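(* Suppose $W:\mathbb{R}^d\to\mathbb{R}$ satisfies assumptions (A), (B), (C') of the context, and let $\mu_0\in\mathcal{P}_2(\mathbb{R}^d)$. For $\tau>0$ small, let $\mu^\tau$ be the piecewise constant interpolation of the minimizing movement scheme with time step $\tau$ starting from $\mu_0$. Then there exist a sequence $\tau_n\searrow0$ and a limit curve $\mu\in AC^2_{loc}([0,+\infty);\mathcal{P}_2(\mathbb{R}^d))$ such that \[ \mu_n(t):=\mu^{\tau_n}(t)\to\mu(t)\quad\text{narrowly as }n\to+\infty \] for all $t\in[0,+\infty)$.
   Context: $\mathcal{P}_2(\mathbb{R}^d)$ is the set of Borel probability measures on $\mathbb{R}^d$ with finite second moment, endowed with the 2-Wasserstein distance $W_2$. Narrow convergence is convergence against bounded continuous functions. $AC^2_{loc}([0,+\infty);\mathcal{P}_2(\mathbb{R}^d))$ is the set of curves that are locally absolutely continuous with respect to $W_2$ with metric derivative in $L^2_{loc}$. Assumptions: (A) $W$ is continuous, $W(x)=W(-x)$, $W(0)=0$, $W\in C^1(\mathbb{R}^d\setminus\{0\})$. (B) There is $C>0$ with $W(z)\le C(1+|z|^2)$ for all $z\in\mathbb{R}^d$. (C') There are $\lambda',\lambda''\ge0$ such that $W(x)+\frac{\lambda''}{2}|x|^2+\lambda'|x|$ is convex. Interaction energy: $\mathcal{W}[\mu]=\frac12\int_{\mathbb{R}^d\times\mathbb{R}^d}W(x-y)\,d\mu(x)d\mu(y)$. Minimizing movement scheme: $\mu_0^\tau=\mu_0$ and, recursively, $\mu^\tau_{k+1}\in\operatorname{argmin}_{\mu\in\mathcal{P}_2(\mathbb{R}^d)}\{\mathcal{W}[\mu]+\frac{1}{2\tau}W_2^2(\mu^\tau_k,\mu)\}$.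 Piecewise constant interpolation: $\mu^\tau(0)=\mu_0$ and $\mu^\tau(t)=\mu^\tau_k$ for $t\in((k-1)\tau,k\tau]$, $k\ge1$. *)

(* Defs.v *)
From HB Require Import structures.
From mathcomp Require Import all_boot all_order all_algebra.
From mathcomp Require Import all_classical all_reals all_analysis.
Set Implicit Arguments.
Unset Strict Implicit.
Unset Printing Implicit Defensive.
Import Order.TTheory GRing.Theory Num.Theory.
Import numFieldNormedType.Exports.
Local Open Scope classical_set_scope.
Local Open Scope ring_scope.

(* The library norm on ['rV[R]_d] is the sup norm (same topology); the
   Euclidean norm is needed in (B), (C') and in the transport cost. *)
Definition enorm (R : realType) (d : nat) (x : 'rV[R]_d) : R :=
  Num.sqrt (\sum_(i < d) x ord0 i ^+ 2).

(* ['rV[R]_d] with its Borel sigma-algebra; the carrier is convertible to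
   ['rV[R]_d], which is what the type ascriptions below rely on. *)
Definition borel_rV (R : realType) (d : nat) :=
  g_sigma_algebraType (@open 'rV[R]_d).

Notation borel_prob R d := (probability (borel_rV R d) R).

(* In finite dimension, continuity of all directional derivatives amounts to
   continuity of the differential. *)
Definition C1_off_origin (R : realType) (d : nat) (W : 'rV[R]_d -> R) : Prop :=
  forall x : 'rV[R]_d, x != 0 ->
    differentiable W x /\
    forall v : 'rV[R]_d, {for x, continuous (fun y : 'rV[R]_d => 'D_v W y)}.

Definition assumption_A (R : realType) (d : nat) (W : 'rV[R]_d -> R) : Prop :=
  [/\ continuous W, forall x, W x = W (- x), W 0 = 0 & C1_off_origin W].

Definition assumption_B (R : realType) (d : nat) (W : 'rV[R]_d -> R) : Prop :=
  exists2 C : R, 0 < C & forall z, W z <= C * (1 + enorm z ^+ 2).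

Definition assumption_C' (R : realType) (d : nat) (W : 'rV[R]_d -> R) : Prop :=
  exists l' l'' : R, [/\ 0 <= l', 0 <= l'' &
    convex_function [set: 'rV[R]_d]
      (fun x : 'rV[R]_d => W x + l'' / 2 * enorm x ^+ 2 + l' * enorm x)].

Definition P2 (R : realType) (d : nat) : set (borel_prob R d) :=
  [set mu : borel_prob R d | (\int[mu]_x (enorm (x : 'rV[R]_d) ^+ 2)%:E < +oo)%E].

Definition coupling (R : realType) (d : nat) (mu nu : borel_prob R d) :
    set (probability (borel_rV R d * borel_rV R d)%type R) :=
  [set gamma : probability (borel_rV R d * borel_rV R d)%type R |
     forall A : set (borel_rV R d), measurable A ->
     gamma (A `*` setT) = mu A /\ gamma (setT `*` A) = nu A].

Definition W2 (R : realType) (d : nat) (mu nu : borel_prob R d) : \bar R :=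
  sqrte (ereal_inf
    [set (\int[gamma]_z (enorm ((z.1 : 'rV[R]_d) - (z.2 : 'rV[R]_d)) ^+ 2)%:E)%E
    | gamma in coupling mu nu]).

Definition narrow_cvg (R : realType) (d : nat)
    (mu_ : nat -> borel_prob R d) (mu : borel_prob R d) : Prop :=
  forall f : 'rV[R]_d -> R, continuous f ->
    (exists M : R, forall x, `|f x| <= M) ->
    ((\int[mu_ n]_x (f x)%:E)%E @[n --> \oo] --> (\int[mu]_x (f x)%:E)%E).

Definition L1_loc (R : realType) (g : R -> R) : Prop :=
  forall T : R, 0 < T ->
    (@lebesgue_measure R).-integrable `[0, T] (EFin \o g).

Definition L2_loc (R : realType) (g : R -> R) : Prop :=
  forall T : R, 0 < T ->
    measurable_fun (`[0, T] : set R) g /\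
    (\int[@lebesgue_measure R]_(t in `[0%R, T]) (g t ^+ 2)%:E < +oo)%E.

(* Curves on [0, +oo[ are functions on [R] whose values at negative times are
   left unconstrained, here and in the definitions below. *)
Definition locally_AC (R : realType) (d : nat) (mu : R -> borel_prob R d) :
    Prop :=
  exists2 m : R -> R, L1_loc m &
    forall s t : R, 0 <= s -> s <= t ->
      (W2 (mu s) (mu t) <= \int[@lebesgue_measure R]_(r in `[s, t]) (m r)%:E)%E.

Definition is_metric_derivative (R : realType) (d : nat)
    (mu : R -> borel_prob R d) (g : R -> R) : Prop :=
  {ae @lebesgue_measure R, forall t : R, 0 < t ->
    (W2 (mu s) (mu t) * (`|s - t|^-1)%:E)%E @[s --> t^'] --> (g t)%:E}.

Definition AC2_loc (R : realType) (d : nat) (mu : R -> borel_prob R d) : Prop :=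
  [/\ forall t, 0 <= t -> P2 (mu t), locally_AC mu &
      exists2 g : R -> R, is_metric_derivative mu g & L2_loc g].

Definition interaction_energy (R : realType) (d : nat) (W : 'rV[R]_d -> R)
    (mu : borel_prob R d) : \bar R :=
  ((2^-1)%:E *
   \int[(mu \x mu)%E]_z (W ((z.1 : 'rV[R]_d) - (z.2 : 'rV[R]_d)))%:E)%E.

Definition mm_functional (R : realType) (d : nat) (W : 'rV[R]_d -> R)
    (tau : R) (nu mu : borel_prob R d) : \bar R :=
  (interaction_energy W mu + ((2 * tau)^-1)%:E * W2 nu mu ^+ 2)%E.

Definition argmin_mm (R : realType) (d : nat) (W : 'rV[R]_d -> R)
    (tau : R) (nu : borel_prob R d) : set (borel_prob R d) :=
  [set mu : borel_prob R d | P2 mu /\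
     forall mu', P2 mu' ->
       (mm_functional W tau nu mu <= mm_functional W tau nu mu')%E].

Definition mm_scheme (R : realType) (d : nat) (W : 'rV[R]_d -> R)
    (mu0 : borel_prob R d) (tau : R) (M : nat -> borel_prob R d) : Prop :=
  M 0%N = mu0 /\ forall k, argmin_mm W tau (M k) (M k.+1).

Definition pwc_interpolation (R : realType) (d : nat) (tau : R)
    (M : nat -> borel_prob R d) (c : R -> borel_prob R d) : Prop :=
  c 0 = M 0%N /\
  forall (k : nat) (t : R), k%:R * tau < t -> t <= k.+1%:R * tau ->
    c t = M k.+1.

(* Main.v *)
(* Let [mu^tau] be the interpolated scheme. Under (A), (B), (C') the energy is
   bounded by [1 + m_2] from both sides, so comparing [mu_{k+1}] with [mu_k] and a
   discrete Gronwall argument bound the second moments and the sum of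
   [W_2^2(mu_k, mu_{k+1}) / tau] on bounded time intervals, uniformly in [tau].
   This yields nondecreasing functions [F], [e] with [W_2(mu^tau s, mu^tau t) <=
   F t - F s] and [2 (F t - F s) <= k (t - s + tau) + (e t - e s) / k] for every
   [k > 0]. Tightness gives a limit along an ultrafilter for each [t], with [F]
   and [e] passing to the limit; testing against countably many open sets at
   rational times and using the (asymptotic) equicontinuity provides a subsequence
   converging narrowly at all times.

   For the limit curve the inequality with [tau = 0] says that [dF] is absolutely
   continuous with a density [rho] in [L^2_loc]. The metric derivative is
   [sup_q |d/dt W_2(mu q, mu t)|], [q] rational, which is at most [rho]; that it
   is a limit of difference quotients follows from the differentiability almost
   everywhere of the functions involved. *)
Require Import Defs.
From HB Require Import structures.
From mathcomp Require Import all_boot all_order all_algebra.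
From mathcomp Require Import all_classical all_reals all_analysis.
From mathcomp Require Import measurable_realfun ring lra.
Set Implicit Arguments.
Unset Strict Implicit.
Unset Printing Implicit Defensive.
Import Order.TTheory GRing.Theory Num.Theory.
Import numFieldNormedType.Exports.
Local Open Scope classical_set_scope.
Local Open Scope ring_scope.

(** * Euclidean norm and Borel sets *)

(** The ultrafilter serves all times at once: it fixes the limits of the measures, of [F] and of [e]
    at uncountably many [t] before any extraction. It is not a sequence, so narrow convergence is
    recast as the open-set criterion [liminf_open]. Finite unions of rational boxes suffice for that
    criterion; at rational times this is a countable list of conditions, open to a diagonal
    argument. Lipschitz tests, which [w2] controls, then reach the other times.

    [W] need not be bounded below, so the energy alone does not bound the moments. The Gronwall
    argument runs on the energy plus a multiple of the squared moment, whose growth is paid by the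
    dissipation when [tau] is small.

    Cauchy-Schwarz and Minkowski appear in the linearised form of Young, with a free parameter. That
    form survives sums, integrals and limits, and becomes an inequality [2 k dP <= k^2 dt + dE]
    between Stieltjes measures: large [k] gives absolute continuity, [k] close to the density gives
    square integrability. *)

Section enorm.
Context {R : realType} {d : nat}.
Implicit Types x y z : 'rV[R]_d.

Lemma sumsq_ge0 x : 0 <= \sum_(i < d) x ord0 i ^+ 2.
Proof. by apply: sumr_ge0 => i _; exact: sqr_ge0. Qed.

Lemma enorm_ge0 x : 0 <= enorm x. Proof. exact: sqrtr_ge0. Qed.

Lemma sqr_enorm x : enorm x ^+ 2 = \sum_(i < d) x ord0 i ^+ 2.
Proof. by rewrite sqr_sqrtr// sumsq_ge0. Qed.

Lemma enormN x : enorm (- x) = enorm x.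
Proof. by congr Num.sqrt; apply: eq_bigr => i _; rewrite mxE sqrrN. Qed.

Lemma enormB x y : enorm (x - y) = enorm (y - x).
Proof. by rewrite -enormN opprB. Qed.

Lemma enorm0 : enorm (0 : 'rV[R]_d) = 0.
Proof.
by rewrite /enorm big1 ?sqrtr0// => i _; rewrite mxE expr0n.
Qed.

Lemma coord_le_enorm x i : `|x ord0 i| <= enorm x.
Proof.
rewrite -(@ler_pXn2r _ 2) ?nnegrE ?enorm_ge0//.
rewrite sqr_enorm real_normK ?num_real// (bigD1 i)//= lerDl.
by apply: sumr_ge0 => j _; exact: sqr_ge0.
Qed.

Lemma young (a b t : R) : 0 < t -> 2 * (a * b) <= t * a ^+ 2 + t^-1 * b ^+ 2.
Proof.
move=> t0; rewrite -subr_ge0.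
have -> : t * a ^+ 2 + t^-1 * b ^+ 2 - 2 * (a * b) = t^-1 * (t * a - b) ^+ 2.
  by field; rewrite gt_eqF.
by rewrite mulr_ge0 ?sqr_ge0// invr_ge0 ltW.
Qed.

Lemma enorm_young x y (s : R) : 0 < s ->
  enorm (x + y) ^+ 2 <= (1 + s) * enorm x ^+ 2 + (1 + s^-1) * enorm y ^+ 2.
Proof.
move=> s0; rewrite !sqr_enorm !mulr_sumr -big_split/=; apply: ler_sum => i _.
rewrite mxE; have := young (x ord0 i) (y ord0 i) s0.
by rewrite sqrrD -mulr_natl; lra.
Qed.

(** For positive [a] and [b] the right-hand side is smallest at [s = b / a], where it equals
    [(a + b)^2]. Minkowski inequalities thus reduce to a family that is linear in the squares and
    can be integrated. *)
Lemma le_add_of_young (a b c : R) : 0 <= a -> 0 <= b -> 0 <= c ->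
  (forall s, 0 < s -> c ^+ 2 <= (1 + s) * a ^+ 2 + (1 + s^-1) * b ^+ 2) ->
  c <= a + b.
Proof.
move=> a0 b0 c0 H; apply/ler_addgt0Pr => e e0.
(* Both numbers are made positive so that [b' / a'] is an admissible parameter; the two halves of
   [e] pay for it. *)
have [a' a'E] : exists a', a' = a + e / 2 by exists (a + e / 2).
have [b' b'E] : exists b', b' = b + e / 2 by exists (b + e / 2).
have a'0 : 0 < a' by rewrite a'E ltr_wpDl// divr_gt0.
have b'0 : 0 < b' by rewrite b'E ltr_wpDl// divr_gt0.
have aa' : a <= a' by rewrite a'E lerDl divr_ge0// ltW.
have bb' : b <= b' by rewrite b'E lerDl divr_ge0// ltW.
suff : c ^+ 2 <= (a' + b') ^+ 2.
  rewrite ler_pXn2r ?nnegrE//; last by rewrite addr_ge0// ltW.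
  by move/le_trans; apply; rewrite a'E b'E addrACA -splitr.
have s0 := divr_gt0 b'0 a'0.
apply: (le_trans (H _ s0)).
have -> : (a' + b') ^+ 2 = (1 + b' / a') * a' ^+ 2 + (1 + (b' / a')^-1) * b' ^+ 2.
  by field; rewrite (gt_eqF a'0) (gt_eqF b'0).
apply: lerD; apply: ler_wpM2l.
- by rewrite addr_ge0// ltW.
- by rewrite ler_pXn2r ?nnegrE// ltW.
- by rewrite addr_ge0// invr_ge0 ltW.
- by rewrite ler_pXn2r ?nnegrE// ltW.
Qed.

Lemma enormD x y : enorm (x + y) <= enorm x + enorm y.
Proof.
apply: le_add_of_young; rewrite ?enorm_ge0// => s s0; exact: enorm_young.
Qed.

Lemma enorm_dist x y : `|enorm x - enorm y| <= enorm (x - y).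
Proof.
rewrite ler_norml; apply/andP; split.
- by have := enormD (y - x) x; rewrite subrK enormB; lra.
- by have := enormD (x - y) y; rewrite subrK; lra.
Qed.

Lemma enorm_le_sup x c : 0 <= c -> (forall i, `|x ord0 i| <= c) ->
  enorm x <= d%:R * c.
Proof.
move=> c0 h; rewrite -(@ler_pXn2r _ 2) ?nnegrE ?enorm_ge0 ?mulr_ge0//.
rewrite sqr_enorm; apply: (@le_trans _ _ (\sum_(i < d) c ^+ 2)).
  apply: ler_sum => i _; rewrite -(real_normK (num_real _)).
  by rewrite ler_pXn2r ?nnegrE.
rewrite sumr_const card_ord exprMn -[leLHS]mulr_natl ler_wpM2r ?sqr_ge0//.
by rewrite -natrX ler_nat; case: d => // n; rewrite leq_pmulr.
Qed.

Lemma lipschitz_continuous (f : 'rV[R]_d -> R) (L : R) :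
  (forall x y, `|f x - f y| <= L * enorm (x - y)) -> continuous f.
Proof.
move=> fL x; apply/(@cvgrPdist_le R R 'rV[R]_d (nbhs x) _ f (f x)) => e e0.
(* The factor [d] compares the Euclidean norm with the sup norm; the [+ 1] keeps the denominator
   positive when [L] or [d] is zero. *)
have D0 : 0 < `|L| * d%:R + 1 by rewrite ltr_wpDl// mulr_ge0.
have de0 : 0 < e / (`|L| * d%:R + 1) by rewrite divr_gt0.
near=> y; apply: (le_trans (fL x y)).
apply: (@le_trans _ _ (`|L| * enorm (x - y))).
  by rewrite ler_wpM2r ?enorm_ge0// ler_norm.
apply: (@le_trans _ _ (`|L| * (d%:R * (e / (`|L| * d%:R + 1))))).
  rewrite ler_wpM2l//; apply: enorm_le_sup; first exact: ltW.
  move=> i; rewrite 2!mxE; apply: ltW.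
  have [_ /(_ ord0 i)] : ball x (e / (`|L| * d%:R + 1)) y.
    by near: y; exact: nbhsx_ballx.
  exact.
rewrite (_ : `|L| * (d%:R * (e / (`|L| * d%:R + 1))) = e * (`|L| * d%:R / (`|L| * d%:R + 1))); last by field; rewrite gt_eqF.
by rewrite ler_piMr ?(ltW e0)// ler_pdivrMr// mul1r lerDl.
Unshelve. all: by end_near. Qed.

Lemma enorm_continuous : continuous (@enorm R d).
Proof.
by apply: (@lipschitz_continuous _ 1) => x y; rewrite mul1r enorm_dist.
Qed.

End enorm.

Section borel.
Context {R : realType} {d : nat}.
Local Notation V := (borel_rV R d).

Lemma open_measurable_rV (A : set 'rV[R]_d) : open A -> measurable (A : set V).
Proof. by move=> oA; exact: sub_sigma_algebra. Qed.

Lemma continuous_measurable_rV (f : 'rV[R]_d -> R) : continuous f ->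
  measurable_fun [set: V] (f : V -> R).
Proof.
move=> cf; apply: (measurability _ (measurable_realfun.RGenOpens.measurableE R)).
move=> _ [_ [a [b ->]] <-]; rewrite setTI.
by apply: open_measurable_rV; apply: open_comp => // x _; exact: cf.
Qed.

Lemma measurable_coord i :
  measurable_fun [set: V] (fun x : V => (x : 'rV[R]_d) ord0 i).
Proof. by apply: continuous_measurable_rV; exact: coord_continuous. Qed.

Definition obox (b : 'rV[rat]_d * 'rV[rat]_d) : set 'rV[R]_d :=
  [set x | forall i, ratr (b.1 ord0 i) < x ord0 i < ratr (b.2 ord0 i)].

(** Half-open because [a <= x_i] is the negation of [x_i < a]: lying in such a box is a Boolean
    combination of the events [x_i < q], the only ones whose probabilities are followed to the
    limit. *)
Definition hbox (b : 'rV[rat]_d * 'rV[rat]_d) : set 'rV[R]_d :=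
  [set x | forall i, ratr (b.1 ord0 i) <= x ord0 i < ratr (b.2 ord0 i)].

Lemma obox_hbox b : obox b `<=` hbox b.
Proof. by move=> x bx i; have /andP[/ltW -> ->] := bx i. Qed.

Lemma boxE (op : rel R) (b : 'rV[rat]_d * 'rV[rat]_d) :
  [set x : 'rV[R]_d | forall i, op (ratr (b.1 ord0 i)) (x ord0 i) &&
    (x ord0 i < ratr (b.2 ord0 i))] =
  \bigcap_(i in [set: 'I_d]) ((fun x : 'rV[R]_d => x ord0 i) @^-1`
    [set t | op (ratr (b.1 ord0 i)) t && (t < ratr (b.2 ord0 i))]).
Proof.
apply/seteqP; split => x.
  by move=> h i _; exact: h.
by move=> h i; exact: (h i I).
Qed.

Lemma measurable_obox b d' (T : measurableType d') (f : T -> 'rV[R]_d) :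
  (forall i, measurable_fun setT (fun x => f x ord0 i)) ->
  measurable (f @^-1` (obox b)).
Proof.
move=> mf; rewrite (boxE <%R b : obox b = _) preimage_bigcap.
apply: fin_bigcap_measurable => [|i _]; first exact: finite_finset.
have := mf i measurableT `]ratr (b.1 ord0 i), ratr (b.2 ord0 i)[%classic.
rewrite setTI; apply; exact: measurable_itv.
Qed.

Lemma measurable_hbox b : measurable (hbox b : set V).
Proof.
rewrite (boxE <=%R b : hbox b = _).
apply: fin_bigcap_measurable => [|i _]; first exact: finite_finset.
have := @measurable_coord i measurableT `[ratr (b.1 ord0 i), ratr (b.2 ord0 i)[%classic.
rewrite setTI; apply; exact: measurable_itv.
Qed.

(** The half-open box has to fit, although the open ones already cover an open set: finite unions
    then satisfy [oboxes s <= hboxes s <= A], with room to pass between the two kinds. *)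
Definition boxes_in (A : set 'rV[R]_d) : set ('rV[rat]_d * 'rV[rat]_d) :=
  [set b | hbox b `<=` A].

Lemma open_bigcup_obox (A : set 'rV[R]_d) : open A ->
  A = \bigcup_(b in boxes_in A) obox b.
Proof.
move=> oA; apply/seteqP; split => x; last first.
  by move=> [b bA] /obox_hbox; exact: bA.
move=> Ax; have /nbhs_ballP[e /= e0 eA] := open_nbhs_nbhs (conj oA Ax).
have ex1 i : exists q : rat, x ord0 i - e < ratr q < x ord0 i.
  have [q] := @rat_in_itvoo R (x ord0 i - e) (x ord0 i) ltac:(lra).
  by rewrite in_itv/=; exists q.
have ex2 i : exists q : rat, x ord0 i < ratr q < x ord0 i + e.
  have [q] := @rat_in_itvoo R (x ord0 i) (x ord0 i + e) ltac:(lra).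
  by rewrite in_itv/=; exists q.
have [a ha] := choice ex1; have [b hb] := choice ex2.
exists (\row_i a i, \row_i b i).
  move=> y /= yh; apply: eA => /=; split => // i j; rewrite !ord1.
  have := yh j; have := ha j; have := hb j; rewrite !mxE.
  move=> /andP[? ?] /andP[? ?] /andP[? ?].
  by rewrite /ball/= ltr_distl; apply/andP; split; lra.
by move=> i; rewrite !mxE; have /andP[_ ->] := ha i; have /andP[-> _] := hb i.
Qed.

Lemma measurable_fun_rV d' (T : measurableType d') (f : T -> V) :
  (forall i, measurable_fun setT (fun x => (f x : 'rV[R]_d) ord0 i)) ->
  measurable_fun setT f.
Proof.
move=> mf; have H := @measurability _ _ T V setT f (@open 'rV[R]_d) erefl. apply: H.
move=> _ [A oA <-]; rewrite setTI (open_bigcup_obox oA) preimage_bigcup.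
rewrite bigcup_mkcond.
apply: countable_bigcupT_measurable => // b.
by case: ifPn => // _; exact: measurable_obox.
Qed.

End borel.

(** * Prokhorov compactness along an ultrafilter *)

Section bits.
Context {R : realType}.

(* [s] is read from its end: its last element decides about [b 0]. *)
Fixpoint cell (T : Type) (b : nat -> set T) (s : seq bool) : set T :=
  if s is c :: s' then
    cell b s' `&` (if c then b (size s') else ~` b (size s'))
  else setT.

Lemma measurable_cell d (T : measurableType d) (b : nat -> set T) s :
  (forall k, measurable (b k)) -> measurable (cell b s).
Proof.
move=> mb; elim: s => //= c s ih; apply: measurableI => //.
by case: c => //; exact: measurableC.
Qed.

Let D01 : set (measurableTypeR R) := `[0, 1[%classic.
Let mD01 : measurable D01. Proof. exact: measurable_itv. Qed.

(** The probability space on which all limit laws are realised: Lebesgue measure of the part in [[0,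
    1[]. *)
Definition leb01 : set (measurableTypeR R) -> \bar R :=
  mrestr (@lebesgue_measure R) mD01.
HB.instance Definition _ := Measure.on leb01.
Let leb01_setT : leb01 setT = 1%E.
Proof.
by rewrite /leb01 /mrestr setTI /D01 lebesgue_measure_itv/= lte01 oppr0 adde0.
Qed.
HB.instance Definition _ := Measure_isProbability.Build _ _ _ leb01 leb01_setT.

Variable p : seq bool -> R.
Hypothesis p_ge0 : forall s, 0 <= p s.
Hypothesis p_nil : p [::] = 1.
Hypothesis p_cons : forall s, p s = p (false :: s) + p (true :: s).

(* The cell of [s] will be the interval [[lo s, lo s + p s[]: each interval is cut
   in two pieces of lengths [p (false :: s)] and [p (true :: s)]. *)
Fixpoint lo (s : seq bool) : R :=
  if s is c :: s' then lo s' + (if c then p (false :: s') else 0) else 0.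

Let J s : set R := `[lo s, lo s + p s[%classic.

Let J_false s x : J (false :: s) x -> J s x.
Proof.
rewrite /J /= !in_itv/= addr0 (p_cons s) => /andP[-> /= h].
by apply: (lt_le_trans h); rewrite lerD2l lerDl.
Qed.

Let J_true s x : J (true :: s) x -> J s x.
Proof.
rewrite /J /= !in_itv/= (p_cons s) => /andP[h1 h2]; apply/andP; split.
  by apply: le_trans h1; rewrite lerDl.
by rewrite addrA.
Qed.

Let J_cases s x : J s x -> J (false :: s) x \/ J (true :: s) x.
Proof.
rewrite /J /= !in_itv/= (p_cons s) addr0 addrA => /andP[-> ->].
by case: ltP => _; [left|right].
Qed.

Let J_cons c s x : J (c :: s) x -> J s x.
Proof. by case: c; [exact: J_true|exact: J_false]. Qed.

Let J_excl s x : J (false :: s) x -> J (true :: s) x -> False.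
Proof.
rewrite /J /= !in_itv/= addr0 => /andP[_ h] /andP[h' _].
by have := lt_le_trans h h'; rewrite ltxx.
Qed.

Let J_inj s t x : size s = size t -> J s x -> J t x -> s = t.
Proof.
elim: s t => [[]//|c s ih [|c' t]//= [st]] Js Jt.
have est : s = t by apply: ih => //; [exact: J_cons Js|exact: J_cons Jt].
move: Js Jt; rewrite est.
by case: c; case: c' => // h1 h2; case: (@J_excl t x).
Qed.

(** The [k]-th binary digit for the weights [p]: the union of the right-hand pieces of all intervals
    of generation [k]. *)
Definition bit_set k : set (measurableTypeR R) :=
  \bigcup_(s : seq bool) (if size s == k then J (true :: s) else set0).

Lemma measurable_bit_set k : measurable (bit_set k).
Proof.
apply: countable_bigcupT_measurable => // s.
by case: ifP => _ //; exact: measurable_itv.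
Qed.

Let cellJ s : cell bit_set s `&` D01 = J s.
Proof.
elim: s => [|c s ih] /=.
  by rewrite setTI /J /D01 /= p_nil add0r.
rewrite setIAC ih; apply/seteqP; split => x.
  move=> [Jx]; case: c => [[t _]|nb].
    case: ifPn => // /eqP st Jt.
    by rewrite (J_inj (esym st) Jx (J_true Jt)).
  case: (J_cases Jx) => // Jt; exfalso; apply: nb.
  by exists s => //; rewrite eqxx.
move=> Jx; split; first exact: J_cons Jx.
case: c Jx => Jx; first by exists s => //; rewrite eqxx.
move=> [t _]; case: ifPn => // /eqP st Jt.
have E := J_inj (esym st) (J_false Jx) (J_true Jt).
by move: Jt; rewrite -E => /(J_excl Jx).
Qed.

Lemma leb01_cell s : leb01 (cell bit_set s) = (p s)%:E.
Proof.
rewrite /leb01 /mrestr -/D01 cellJ /J lebesgue_measure_itv/= lte_fin ltrDl.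
case: ltP => [_|p0]; first by rewrite -EFinD addrC addKr.
by congr EFin; apply/eqP; rewrite eq_le p_ge0.
Qed.

End bits.

Section pr.
Context d {T : measurableType d} {R : realType}.
Implicit Type P : probability T R.

Definition pr P (A : set T) : R := fine (P A).

Lemma prE P A : measurable A -> P A = (pr P A)%:E.
Proof. by move=> mA; rewrite /pr fineK// fin_num_measure. Qed.

Lemma pr_ge0 P A : 0 <= pr P A.
Proof. exact: fine_ge0. Qed.

Lemma le_pr P A B : measurable A -> measurable B -> A `<=` B -> pr P A <= pr P B.
Proof.
by move=> mA mB AB; rewrite -lee_fin -!prE// le_measure ?inE.
Qed.

Lemma prT P : pr P setT = 1.
Proof. by rewrite /pr probability_setT. Qed.

Lemma pr_le1 P A : measurable A -> pr P A <= 1.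
Proof. by move=> mA; rewrite -(prT P); exact: le_pr. Qed.

Lemma pr0 P : pr P set0 = 0.
Proof. by rewrite /pr measure0. Qed.

Lemma prU P A B : measurable A -> measurable B -> A `&` B = set0 ->
  pr P (A `|` B) = pr P A + pr P B.
Proof.
move=> mA mB AB; apply: EFin_inj; rewrite EFinD -!prE//; last exact: measurableU.
by rewrite measureU.
Qed.

Lemma pr_split P A B : measurable A -> measurable B ->
  pr P A = pr P (A `&` ~` B) + pr P (A `&` B).
Proof.
move=> mA mB; rewrite -prU; last 3 first.
- by apply: measurableI => //; exact: measurableC.
- exact: measurableI.
- by rewrite setIACA setICl setI0.
by congr (pr P _); rewrite -setIUr setUC setUv setIT.
Qed.

End pr.

Section ultra.
Context {R : realType} (U : set_system nat) {UU : UltraFilter U}.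

(** Compactness of [[-M, M]] gives a cluster point, and an ultrafilter converges to each of its
    cluster points because it contains every set or its complement. *)
Lemma ultra_cvgr (a : nat -> R) (M : R) : (forall n, `|a n| <= M) ->
  exists l : R, a n @[n --> U] --> l.
Proof.
move=> aM.
have PF : ProperFilter U by exact: ultra_proper.
have aU : (a @ U) `[-M, M]%classic.
  by apply: (@filterS _ U _ setT) => [n _|]; [have := aM n; rewrite ler_norml /= in_itv|exact: filterT].
have [l [_ lc]] := @segment_compact R (- M) M (a @ U) _ aU.
exists l => O lO; have [//|H] := in_ultra_setVsetC (a @^-1` O) UU.
by have [x []] := lc (~` O) O H lO.
Qed.

End ultra.

Section transfer.
Context {R : realType} (U : set_system nat) {UU : UltraFilter U}.

Definition bits_of (T : Type) (b : nat -> set T) (x : T) : nat -> bool :=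
  fun j => `[< b j x >].

Definition finitary (k : nat) (phi : (nat -> bool) -> Prop) :=
  forall f g, (forall j, (j < k)%N -> f j = g j) -> phi f -> phi g.

Lemma cell_bits_of (T : Type) (b : nat -> set T) s x : cell b s x ->
  forall j, (j < size s)%N -> bits_of b x j = nth false (rev s) j.
Proof.
elim: s => // c s ih /= [/ih xs xc] j; rewrite ltnS leq_eqVlt => /predU1P[->|js].
  rewrite rev_cons nth_rcons size_rev ltnn eqxx /bits_of.
  by move: xc; case: c => ?; [exact: asboolT|exact: asboolF].
by rewrite rev_cons nth_rcons size_rev js xs.
Qed.

Lemma cell_finitary (T : Type) (b : nat -> set T) s phi :
  finitary (size s) phi -> cell b s `&` [set x | phi (bits_of b x)] =
  if `[< phi (nth false (rev s)) >] then cell b s else set0.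
Proof.
move=> fphi; apply/seteqP; split => x.
  move=> [sx /= px]; rewrite asboolT//.
  by apply: fphi px => j js; exact: cell_bits_of.
case: ifPn => // /asboolP ps sx; split => //=.
by apply: fphi ps => j js; rewrite (cell_bits_of sx).
Qed.

Lemma cell_finitary_split (T : Type) (b : nat -> set T) s (A : set T) :
  cell b s `&` A = (cell b (false :: s) `&` A) `|` (cell b (true :: s) `&` A).
Proof. by rewrite -setIUl /= -setIUr setUC setUv setIT. Qed.

Lemma measurable_cell_finitary d (T : measurableType d) (b : nat -> set T) k phi n s :
  (forall j, measurable (b j)) -> finitary k phi -> (n + size s = k)%N ->
  measurable (cell b s `&` [set x | phi (bits_of b x)]).
Proof.
move=> mb; elim: n s => [|n ih] s fphi nk.
  rewrite cell_finitary; last by rewrite -nk in fphi.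
  by case: ifP => // _; exact: measurable_cell.
by rewrite cell_finitary_split; apply: measurableU; apply: ih => //=; rewrite addnS -nk.
Qed.

Lemma measurable_finitary d (T : measurableType d) (b : nat -> set T) k phi :
  (forall j, measurable (b j)) -> finitary k phi ->
  measurable [set x | phi (bits_of b x)].
Proof.
move=> mb fphi.
have := @measurable_cell_finitary _ _ b k phi k [::] mb fphi (addn0 k).
by rewrite setTI.
Qed.

(** An event that depends on the first [k] bits is a finite disjoint union of cells of depth [k].
    The induction splits a cell until that depth, where the event contains the cell or misses it. *)
Lemma transfer d (T : measurableType d) (nu_ : nat -> probability T R)
    (B : nat -> set T) d' (T' : measurableType d') (P : probability T' R)
    (b : nat -> set T') k phi :
  (forall j, measurable (B j)) -> (forall j, measurable (b j)) ->
  (forall s, pr (nu_ n) (cell B s) @[n --> U] --> pr P (cell b s)) ->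
  finitary k phi ->
  pr (nu_ n) [set x | phi (bits_of B x)] @[n --> U] --> pr P [set x | phi (bits_of b x)].
Proof.
move=> mB mb cvgs fphi.
have PF : ProperFilter U by exact: ultra_proper.
suff H n s : (n + size s = k)%N ->
    pr (nu_ n) (cell B s `&` [set x | phi (bits_of B x)]) @[n --> U] -->
    pr P (cell b s `&` [set x | phi (bits_of b x)]).
  by have := H k [::] (addn0 k); rewrite /= !setTI.
elim: n s => [|n ih] s nk.
  rewrite !cell_finitary; [|by rewrite -nk in fphi..].
  case: ifP => _; first exact: cvgs.
  by rewrite pr0; under eq_fun do rewrite pr0; exact: cvg_cst.
have nk' c : (n + size (c :: s) = k)%N by rewrite /= addnS -nk.
have disj T0 (b0 : nat -> set T0) A : (cell b0 (false :: s) `&` A) `&` (cell b0 (true :: s) `&` A) = set0.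
  by rewrite setIACA /= (setIACA (cell b0 s)) setICl setI0 set0I.
rewrite !(cell_finitary_split _ s) prU//; last 2 first.
  by apply: (measurable_cell_finitary mb fphi (nk' _)).
  by apply: (measurable_cell_finitary mb fphi (nk' _)).
under eq_fun.
  move=> n0; rewrite prU//; last 2 first.
    by apply: (measurable_cell_finitary mB fphi (nk' _)).
  by apply: (measurable_cell_finitary mB fphi (nk' _)).
  over.
by apply: cvgD; apply: ih; exact: nk'.
Qed.

End transfer.

Section law.
Context d d' {T : measurableType d} {T' : measurableType d'} {R : realType}.
Variables (P : probability T R) (f : T -> T') (mf : measurable_fun setT f).

Let mf_pack : {mfun T >-> T'} := HB.pack f (isMeasurableFun.Build _ _ _ _ _ mf).

Definition law : probability T' R := distribution P mf_pack.

Lemma pr_law A : pr law (A : set T') = pr P (f @^-1` A). Proof. by []. Qed.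

End law.

Lemma cvgr_le_cst {R : realType} (T : Type) (F : set_system T) {PF : ProperFilter F}
    (a : T -> R) (l e : R) : a n @[n --> F] --> l -> (\forall n \near F, a n <= e) ->
  l <= e.
Proof.
move=> al ae; rewrite -(cvg_lim (@Rhausdorff R) al); apply: limr_le => //.
by apply/cvg_ex; exists l.
Qed.

(** * Approximation of open sets by finite unions of rational boxes *)

Section open_inner.
Context {R : realType} {m : nat}.
Local Notation V := (borel_rV R m).
Implicit Types (s : seq ('rV[rat]_m * 'rV[rat]_m)).

Definition oboxes s : set 'rV[R]_m := [set x | exists2 b, b \in s & obox b x].

Definition hboxes s : set 'rV[R]_m := [set x | exists2 b, b \in s & hbox b x].

Lemma oboxes_hboxes s : oboxes s `<=` hboxes s.
Proof. by move=> x [b bs /obox_hbox bx]; exists b. Qed.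

Lemma oboxesE s : oboxes s = \bigcup_(b in [set` s]) obox b.
Proof. by apply/seteqP; split => x [b bs bx]; exists b. Qed.

Lemma hboxesE s : hboxes s = \bigcup_(b in [set` s]) hbox b.
Proof. by apply/seteqP; split => x [b bs bx]; exists b. Qed.

Lemma measurable_oboxes s : measurable (oboxes s : set V).
Proof.
rewrite oboxesE; apply: fin_bigcup_measurable => [|b _]; first exact: finite_seq.
by apply: (@measurable_obox R m b _ V id) => i; exact: measurable_coord.
Qed.

Lemma measurable_hboxes s : measurable (hboxes s : set V).
Proof.
rewrite hboxesE; apply: fin_bigcup_measurable => [|b _]; first exact: finite_seq.
exact: measurable_hbox.
Qed.

(** [A] is the increasing union of the finite unions of its first [n] boxes in an enumeration, so
    continuity from below applies. *)
Lemma open_inner (nu : borel_prob R m) (A : set 'rV[R]_m) (e : R) : open A -> 0 < e ->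
  exists2 s, hboxes s `<=` A & pr nu (A : set V) <= pr nu (oboxes s : set V) + e.
Proof.
move=> oA e0.
pose s_ n := [seq b <- pmap unpickle (iota 0 n) | `[< hbox b `<=` A >]].
have sA n : hboxes (s_ n) `<=` A.
  move=> x [b]; rewrite mem_filter => /andP[/asboolP bA _]; exact: bA.
have mem_s b n : hbox b `<=` A -> (pickle b < n)%N -> b \in s_ n.
  move=> bA bn; rewrite mem_filter asboolT//= mem_pmap; apply/mapP.
  by exists (pickle b); rewrite ?mem_iota// pickleK.
have UA : \bigcup_n (oboxes (s_ n)) = A.
  apply/seteqP; split => [x [n _ /oboxes_hboxes]|x]; first exact: sA.
  rewrite [X in X x -> _](open_bigcup_obox oA) => -[b bA bx].
  by exists (pickle b).+1 => //; exists b => //; apply: mem_s.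
have ms n : measurable (oboxes (s_ n) : set V) by exact: measurable_oboxes.
have mA : measurable (A : set V) by exact: open_measurable_rV.
have nd : {homo (fun n => oboxes (s_ n) : set V) : n m / (n <= m)%N >-> (n <= m)%O}.
  move=> n k nk; apply/subsetPset => x [b bs bx]; exists b => //.
  move: bs; rewrite !mem_filter => /andP[->]/=.
  rewrite !mem_pmap => /mapP[j]; rewrite mem_iota/= add0n => jn jb.
  by apply/mapP; exists j => //; rewrite mem_iota/= add0n (leq_trans jn).
have : nu (oboxes (s_ n) : set V) @[n --> \oo] --> (pr nu (A : set V))%:E.
  rewrite -prE// -[in X in _ --> X]UA.
  by apply: (nondecreasing_cvg_mu _ _ nd) => //; rewrite UA.
move=> /fine_cvgP [_ H].
have [n _ /(_ n (leqnn n)) /= Hn] := cvgr_ge _ H (pr nu (A : set V) - e) ltac:(by rewrite ltrBlDr ltrDl).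
by exists (s_ n); [exact: sA|rewrite -lerBlDr].
Qed.

End open_inner.

Lemma pr_countable_null d (T : measurableType d) {R : realType} (P : probability T R)
    (I : countType) (F : I -> set T) :
  (forall i, measurable (F i)) -> (forall i, pr P (F i) = 0) ->
  measurable (\bigcup_i F i) /\ pr P (\bigcup_i F i) = 0.
Proof.
move=> mF PF; split; first exact: countable_bigcupT_measurable.
pose G k := if unpickle k is Some i then F i else set0.
have -> : \bigcup_i F i = \bigcup_k G k.
  apply/seteqP; split => x [i _ ix]; first by exists (pickle i) => //; rewrite /G pickleK.
  by move: ix; rewrite /G; case: unpickle => // j jx; exists j.
rewrite /pr (@measure_negligible _ _ _ P (\bigcup_k G k))//.
  by apply: bigcupT_measurable => k; rewrite /G; case: unpickle.
apply: negligible_bigcup => k; rewrite /G; case: unpickle => [i|]; last exact: negligible_set0.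
by apply/negligibleP => //; have := prE P (mF i); rewrite PF.
Qed.

(** The portmanteau form of narrow convergence, [nu A <= liminf nu_n A] for open [A], along an
    arbitrary filter. *)
Definition liminf_open {R : realType} {m : nat} (F : set_system nat)
    (nu_ : nat -> borel_prob R m) (nu : borel_prob R m) :=
  forall (A : set 'rV[R]_m) (e : R), open A -> 0 < e ->
    \forall n \near F, pr nu (A : set (borel_rV R m)) <=
                       pr (nu_ n) (A : set (borel_rV R m)) + e.

Section prokhorov.
Context {R : realType} {m : nat} (U : set_system nat) {UU : UltraFilter U}.
Local Notation V := (borel_rV R m).
Variable nu_ : nat -> borel_prob R m.
Hypothesis tight : forall e : R, 0 < e -> exists K : R, forall n,
  pr (nu_ n) ([set x | K <= enorm x] : set V) <= e.

Let PU : ProperFilter U. Proof. exact: ultra_proper. Qed.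

(** An enumeration of the events [x_i < q]; integers that code no pair get the empty event. *)
Let B (k : nat) : set V :=
  if (unpickle k : option ('I_m * rat)) is Some iq
  then [set x : 'rV[R]_m | x ord0 iq.1 < ratr iq.2] else set0.

Let BE i q : B (pickle (i, q)) = [set x : 'rV[R]_m | x ord0 i < ratr q].
Proof. by rewrite /B pickleK. Qed.

Let mB k : measurable (B k).
Proof.
rewrite /B; case: unpickle => // -[i q] /=.
have := @measurable_coord R m i measurableT `]-oo, ratr q[%classic (measurable_itv _).
by rewrite setTI; congr measurable; apply/seteqP; split => x; rewrite /= in_itv.
Qed.

(** The limits [p s] of the cell probabilities are nonnegative, equal to 1 at the root, and additive
    over the two children of a cell, which is what the cutting of [[0, 1[] into intervals
    requires. *)
Lemma limit_bits : exists2 b : nat -> set (measurableTypeR R),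
  forall k, measurable (b k) &
  forall s, pr (nu_ n) (cell B s) @[n --> U] --> pr (@leb01 R) (cell b s).
Proof.
have mc s : measurable (cell B s) by exact: measurable_cell.
have /choice[p pP] s : exists l : R, pr (nu_ n) (cell B s) @[n --> U] --> l.
  by apply: (ultra_cvgr (M := 1)) => n; rewrite ger0_norm ?pr_ge0 ?pr_le1.
have p0 s : 0 <= p s.
  rewrite -oppr_le0; apply: (cvgr_le_cst (cvgN (pP s))).
  by apply: nearW => n /=; rewrite oppr_le0 pr_ge0.
have p1 : p [::] = 1.
  apply: (@cvg_unique _ (@Rhausdorff R) _ _ _ _ (pP [::])).
  by rewrite /=; under eq_fun do rewrite prT; exact: cvg_cst.
have pc s : p s = p (false :: s) + p (true :: s).
  apply: (@cvg_unique _ (@Rhausdorff R) _ _ _ _ (pP s)).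
  rewrite (_ : (fun n => pr (nu_ n) (cell B s)) = (fun n =>
      pr (nu_ n) (cell B (false :: s)) + pr (nu_ n) (cell B (true :: s)))).
    exact: cvgD (pP _) (pP _).
  by apply/funext => n; exact: pr_split.
exists (bit_set p); first exact: measurable_bit_set.
move=> s; have -> : pr (@leb01 R) (cell (bit_set p) s) = p s.
  exact: (congr1 fine (leb01_cell p0 p1 pc s)).
exact: pP.
Qed.

(* Along [U] the probabilities of all the finite Boolean combinations of the events
   [x_i < q] converge; realising their limits by sets [A i q] in [[0, 1[], the
   limit is the law of the vector with coordinates [sup {q | u \notin A i q}]. *)
Lemma prokhorov_ultra : exists nu : borel_prob R m, liminf_open U nu_ nu.
Proof.
have [b mb cb] := limit_bits.
have TL k phi := transfer (UU := UU) (k := k) (phi := phi) mB mb cb.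
pose P : probability (measurableTypeR R) R := @leb01 R.
pose A i q := b (pickle (i : 'I_m, q : rat)).
have mA i q : measurable (A i q) by exact: mb.
have bitE T (c : nat -> set T) j : [set x | bits_of c x j] = c j.
  by apply/seteqP; split => x /= /asboolP.
have nbitE T (c : nat -> set T) j : [set x | ~~ bits_of c x j] = ~` c j.
  by apply/seteqP; split => x /= /asboolPn.
have fin1 (g : bool -> bool) j : finitary j.+1 (fun f => g (f j)).
  by move=> f f' ff' /=; rewrite (ff' j (ltnSn j)).
(* Before the limit this event is empty, and it depends on finitely many bits. *)
have A_mono i (q q' : rat) : q <= q' -> pr P (A i q `&` ~` A i q') = 0.
  move=> qq'; pose ja := pickle (i, q); pose jb := pickle (i, q').
  have fphi : finitary (maxn ja jb).+1 (fun f => f ja /\ ~~ f jb).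
    by move=> f g fg [fj fj']; rewrite -!fg// ltnS ?leq_maxr ?leq_maxl.
  have := TL _ _ fphi.
  have E T (c : nat -> set T) : [set x | bits_of c x ja /\ ~~ bits_of c x jb] = c ja `&` ~` c jb.
    by rewrite -bitE -nbitE.
  rewrite !E /ja /jb !BE.
  rewrite (_ : _ `&` _ = set0); last first.
    apply/seteqP; split => // x /= [h1 h2]; apply: h2; apply: (lt_le_trans h1).
    by rewrite ler_rat.
  rewrite (_ : (fun n => pr (nu_ n) _) = cst 0); last by apply/funext => n; exact: pr0.
  move=> H; apply/esym; apply: (@cvg_unique _ (@Rhausdorff R) _ _ _ _ _ H).
  exact: cvg_cst.
(* Tightness enters here: no mass escapes to infinity along a coordinate. *)
have A_tail i (e : R) : 0 < e -> exists N : nat,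
    pr P (A i (- N%:R)) <= e /\ pr P (~` A i N%:R) <= e.
  move=> e0; have [K HK] := tight e0.
  have [N KN] : exists N : nat, K < N%:R.
    by exists (Num.bound `|K|); rewrite (le_lt_trans (ler_norm _))// archi_boundP.
  have mK : measurable ([set x : 'rV[R]_m | K <= enorm x] : set V).
    have := continuous_measurable_rV (@enorm_continuous R m) measurableT (measurable_itv `[K, +oo[).
    by rewrite setTI; congr measurable; apply/seteqP; split => x; rewrite /= in_itv/= andbT.
  exists N; split.
    have := TL _ _ (fin1 id (pickle (i, - N%:R : rat))).
    rewrite !bitE BE => /cvgr_le_cst; apply; apply: nearW => n.
    apply: le_trans (HK n); apply: le_pr => //; first by rewrite -BE.
    move=> x /=; rewrite rmorphN/= ratr_nat => xN; rewrite ltW//.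
    apply: lt_le_trans (coord_le_enorm x i).
    by rewrite (lt_le_trans KN)// -normrN (le_trans _ (ler_norm _))// lerNr ltW.
  have := TL _ _ (fin1 negb (pickle (i, N%:R : rat))).
  rewrite !nbitE BE => /cvgr_le_cst; apply; apply: nearW => n.
  apply: le_trans (HK n); apply: le_pr => //; first by apply: measurableC; rewrite -BE.
  move=> x /= /negP; rewrite -leNgt ratr_nat => xN.
  apply: le_trans (coord_le_enorm x i).
  by rewrite (le_trans (ltW KN))// (le_trans xN)// ler_norm.
(* Off these null sets [A i q] is monotone in [q] ([N1]), fails for some [q] ([N2]) and holds for
   some [q] ([N3]), so that [S i u] is nonempty and bounded above. *)
pose N1 := \bigcup_(k : 'I_m * rat * rat)
  (if k.1.2 <= k.2 then A k.1.1 k.1.2 `&` ~` A k.1.1 k.2 else set0).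
pose N2 := \bigcup_(i : 'I_m) \bigcap_(n : nat) A i (- n%:R).
pose N3 := \bigcup_(i : 'I_m) \bigcap_(n : nat) ~` A i n%:R.
have [mN1 PN1] : measurable N1 /\ pr P N1 = 0.
  apply: pr_countable_null => -[[i q] q'] /=; case: ifPn => // qq'.
  - by apply: measurableI => //; exact: measurableC.
  - exact: A_mono.
  - by rewrite pr0.
have [mN2 PN2] : measurable N2 /\ pr P N2 = 0.
  apply: pr_countable_null => i; first exact: bigcapT_measurable.
  apply/eqP; rewrite eq_le pr_ge0 andbT; apply/ler_addgt0Pr => e e0; rewrite add0r.
  have [n [+ _]] := A_tail i e e0; apply: le_trans; apply: le_pr => //.
    exact: bigcapT_measurable.
  by move=> x; apply.
have [mN3 PN3] : measurable N3 /\ pr P N3 = 0.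
  have mC i n : measurable (~` A i n) by exact: measurableC.
  apply: pr_countable_null => i; first exact: bigcapT_measurable.
  apply/eqP; rewrite eq_le pr_ge0 andbT; apply/ler_addgt0Pr => e e0; rewrite add0r.
  have [n [_ +]] := A_tail i e e0; apply: le_trans; apply: le_pr => //.
    exact: bigcapT_measurable.
  by move=> x; apply.
pose N := N1 `|` N2 `|` N3.
have mN : measurable N by apply: measurableU => //; exact: measurableU.
have PN : pr P N = 0.
  apply/eqP; rewrite eq_le pr_ge0 andbT -lee_fin -prE//.
  rewrite (le_trans (measureU2 _ _ _))//; first exact: measurableU.
  rewrite [X in (_ + X <= _)%E](_ : _ = 0%E); last by rewrite [LHS](prE P mN3) PN3.
  rewrite adde0 (le_trans (measureU2 _ _ _))//.
  by rewrite [X in (X + _ <= _)%E](prE P mN1) [X in (_ + X <= _)%E](prE P mN2) PN1 PN2 adde0.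
pose S i u := [set (ratr q : R) | q in [set q : rat | ~ A i q u]].
have S0 i u : ~ N u -> S i u !=set0.
  move=> Nu; have [n nA] : exists n : nat, ~ A i (- n%:R) u.
    by apply/existsNP => h; apply: Nu; left; right; exists i => // n _; exact: h.
  by exists (ratr (- n%:R)); exists (- n%:R).
have mono i u q q' : ~ N u -> q <= q' -> A i q u -> A i q' u.
  move=> Nu qq' Aq; apply: contrapT => nA; apply: Nu; left; left.
  by exists (i, q, q') => //=; rewrite qq'.
have Sub i u q : ~ N u -> A i q u -> ubound (S i u) (ratr q).
  move=> Nu Aq _ [q' nA <-]; rewrite ler_rat leNgt; apply/negP => qq'.
  by apply: nA; apply: mono Aq => //; exact: ltW.
have hasub i u : ~ N u -> has_ubound (S i u).
  move=> Nu; have [n nA] : exists n : nat, A i n%:R u.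
    apply: contrapT => h; apply: Nu; right; exists i => // n _ An.
    by apply: h; exists n.
  by exists (ratr n%:R); exact: Sub.
pose Y u : V := \row_(i < m) (if `[< N u >] then 0 else sup (S i u)).
have mY : measurable_fun setT Y.
  apply: measurable_fun_rV => i.
  rewrite (_ : (fun x => _) = (fun u => if `[< N u >] then 0 else sup (S i u))); last first.
    by apply/funext => u; rewrite mxE.
  apply: (measurability _ (measurable_realfun.RGenOInfty.measurableE R)).
  move=> _ [_ [c ->] <-]; rewrite setTI.
  rewrite (_ : _ @^-1` _ = (N `&` (if 0 > c then setT else set0)) `|`
    (~` N `&` \bigcup_(q : rat) (if c < ratr q then ~` A i q else set0))).
    apply: measurableU; apply: measurableI => //; first by case: ifP.
      exact: measurableC.
    apply: countable_bigcupT_measurable => // q.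
    by case: ifP => // _; exact: measurableC.
  apply/seteqP; split => u; rewrite /= in_itv/= andbT.
    case: asboolP => [Nu c0|Nu cs]; first by left; rewrite c0.
    right; split => //; have [_ [q nA <-] cq] := sup_gt (S0 i u Nu) cs.
    by exists q => //; rewrite cq.
  move=> [[Nu]|[Nu [q _]]].
    by rewrite asboolT//; case: ifP.
  rewrite asboolF//; case: ifP => // cq nA; apply: (lt_le_trans cq).
  by apply: ub_le_sup; [exact: hasub|exists q].
exists (law P mY) => C e oC e0.
have e20 : 0 < e / 2 by rewrite divr_gt0.
have [s sC sle] := open_inner (law P mY) oC e20.
(* The bits of a point of the half-open box: [x_i < a] fails and [x_i < b] holds. *)
pose bd (f : nat -> bool) (bx : 'rV[rat]_m * 'rV[rat]_m) := forall i : 'I_m,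
  ~~ f (pickle (i, bx.1 ord0 i)) /\ f (pickle (i, bx.2 ord0 i)).
pose phi f := exists2 bx, bx \in s & bd f bx.
pose k := (\max_(bx <- s) \max_(i < m)
  maxn (pickle (i, (bx.1 : 'rV[rat]_m) ord0 i)) (pickle (i, (bx.2 : 'rV[rat]_m) ord0 i))).+1.
have fphi : finitary k phi.
  move=> f g fg [bx bs H]; exists bx => // i; have := H i.
  have hk : (maxn (pickle (i, bx.1 ord0 i)) (pickle (i, bx.2 ord0 i)) < k)%N.
    rewrite ltnS; apply: leq_trans (leq_bigmax_seq _ bs isT).
    exact: (leq_bigmax (F := fun i => maxn (pickle (i, bx.1 ord0 i)) (pickle (i, bx.2 ord0 i)))).
  by rewrite !fg//; apply: leq_ltn_trans hk; rewrite ?leq_maxl ?leq_maxr.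
have := TL _ _ fphi.
have -> : [set x | phi (bits_of B x)] = hboxes s.
  apply/seteqP; split => x [bx bs H]; exists bx => // i; have := H i.
    move=> [/asboolP + /asboolP]; rewrite !BE /= => /negP; rewrite -leNgt => -> ->//.
  move=> /andP[h1 h2]; split; last by apply/asboolP; rewrite BE.
  by apply/asboolP; rewrite BE /=; apply/negP; rewrite -leNgt.
have mphi := measurable_finitary mb fphi.
have mo := measurable_oboxes s.
have mpo : measurable (Y @^-1` oboxes s).
  by rewrite -[X in measurable X]setTI; have := mY; exact.
(* Strict bounds on the supremum decide the bits, while bits only give weak bounds back. Hence open
   boxes for the limit law and half-open ones for [nu_ n]. *)
have sphi : pr (law P mY) (oboxes s : set V) <= pr P [set x | phi (bits_of b x)].
  rewrite pr_law (pr_split P mpo mN).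
  rewrite [X in _ + X](_ : _ = 0) ?addr0; last first.
    apply/eqP; rewrite eq_le pr_ge0 andbT -PN; apply: le_pr => //.
    exact: measurableI.
  apply: (@le_pr _ _ _ P _ _ (measurableI _ _ mpo (measurableC mN)) mphi).
  move=> u [[bx bs Yu] Nu]; exists bx => // i.
  have := Yu i; rewrite /Y mxE asboolF// => /andP[h1 h2]; split.
    apply/asboolP => /(Sub i u _ Nu) Au.
    have := ge_sup (S0 i u Nu) Au; by move/(lt_le_trans h1); rewrite ltxx.
  apply/asboolP; apply: contrapT => nA.
  have : ratr (bx.2 ord0 i) <= sup (S i u).
    by apply: ub_le_sup; [exact: hasub|exists (bx.2 ord0 i)].
  by move/(lt_le_trans h2); rewrite ltxx.
move=> /cvgr_ge /(_ (pr P [set x | phi (bits_of b x)] - e / 2)).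
rewrite ltrBlDr ltrDl => /(_ e20); apply: filterS => n Hn.
have hC : pr (nu_ n) (hboxes s : set V) <= pr (nu_ n) (C : set V).
  by apply: le_pr => //; [exact: measurable_hboxes|exact: open_measurable_rV].
by move: sle sphi Hn hC; lra.
Qed.

End prokhorov.

(** * Narrow convergence *)

Section mean.
Context d {T : measurableType d} {R : realType}.
Implicit Type P : probability T R.

Definition mean P (f : T -> R) : R := (\int[P]_x f x)%R.

Definition bmf (f : T -> R) :=
  measurable_fun setT f /\ exists M : R, forall x, `|f x| <= M.

Lemma bmf_integrable P f : bmf f -> P.-integrable setT (EFin \o f).
Proof.
move=> [mf [M fM]].
have mf' : measurable_fun setT (EFin \o f) by exact/measurable_EFinP.
apply: (le_integrable measurableT mf' _ (finite_measure_integrable_cst P M measurableT)).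
by move=> x _ /=; rewrite lee_fin (le_trans (fM x))// ler_norm.
Qed.

Lemma meanE P f : bmf f -> (\int[P]_x (f x)%:E)%E = (mean P f)%:E.
Proof.
move=> bf; rewrite /mean /Rintegral fineK//.
exact: integrable_fin_num (bmf_integrable P bf).
Qed.

Lemma le_mean P f g : bmf f -> bmf g -> (forall x, f x <= g x) ->
  mean P f <= mean P g.
Proof.
by move=> bf bg fg; apply: le_Rintegral => //; exact: bmf_integrable.
Qed.

Lemma meanD P f g : bmf f -> bmf g ->
  mean P (fun x => f x + g x) = mean P f + mean P g.
Proof. by move=> bf bg; apply: RintegralD => //; exact: bmf_integrable. Qed.

Lemma meanZ P f r : bmf f -> mean P (fun x => r * f x) = r * mean P f.
Proof. by move=> bf; apply: RintegralZl => //; exact: bmf_integrable. Qed.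

Lemma mean_cst P r : mean P (fun=> r) = r.
Proof. by rewrite /mean Rintegral_cst// -/(pr P setT) prT mulr1. Qed.

Lemma bmf_cst r : bmf (fun=> r).
Proof. by split => //; exists `|r|. Qed.

Lemma bmfD f g : bmf f -> bmf g -> bmf (fun x => f x + g x).
Proof.
move=> [mf [M fM]] [mg [N gN]]; split; first exact: measurable_funD.
by exists (M + N) => x; rewrite (le_trans (ler_normD _ _))// lerD.
Qed.

Lemma bmfZ f r : bmf f -> bmf (fun x => r * f x).
Proof.
move=> [mf [M fM]]; split; first exact: measurable_funM.
by exists (`|r| * M) => x; rewrite normrM ler_wpM2l.
Qed.

Lemma bmf_indic (A : set T) : measurable A -> bmf (\1_A : T -> R).
Proof.
move=> mA; split; first exact: measurable_indic.
by exists 1 => x; rewrite indicE; case: (_ \in _); rewrite ?normr1 ?normr0.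
Qed.

Lemma mean_indic P (A : set T) : measurable A -> mean P \1_A = pr P A.
Proof. by move=> mA; rewrite /mean /Rintegral integral_indic// setIT. Qed.

Lemma bmf_sum (I : Type) (s : seq I) (f : I -> T -> R) :
  (forall i, bmf (f i)) -> bmf (fun x => \sum_(i <- s) f i x).
Proof.
move=> bf; elim: s => [|i s ih].
  by under [X in bmf X]eq_fun do rewrite big_nil; exact: bmf_cst.
by under [X in bmf X]eq_fun do rewrite big_cons; exact: bmfD.
Qed.

Lemma mean_sum P (I : Type) (s : seq I) (f : I -> T -> R) :
  (forall i, bmf (f i)) ->
  mean P (fun x => \sum_(i <- s) f i x) = \sum_(i <- s) mean P (f i).
Proof.
move=> bf; elim: s => [|i s ih].
  by under [X in mean _ X]eq_fun do rewrite big_nil; rewrite mean_cst big_nil.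
under [X in mean _ X]eq_fun do rewrite big_cons.
by rewrite meanD//; [rewrite ih big_cons|exact: bmf_sum].
Qed.

End mean.

Lemma pr_bigcup_nd d (T : measurableType d) {R : realType} (P : probability T R)
    (F : nat -> set T) (e : R) :
  (forall n, measurable (F n)) -> (forall n m, (n <= m)%N -> F n `<=` F m) ->
  0 < e -> exists n, pr P (\bigcup_n F n) <= pr P (F n) + e.
Proof.
move=> mF nd e0.
have mUF : measurable (\bigcup_n F n) by exact: bigcupT_measurable.
have : P (F n) @[n --> \oo] --> (pr P (\bigcup_n F n))%:E.
  rewrite -prE//.
  by apply: nondecreasing_cvg_mu => // n m nm; apply/subsetPset; exact: nd.
move=> /fine_cvgP [_ H].
have [n _ /(_ n (leqnn n)) /= Hn] := cvgr_ge _ H (pr P (\bigcup_n F n) - e)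
  ltac:(by rewrite ltrBlDr ltrDl).
by exists n; rewrite -lerBlDr.
Qed.

Section portmanteau.
Context {R : realType} {m : nat} (F : set_system nat) {PF : ProperFilter F}.
Local Notation V := (borel_rV R m).

Lemma bmf_continuous (f : 'rV[R]_m -> R) (M : R) : continuous f ->
  (forall x, `|f x| <= M) -> bmf (f : V -> R).
Proof.
by move=> cf fM; split; [exact: continuous_measurable_rV|exists M].
Qed.

(** Discrete layer cake: counting the levels [1, ..., N] strictly below [s] loses at most 1, as long
    as [s <= N + 1]. *)
Lemma stair_le (s : R) N : 0 <= s -> \sum_(j < N) (((j.+1%:R < s)%R)%:R : R) <= s.
Proof.
move=> s0; elim: N => [|N ih]; first by rewrite big_ord0.
rewrite big_ord_recr /=; case: ltP => [h|_]; last by rewrite addr0.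
apply: le_trans (ltW h); rewrite -(natr1 N) lerD2r.
apply: (@le_trans _ _ (\sum_(j < N) (1 : R))).
  by apply: ler_sum => j _; rewrite lern1 leq_b1.
by rewrite sumr_const card_ord.
Qed.

Lemma stair_ge (s : R) N : s <= N.+1%:R -> s <= 1 + \sum_(j < N) (((j.+1%:R < s)%R)%:R : R).
Proof.
elim: N => [|N ih] sN; first by rewrite big_ord0 addr0.
rewrite big_ord_recr /=; case: ltP => [h|h]; last by rewrite addr0 ih.
have -> : \sum_(j < N) (((j.+1%:R < s)%R)%:R : R) = N%:R.
  rewrite (eq_bigr (fun=> 1)) ?sumr_const ?card_ord// => j _.
  by rewrite (lt_trans _ h)// ltr_nat ltnS ltn_ord.
by move: sN; rewrite -(natr1 N.+1) -(natr1 N) /= mulr1n; lra.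
Qed.

(** Up to [1 / (N + 1)], [f] is the average of the indicators of its superlevel sets at heights
    [(j + 1) / (N + 1)]. These are finitely many open sets, to each of which the hypothesis
    applies. *)
Lemma liminf_mean (nu_ : nat -> borel_prob R m) (nu : borel_prob R m) (f : 'rV[R]_m -> R) (e : R) :
  liminf_open F nu_ nu -> continuous f -> (forall x, 0 <= f x <= 1) -> 0 < e ->
  \forall n \near F, mean nu (f : V -> R) <= mean (nu_ n) (f : V -> R) + e.
Proof.
move=> H cf f01 e0.
have [N eN] : exists N : nat, N.+1%:R^-1 < e / 2.
  exists (Num.bound (e / 2)^-1); rewrite invf_plt ?posrE ?divr_gt0//.
  apply: (@lt_trans _ _ (Num.bound (e / 2)^-1)%:R); last by rewrite ltr_nat.
  by rewrite archi_boundP// invr_ge0 divr_ge0// ltW.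
pose A j : set V := [set x : 'rV[R]_m | j.+1%:R / N.+1%:R < f x].
have oA j : open (A j : set 'rV[R]_m).
  rewrite (_ : A j = f @^-1` `]j.+1%:R / N.+1%:R, +oo[).
    by apply: open_comp => [x _|]; [exact: cf|exact: interval_open].
  by apply/seteqP; split => x; rewrite /= in_itv/= andbT.
have mA j : measurable (A j) by exact: open_measurable_rV.
pose h := fun x : V => N.+1%:R^-1 * \sum_(j < N) (\1_(A j) x : R).
have bh0 : bmf (fun x : V => \sum_(j < N) (\1_(A j) x : R)).
  by apply: bmf_sum => j; exact: bmf_indic.
have bh : bmf h by exact: bmfZ.
have bf : bmf (f : V -> R).
  apply: (@bmf_continuous _ 1 cf) => x; have /andP[? ?] := f01 x.
  by rewrite ger0_norm.
have hE x : h x = N.+1%:R^-1 * \sum_(j < N) (((j.+1%:R < N.+1%:R * f x)%R)%:R : R).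
  congr (_ * _); apply: eq_bigr => j _; rewrite indicE; congr ((nat_of_bool _)%:R).
  by apply/idP/idP; rewrite inE /A/= ltr_pdivrMr// mulrC.
have N0 : 0 < N.+1%:R :> R by [].
have hf x : h x <= f x.
  rewrite hE ler_pdivrMl//; apply: stair_le.
  by rewrite mulr_ge0//; have /andP[] := f01 x.
have fh x : f x <= h x + N.+1%:R^-1.
  rewrite hE -[X in _ + X]mulr1 -mulrDr ler_pdivlMl// [leRHS]addrC; apply: stair_ge.
  by rewrite ler_piMr//; have /andP[] := f01 x.
have mh P : mean P h = N.+1%:R^-1 * \sum_(j < N) pr P (A j).
  rewrite /h meanZ// mean_sum; last by move=> j; exact: bmf_indic.
  by congr (_ * _); apply: eq_bigr => j _; rewrite mean_indic.
have e20 : 0 < e / 2 by rewrite divr_gt0.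
have : \forall n \near F, forall j : 'I_N, pr nu (A j) <= pr (nu_ n) (A j) + e / 2.
  apply: filter_forall => j; exact: H.
apply: filterS => n Hn.
have h1 : mean nu (f : V -> R) <= mean nu h + N.+1%:R^-1.
  rewrite -(mean_cst nu (N.+1%:R^-1)) -meanD//; last exact: bmf_cst.
  by apply: le_mean => //; apply: bmfD => //; exact: bmf_cst.
have h2 : mean (nu_ n) h <= mean (nu_ n) (f : V -> R) by exact: le_mean.
have h3 : mean nu h <= mean (nu_ n) h + e / 2.
  rewrite !mh; apply: (@le_trans _ _ (N.+1%:R^-1 * (\sum_(j < N) pr (nu_ n) (A j) + N%:R * (e / 2)))).
    rewrite ler_wpM2l ?invr_ge0//.
    have -> : N%:R * (e / 2) = \sum_(j < N) (e / 2).
      by rewrite sumr_const card_ord mulr_natl.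
    by rewrite -big_split/=; apply: ler_sum => j _.
  rewrite mulrDr lerD2l (mulrA _ _ (e / 2)) ler_piMl ?(ltW e20)// mulrC ler_pdivrMr// mul1r.
  by rewrite ler_nat.
by rewrite (le_trans h1)// (le_trans (lerD h3 (ltW eN)))// -addrA -splitr lerD2r.
Qed.

Lemma liminf_open_cvg (nu_ : nat -> borel_prob R m) (nu : borel_prob R m) (f : 'rV[R]_m -> R) (M : R) :
  liminf_open F nu_ nu -> continuous f -> (forall x, `|f x| <= M) ->
  mean (nu_ n) (f : V -> R) @[n --> F] --> mean nu (f : V -> R).
Proof.
move=> H cf fM.
have M0 : 0 <= M by exact: le_trans (normr_ge0 _) (fM 0).
have K0 : 0 < 2 * M + 1 by rewrite ltr_wpDl// mulr_ge0.
have bf : bmf (f : V -> R) by exact: bmf_continuous cf fM.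
have one_sided (s : R) : `|s| = 1 -> forall e, 0 < e ->
    \forall n \near F, s * mean nu (f : V -> R) <= s * mean (nu_ n) (f : V -> R) + e.
  (* An affine change brings [f] and [- f] into [[0, 1]]; [2 * M + 1] stays positive when
     [M = 0]. *)
  move=> s1 e e0; pose g x := (2 * M + 1)^-1 * (s * f x + M).
  have cg : continuous g.
    move=> x; apply: (@continuous_comp _ _ _ f
      (fun t : R => (2 * M + 1)^-1 * (s * t + M))); first exact: cf.
    apply: cvgM; first exact: cvg_cst.
    apply: cvgD; last exact: cvg_cst.
    by apply: cvgM; [exact: cvg_cst|exact: cvg_id].
  have sf x : `|s * f x| <= M by rewrite normrM s1 mul1r.
  have g01 x : 0 <= g x <= 1.
    rewrite /g ler_pdivlMl// mulr0 ler_pdivrMl// mulr1.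
    by have := sf x; rewrite ler_norml => /andP[? ?]; apply/andP; split; lra.
  have mg P : mean P (g : V -> R) = (2 * M + 1)^-1 * (s * mean P (f : V -> R) + M).
    rewrite meanZ; last by apply: bmfD; [exact: bmfZ|exact: bmf_cst].
    by rewrite meanD; [rewrite meanZ// mean_cst|exact: bmfZ|exact: bmf_cst].
  have := liminf_mean H cg g01 (e := e / (2 * M + 1)) (divr_gt0 e0 K0).
  apply: filterS => n; rewrite !mg (mulrC e) -mulrDr ler_pM2l ?invr_gt0//.
  by rewrite addrAC lerD2r.
apply/cvgrPdist_le => e e0.
have H1 := one_sided 1 (normr1 _) e e0.
have H2 := one_sided (-1) ltac:(by rewrite normrN normr1) e e0.
near=> n; rewrite ler_norml; apply/andP; split.
  have : -1 * mean nu (f : V -> R) <= -1 * mean (nu_ n) (f : V -> R) + e by near: n.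
  by rewrite !mulN1r; lra.
have : 1 * mean nu (f : V -> R) <= 1 * mean (nu_ n) (f : V -> R) + e by near: n.
by rewrite !mul1r; lra.
Unshelve. all: by end_near. Qed.

(** Only countably many open sets are tested, as the diagonal extraction demands. *)
Lemma liminf_open_boxes (nu_ : nat -> borel_prob R m) (nu : borel_prob R m) :
  (forall s (e : R), 0 < e ->
     \forall n \near F, pr nu (oboxes s : set V) <= pr (nu_ n) (oboxes s : set V) + e) ->
  liminf_open F nu_ nu.
Proof.
move=> H A e oA e0; have e20 : 0 < e / 2 by rewrite divr_gt0.
have [s sA sle] := open_inner nu oA e20.
apply: filterS (H s _ e20) => n Hn.
have : pr (nu_ n) (oboxes s : set V) <= pr (nu_ n) (A : set V).
  apply: le_pr; [exact: measurable_oboxes|exact: open_measurable_rV|].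
  exact: (subset_trans (@oboxes_hboxes _ _ s)).
by move: sle Hn; lra.
Qed.

(* A Lipschitz substitute for the distance to [~` A], truncated at [1] so that
   the infimum is taken over a nonempty set even when [A] is everything. *)
Definition bdist (A : set 'rV[R]_m) (x : 'rV[R]_m) : R :=
  inf [set r | r = 1 \/ exists2 y, ~ A y & r = enorm (x - y)].

Lemma bdist_has_lbound (A : set 'rV[R]_m) (x : 'rV[R]_m) :
  lbound [set r | r = 1 \/ exists2 y, ~ A y & r = enorm (x - y)] 0.
Proof. by move=> r [->|[y _ ->]] //; exact: enorm_ge0. Qed.

Lemma bdist_ge0 A x : 0 <= bdist A x.
Proof. by apply: lb_le_inf; [exists 1; left|exact: bdist_has_lbound]. Qed.

Lemma bdist_le1 A x : bdist A x <= 1.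
Proof. by apply: ge_inf; [exists 0; exact: bdist_has_lbound|left]. Qed.

Lemma bdist_out A x : ~ A x -> bdist A x = 0.
Proof.
move=> Ax; apply/eqP; rewrite eq_le bdist_ge0 andbT.
apply: ge_inf; first by exists 0; exact: bdist_has_lbound.
by right; exists x => //; rewrite subrr enorm0.
Qed.

Lemma bdist_lip A x y : `|bdist A x - bdist A y| <= enorm (x - y).
Proof.
have h u v : bdist A u - enorm (u - v) <= bdist A v.
  apply: lb_le_inf; first by exists 1; left.
  move=> r [->|[z Az ->]].
    by rewrite lerBlDr (le_trans (bdist_le1 A u))// lerDl enorm_ge0.
  rewrite lerBlDr; apply: (@le_trans _ _ (enorm (u - z))).
    by apply: ge_inf; [exists 0; exact: bdist_has_lbound|right; exists z].
  by rewrite -(subrKA v) addrC enormD// addrC.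
rewrite ler_norml; apply/andP; split.
  by have := h y x; rewrite enormB; lra.
by have := h x y; lra.
Qed.

Lemma bdist_gt0 A x : open A -> A x -> 0 < bdist A x.
Proof.
move=> oA Ax; have /nbhs_ballP[e /= e0 eA] := open_nbhs_nbhs (conj oA Ax).
apply: (@lt_le_trans _ _ (Num.min 1 e)); first by rewrite lt_min ltr01.
apply: lb_le_inf; first by exists 1; left.
move=> r [->|[y Ay ->]]; first by rewrite ge_min lexx.
rewrite leNgt; apply/negP; rewrite lt_min => /andP[_ xy]; apply: Ay; apply: eA.
split => // i j; rewrite ord1 /ball/=; apply: le_lt_trans xy.
by have := coord_le_enorm (x - y) j; rewrite !mxE.
Qed.

(** The indicator of [A] is the increasing limit of the Lipschitz functions
    [min 1 ((n + 1) * bdist A)]; the sets [G n] where they equal 1 exhaust [A]. Lipschitz tests are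
    the ones that the transport distance controls. *)
Lemma liminf_open_lip (nu_ : nat -> borel_prob R m) (nu : borel_prob R m) :
  (forall (f : 'rV[R]_m -> R) (L : R), (forall x, 0 <= f x <= 1) ->
     (forall x y, `|f x - f y| <= L * enorm (x - y)) ->
     forall e : R, 0 < e -> \forall n \near F,
       mean nu (f : V -> R) <= mean (nu_ n) (f : V -> R) + e) ->
  liminf_open F nu_ nu.
Proof.
move=> H A e oA e0; have e20 : 0 < e / 2 by rewrite divr_gt0.
pose G n : set V := [set x : 'rV[R]_m | 1 <= n.+1%:R * bdist A x].
pose g n (x : 'rV[R]_m) := Num.min 1 (n.+1%:R * bdist A x).
have lip n x y : `|g n x - g n y| <= n.+1%:R * enorm (x - y).
  apply: (@le_trans _ _ (n.+1%:R * `|bdist A x - bdist A y|)); last first.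
    by rewrite ler_wpM2l// bdist_lip.
  rewrite -[X in X * _]ger0_norm// -normrM mulrBr /g.
  set a := _ * bdist A x; set b := _ * bdist A y.
  rewrite /Num.min; case: ltP => h1; case: ltP => h2.
  - by rewrite subrr normr0.
  - by rewrite ger0_norm ?subr_ge0// ger0_norm ?lerD2r ?subr_ge0 ?(ltW h1)// (le_trans h2)// ltW.
  - rewrite distrC (distrC a).
    by rewrite ger0_norm ?subr_ge0// ger0_norm ?lerD2r ?subr_ge0 ?(ltW h2)// (le_trans h1)// ltW.
  - by [].
have g01 n x : 0 <= g n x <= 1.
  by rewrite /g le_min ler01 mulr_ge0 ?bdist_ge0//= ge_min lexx.
have cg n : continuous (g n) by exact: lipschitz_continuous (lip n).
have bg n : bmf (g n : V -> R).
  apply: (@bmf_continuous _ 1 (cg n)) => x; have /andP[? ?] := g01 n x.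
  by rewrite ger0_norm.
have mA : measurable (A : set V) by exact: open_measurable_rV.
have cb : continuous (bdist A).
  by apply: (@lipschitz_continuous _ _ _ 1) => x y; rewrite mul1r bdist_lip.
have mG n : measurable (G n).
  have mb : measurable_fun setT (fun x : V => n.+1%:R * bdist A x).
    by apply: measurable_funM => //; exact: continuous_measurable_rV.
  have := mb measurableT `[1, +oo[%classic (measurable_itv _).
  by rewrite setTI; congr measurable; apply/seteqP; split => x; rewrite /= in_itv/= andbT.
have ndG n k : (n <= k)%N -> G n `<=` G k.
  move=> nk x; rewrite /G /= => /le_trans; apply; rewrite ler_wpM2r ?bdist_ge0//.
  by rewrite ler_nat ltnS.
have UG : \bigcup_n G n = A.
  apply/seteqP; split => x /=.
    move=> [n _ /= h]; apply: contrapT => /bdist_out xA.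
    by move: h; rewrite /G /= xA mulr0 ler10.
  move=> Ax; have b0 := bdist_gt0 oA Ax.
  exists (Num.bound (bdist A x)^-1) => //=.
  rewrite /G /= -ler_pdivrMr// mul1r ltW//.
  apply: (@lt_trans _ _ (Num.bound (bdist A x)^-1)%:R); last by rewrite ltr_nat.
  by rewrite archi_boundP// invr_ge0 ltW.
have [k] := pr_bigcup_nd nu mG ndG e20; rewrite UG => hk.
apply: filterS (H (g k) _ (g01 k) (lip k) _ e20) => n Hn.
have h1 : pr nu (G k) <= mean nu (g k : V -> R).
  rewrite -mean_indic//; apply: le_mean => //; first exact: bmf_indic.
  move=> x; rewrite indicE; case: (boolP (x \in G k)).
    by rewrite inE /G/= => h; rewrite /g le_min lexx.
  by move=> _; have /andP[] := g01 k x.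
have h2 : mean (nu_ n) (g k : V -> R) <= pr (nu_ n) (A : set V).
  rewrite -mean_indic//; apply: le_mean => //; first exact: bmf_indic.
  move=> x; rewrite indicE; case: (boolP (x \in (A : set V))).
    by move=> _; have /andP[] := g01 k x.
  by rewrite notin_setE => /bdist_out h; rewrite /g h mulr0 ge_min lexx orbT.
by move: hk Hn h1 h2; lra.
Qed.

End portmanteau.

(** With constant sequences the Lipschitz criterion gives both inequalities on open sets, a
    generating family closed under intersection. *)
Lemma probability_eq_lip {R : realType} {m : nat} (mu nu : borel_prob R m) :
  (forall (f : 'rV[R]_m -> R) (L : R), (forall x, 0 <= f x <= 1) ->
     (forall x y, `|f x - f y| <= L * enorm (x - y)) ->
     mean mu (f : borel_rV R m -> R) = mean nu (f : borel_rV R m -> R)) ->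
  forall A, measurable A -> mu A = nu A.
Proof.
move=> H.
have half (m1 m2 : borel_prob R m) : (forall (f : 'rV[R]_m -> R) (L : R),
      (forall x, 0 <= f x <= 1) ->
      (forall x y, `|f x - f y| <= L * enorm (x - y)) ->
      mean m1 (f : borel_rV R m -> R) = mean m2 (f : borel_rV R m -> R)) ->
    forall A : set 'rV[R]_m, open A ->
      pr m1 (A : set (borel_rV R m)) <= pr m2 (A : set (borel_rV R m)).
  move=> H12 A oA; apply/ler_addgt0Pr => e e0.
  have lo : liminf_open \oo (fun=> m2) m1.
    apply: liminf_open_lip => f L f01 fL e' e'0; apply: nearW => _.
    by rewrite (H12 f L f01 fL) lerDl ltW.
  by have [n _ /(_ n (leqnn n))] := lo A e oA e0.
pose g (k : nat) : set (borel_rV R m) := setT.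
have E A : open (A : set 'rV[R]_m) -> mu (A : set (borel_rV R m)) = nu A.
  move=> oA; have mA := open_measurable_rV oA.
  rewrite [LHS](prE mu mA) [RHS](prE nu mA); congr EFin.
  by apply/eqP; rewrite eq_le !half// => f L f01 fL; rewrite (H f L).
apply: (@measure_unique _ R (borel_rV R m) (@open 'rV[R]_m) g) => //.
- by move=> A B; exact: openI.
- by move=> k; exact: openT.
- by apply/seteqP; split => // x _; exists 0%N.
- by move=> k; rewrite [X in (X < _)%E](prE mu measurableT) ltry.
Qed.

(** * Wasserstein distance *)

Section glue.
Context d1 d2 {S1 : measurableType d1} {S2 : measurableType d2} {R : realType}.
Variables (P : probability S1 R) (Q : probability S2 R).
Variables (i1 : S1 -> nat) (i2 : S2 -> nat).
Hypothesis mi1 : forall k, measurable (i1 @^-1` [set k]).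
Hypothesis mi2 : forall k, measurable (i2 @^-1` [set k]).
Hypothesis i12 : forall k, P (i1 @^-1` [set k]) = Q (i2 @^-1` [set k]).

Let Pfin k : (P (i1 @^-1` [set k]) < +oo)%E.
Proof. by rewrite (prE P (mi1 k)) ltry. Qed.
Let Qfin k : (Q (i2 @^-1` [set k]) < +oo)%E.
Proof. by rewrite (prE Q (mi2 k)) ltry. Qed.

Let Pk k := mfrestr (mi1 k) (Pfin k).
Let Qk k := mfrestr (mi2 k) (Qfin k).
Let q k : R := pr Q (i2 @^-1` [set k]).
Let c k : {nonneg R} := NngNum (eqbRL (invr_ge0 (q k)) (pr_ge0 Q _)).

(* On [i1 = i2 = k], the normalised product of the restrictions of [P] and [Q]; no
   harm comes from [0^-1 = 0] when the fibre is null. *)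
Let G : set (S1 * S2) -> \bar R :=
  mseries (fun k => mscale (c k) (Pk k \x Qk k)%E) 0.

Let GX A B : measurable A -> measurable B -> G (A `*` B) =
  (\sum_(0 <= k <oo) (((q k)^-1)%:E *
    (P (A `&` i1 @^-1` [set k]) * Q (B `&` i2 @^-1` [set k]))))%E.
Proof.
move=> mA mB; apply: eq_eseriesr => k _.
by congr (_ * _)%E; exact: product_measure1E.
Qed.

Let sum_fib d (S : measurableType d) (m : probability S R) (i : S -> nat) A :
  (forall k, measurable (i @^-1` [set k])) -> measurable A ->
  (\sum_(0 <= k <oo) m (A `&` i @^-1` [set k]))%E = m A.
Proof.
move=> mi mA.
have -> : m A = m (\bigcup_k (A `&` i @^-1` [set k])).
  congr (m _); apply/seteqP; split => [x Ax|x [k _ []]//].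
  by exists (i x).
rewrite measure_bigcup//.
- by apply: eq_eseriesl => k; apply/esym; rewrite in_setT.
- by move=> k _; exact: measurableI.
- by move=> j k _ _ [x [[_ /= <-] [_ /= <-]]].
Qed.

Let GP A : measurable A -> G (A `*` setT) = P A.
Proof.
move=> mA; rewrite GX// -(sum_fib _ mi1 mA); apply: eq_eseriesr => k _.
rewrite setTI muleCA; have [q0|q0] := eqVneq (q k) 0.
  rewrite [X in (X * _)%E = _](_ : _ = 0%E).
    rewrite mul0e; apply/esym/eqP; rewrite -measure_le0.
    apply: (@le_trans _ _ (P (i1 @^-1` [set k]))).
      by apply: le_measure; rewrite ?inE//; exact: measurableI.
    by rewrite i12 (prE Q (mi2 k)) -/(q k) q0.
  apply/eqP; rewrite -measure_le0.
  apply: (@le_trans _ _ (P (i1 @^-1` [set k]))).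
    by apply: le_measure; rewrite ?inE//; exact: measurableI.
  by rewrite i12 (prE Q (mi2 k)) -/(q k) q0.
by rewrite (prE Q (mi2 k)) -/(q k) -EFinM mulVf// mule1.
Qed.

Let GQ B : measurable B -> G (setT `*` B) = Q B.
Proof.
move=> mB; rewrite GX// -(sum_fib _ mi2 mB); apply: eq_eseriesr => k _.
rewrite setTI i12 muleA; have [q0|q0] := eqVneq (q k) 0.
  rewrite [in LHS](prE Q (mi2 k)) -/(q k) q0 mule0 mul0e.
  apply/esym/eqP; rewrite -measure_le0.
  apply: (@le_trans _ _ (Q (i2 @^-1` [set k]))).
    by apply: le_measure; rewrite ?inE//; exact: measurableI.
  by rewrite (prE Q (mi2 k)) -/(q k) q0.
by rewrite [in X in (X * _)%E](prE Q (mi2 k)) -/(q k) -EFinM mulVf// mul1e.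
Qed.

Let N : set (S1 * S2) := [set z | i1 z.1 <> i2 z.2].

Let mN : measurable N.
Proof.
rewrite (_ : N = ~` \bigcup_k ((i1 @^-1` [set k]) `*` (i2 @^-1` [set k]))).
  apply: measurableC; apply: bigcupT_measurable => k.
  exact: measurableX.
apply/seteqP; split => -[x y] /= h; first by move=> [k _ /= [xk yk]]; apply: h; rewrite xk yk.
by move=> xy; apply: h; exists (i1 x) => //=; split.
Qed.

Let G0 : G N = 0%E.
Proof.
have Z k : (Pk k \x Qk k)%E N = 0%E.
  have mC1 : measurable (~` (i1 @^-1` [set k])) by exact: measurableC.
  have mC2 : measurable (~` (i2 @^-1` [set k])) by exact: measurableC.
  pose A1 : set (S1 * S2) := ~` (i1 @^-1` [set k]) `*` setT.
  pose A2 : set (S1 * S2) := setT `*` ~` (i2 @^-1` [set k]).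
  have mA1 : measurable A1 by exact: measurableX.
  have mA2 : measurable A2 by exact: measurableX.
  have Z1 : (Pk k \x Qk k)%E A1 = 0%E.
    rewrite /A1 product_measure1E//.
    by rewrite [X in (X * _)%E](_ : _ = 0%E) ?mul0e//; exact: (eq_trans (congr1 P (setICl _)) (measure0 P)).
  have Z2 : (Pk k \x Qk k)%E A2 = 0%E.
    rewrite /A2 product_measure1E//.
    by rewrite [X in (_ * X)%E](_ : _ = 0%E) ?mule0//; exact: (eq_trans (congr1 Q (setICl _)) (measure0 Q)).
  apply/eqP; rewrite -measure_le0.
  apply: (@le_trans _ _ ((Pk k \x Qk k)%E (A1 `|` A2))).
    apply: le_measure; rewrite ?inE//; first exact: measurableU.
    move=> [x y] /= xy; have [xk|xk] := eqVneq (i1 x) k.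
      by right; split => //= yk; apply: xy; rewrite xk yk.
    by left; split => //=; apply/eqP.
  by rewrite (le_trans (measureU2 _ _ _))// [X in (X + _)%E]Z1 [X in (_ + X)%E]Z2 adde0.
rewrite /G /mseries eseries0// => k _ _.
exact: (eq_trans (congr1 (fun x => ((c k)%:num%:E * x)%E) (Z k)) (mule0 _)).
Qed.

(** Conditionally on the common index the two components are independent. Summing over the fibres
    restores the marginals, and each term is carried by [i1 = i2 = k]. *)
Lemma coupling_glue : exists Gamma : probability (S1 * S2)%type R,
  [/\ forall A, measurable A -> Gamma (A `*` setT) = P A,
      forall B, measurable B -> Gamma (setT `*` B) = Q B &
      {ae Gamma, forall z, i1 z.1 = i2 z.2}].
Proof.
have G1 : G setT = 1%E by rewrite -setXTT GP// probability_setT.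
pose Gp : probability (S1 * S2)%type R :=
  HB.pack (mseries (fun k => mscale (c k) (Pk k \x Qk k)%E) 0)
    (Measure_isProbability.Build _ _ _
      (mseries (fun k => mscale (c k) (Pk k \x Qk k)%E) 0) G1).
exists Gp; split => //.
exists N; split => //.
Qed.

End glue.

(** The image measure is described by its values on sets only, so that this applies to the marginals
    of a coupling as well as to [law]. *)
Lemma integral_marginal d d' (T : measurableType d) (T' : measurableType d') (R : realType)
    (G : {measure set T -> \bar R}) (P : {measure set T' -> \bar R}) (f : T -> T')
    (phi : T' -> \bar R) :
  measurable_fun setT f -> (forall A, measurable A -> G (f @^-1` A) = P A) ->
  measurable_fun setT phi -> (forall x, (0 <= phi x)%E) ->
  (\int[G]_x phi (f x) = \int[P]_x phi x)%E.
Proof.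
move=> mf GP mphi phi0.
have := @ge0_integral_pushforward _ _ T T' R f mf G setT phi measurableT mphi
  (fun x _ => phi0 x).
rewrite preimage_setT => <-.
by apply: eq_measure_integral => A mA _; exact: GP.
Qed.

Lemma mean_marginal d d' (T : measurableType d) (T' : measurableType d') (R : realType)
    (G : probability T R) (P : probability T' R) (f : T -> T') (phi : T' -> R) :
  measurable_fun setT f -> (forall A, measurable A -> G (f @^-1` A) = P A) ->
  measurable_fun setT phi -> (forall x, 0 <= phi x) ->
  mean G (phi \o f) = mean P phi.
Proof.
move=> mf GP mphi phi0; rewrite /mean /Rintegral; congr fine.
apply: (integral_marginal (phi := EFin \o phi) mf GP) => //.
exact/measurable_EFinP.
Qed.

Lemma integral_cst_prob d (T : measurableType d) (R : realType) (P : probability T R) (r : R) :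
  (\int[P]_x r%:E = r%:E)%E.
Proof.
rewrite integral_cst// -[RHS]mule1; congr (_ * _)%E; exact: probability_setT.
Qed.

Section wasserstein.
Context {R : realType} {d : nat}.
Local Notation V := (borel_rV R d).
Implicit Types mu nu : borel_prob R d.

Definition w2 mu nu : R := fine (W2 mu nu).

Definition transport_cost (G : probability (V * V)%type R) : \bar R :=
  (\int[G]_z (enorm ((z.1 : 'rV[R]_d) - (z.2 : 'rV[R]_d)) ^+ 2)%:E)%E.

Definition moment mu : R :=
  Num.sqrt (fine (\int[mu]_x (enorm (x : 'rV[R]_d) ^+ 2)%:E)%E).

Lemma measurable_enorm : measurable_fun setT (fun x : V => enorm (x : 'rV[R]_d)).
Proof. by apply: continuous_measurable_rV; exact: enorm_continuous. Qed.

Lemma measurable_enorm2 :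
  measurable_fun setT (fun x : V => (enorm (x : 'rV[R]_d) ^+ 2)%:E).
Proof.
by apply/measurable_EFinP; apply: measurable_funX; exact: measurable_enorm.
Qed.

Lemma measurable_subV d' (T : measurableType d') (f g : T -> V) :
  measurable_fun setT f -> measurable_fun setT g ->
  measurable_fun setT (fun z => ((f z : 'rV[R]_d) - (g z : 'rV[R]_d)) : V).
Proof.
move=> mf mg; apply: measurable_fun_rV => i.
under eq_fun do rewrite 2!mxE.
by apply: measurable_funB; exact: (measurableT_comp (measurable_coord i)).
Qed.

Lemma measurable_dist2 d' (T : measurableType d') (f g : T -> V) :
  measurable_fun setT f -> measurable_fun setT g ->
  measurable_fun setT (fun z => (enorm ((f z : 'rV[R]_d) - (g z : 'rV[R]_d)) ^+ 2)%:E).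
Proof.
by move=> mf mg; exact: (measurableT_comp measurable_enorm2 (measurable_subV mf mg)).
Qed.

Lemma P2E mu : P2 mu ->
  (\int[mu]_x (enorm (x : 'rV[R]_d) ^+ 2)%:E = (moment mu ^+ 2)%:E)%E.
Proof.
have h0 : (0 <= \int[mu]_x (enorm (x : 'rV[R]_d) ^+ 2)%:E)%E.
  by apply: integral_ge0 => x _; rewrite lee_fin sqr_ge0.
move=> mu2; rewrite sqr_sqrtr ?fine_ge0// fineK//.
by rewrite ge0_fin_numE.
Qed.

Lemma moment_ge0 mu : 0 <= moment mu. Proof. exact: sqrtr_ge0. Qed.

Lemma coupling_fst mu nu G phi : coupling mu nu G ->
  measurable_fun setT phi -> (forall x : V, (0 <= phi x)%E) ->
  (\int[G]_z phi z.1 = \int[mu]_x phi x)%E.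
Proof.
move=> cG; apply: (@integral_marginal _ _ _ _ _ G mu fst); first exact: measurable_fst.
move=> A mA; have [h _] := cG A mA.
by rewrite -[RHS]h; congr (G _); apply/seteqP; split => -[x y] // [].
Qed.

Lemma coupling_snd mu nu G phi : coupling mu nu G ->
  measurable_fun setT phi -> (forall x : V, (0 <= phi x)%E) ->
  (\int[G]_z phi z.2 = \int[nu]_x phi x)%E.
Proof.
move=> cG; apply: (@integral_marginal _ _ _ _ _ G nu snd); first exact: measurable_snd.
move=> A mA; have [_ h] := cG A mA.
by rewrite -[RHS]h; congr (G _); apply/seteqP; split => -[x y] // [].
Qed.

Lemma coupling_prod mu nu : coupling mu nu (mu \x nu)%E.
Proof.
move=> A mA; split.
  rewrite -[RHS]mule1 -(probability_setT nu).
  exact: (product_measure1E mu nu mA measurableT).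
rewrite -[RHS]mul1e -(probability_setT mu).
exact: (product_measure1E mu nu measurableT mA).
Qed.

(* Integrated form of [|y|^2 <= (1 + s) |x|^2 + (1 + 1/s) |x - y|^2] and alike. *)
Lemma integral_young d' (T : measurableType d') (G : {measure set T -> \bar R})
    (f g h : T -> R) (s : R) : 0 < s ->
  measurable_fun setT f -> measurable_fun setT g -> measurable_fun setT h ->
  {ae G, forall x, h x ^+ 2 <= (1 + s) * f x ^+ 2 + (1 + s^-1) * g x ^+ 2} ->
  (\int[G]_x (h x ^+ 2)%:E <=
   (1 + s)%:E * \int[G]_x (f x ^+ 2)%:E + (1 + s^-1)%:E * \int[G]_x (g x ^+ 2)%:E)%E.
Proof.
move=> s0 mf mg mh fgh.
have p1 : 0 <= 1 + s by rewrite addr_ge0// ltW.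
have p2 : 0 <= 1 + s^-1 by rewrite addr_ge0// invr_ge0 ltW.
have m2 (k : T -> R) : measurable_fun setT k -> measurable_fun setT (fun x => (k x ^+ 2)%:E).
  by move=> mk; apply/measurable_EFinP; exact: measurable_funX.
have k0 (k : T -> R) x : (0 <= (k x ^+ 2)%:E)%E by rewrite lee_fin sqr_ge0.
rewrite -!ge0_integralZl_EFin//; [|by apply: m2..].
rewrite -ge0_integralD//; last 4 first.
- by move=> x _; rewrite mule_ge0// ?lee_fin.
- by apply: measurable_funeM; exact: m2.
- by move=> x _; rewrite mule_ge0// ?lee_fin.
- by apply: measurable_funeM; exact: m2.
apply: ae_ge0_le_integral => //.
- exact: m2.
- by move=> x _; rewrite adde_ge0// mule_ge0// ?lee_fin.
- by apply: emeasurable_funD; apply: measurable_funeM; exact: m2.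
- by apply: filterS fgh => x h1 _; rewrite -!EFinM -EFinD lee_fin.
Qed.

Lemma transport_cost_lty mu nu G : coupling mu nu G -> P2 mu -> P2 nu ->
  (transport_cost G < +oo)%E.
Proof.
move=> cG mu2 nu2.
have := @integral_young _ _ G (fun z : V * V => enorm (z.1 : 'rV[R]_d))
  (fun z : V * V => enorm (z.2 : 'rV[R]_d))
  (fun z : V * V => enorm ((z.1 : 'rV[R]_d) - (z.2 : 'rV[R]_d))) 1 ltr01.
move=> H; apply: le_lt_trans (H _ _ _ _) _ => {H}.
- exact: (measurableT_comp measurable_enorm measurable_fst).
- exact: (measurableT_comp measurable_enorm measurable_snd).
- exact: (measurableT_comp measurable_enorm (measurable_subV measurable_fst measurable_snd)).
- by apply/aeW => z; rewrite -(enormN z.2); exact: enorm_young.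
- rewrite (coupling_fst (phi := fun x : V => (enorm (x : 'rV[R]_d) ^+ 2)%:E) cG); last 2 first.
    exact: measurable_enorm2.
    by move=> x; rewrite lee_fin sqr_ge0.
  rewrite (coupling_snd (phi := fun x : V => (enorm (x : 'rV[R]_d) ^+ 2)%:E) cG); last 2 first.
    exact: measurable_enorm2.
    by move=> x; rewrite lee_fin sqr_ge0.
  by rewrite (P2E mu2) (P2E nu2) -!EFinM -EFinD ltry.
Qed.

Section spec.
Variables mu nu : borel_prob R d.
Hypotheses (mu2 : P2 mu) (nu2 : P2 nu).

Let S := [set transport_cost G | G in coupling mu nu].

Let S0 : (0 <= ereal_inf S)%E.
Proof.
apply: le_ereal_inf_tmp => _ [G _ <-].
by apply: integral_ge0 => x _; rewrite lee_fin sqr_ge0.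
Qed.

Let Sfin : ereal_inf S \is a fin_num.
Proof.
rewrite ge0_fin_numE//.
apply: le_lt_trans (transport_cost_lty (@coupling_prod mu nu) mu2 nu2).
by apply: ereal_inf_lbound; exists (mu \x nu)%E => //; exact: coupling_prod.
Qed.

Let w2E0 : w2 mu nu = Num.sqrt (fine (ereal_inf S)).
Proof. by rewrite /w2 /W2 -/S -(fineK Sfin). Qed.

Lemma W2_w2 : W2 mu nu = (w2 mu nu)%:E.
Proof. by rewrite w2E0 /W2 -/S -(fineK Sfin). Qed.

Lemma w2_ge0 : 0 <= w2 mu nu. Proof. by rewrite w2E0 sqrtr_ge0. Qed.

Let w2_sqr : (w2 mu nu ^+ 2)%:E = ereal_inf S.
Proof. by rewrite w2E0 sqr_sqrtr ?fine_ge0// fineK. Qed.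

Lemma w2_le G (c : R) : coupling mu nu G -> 0 <= c ->
  (transport_cost G <= (c ^+ 2)%:E)%E -> w2 mu nu <= c.
Proof.
move=> cG c0 Gc; rewrite -(@ler_pXn2r _ 2) ?nnegrE ?w2_ge0// -lee_fin w2_sqr.
by apply: le_trans Gc; apply: ereal_inf_lbound; exists G.
Qed.

(** Together with [w2_le] this is the access to the infimum: near-optimal couplings, at the price of
    an arbitrarily small excess. *)
Lemma w2_lt (c : R) : w2 mu nu < c ->
  exists2 G, coupling mu nu G & (transport_cost G <= (c ^+ 2)%:E)%E.
Proof.
move=> wc; have /ereal_inf_lt [_ [G cG <-] Gc] : (ereal_inf S < (c ^+ 2)%:E)%E.
  rewrite -w2_sqr lte_fin ltr_pXn2r ?nnegrE ?w2_ge0//.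
  exact: le_trans w2_ge0 (ltW wc).
by exists G => //; exact: ltW.
Qed.

End spec.

Lemma w2_refl mu : P2 mu -> w2 mu mu = 0.
Proof.
move=> mu2.
have md : measurable_fun setT (fun x : V => (x, x)) by exact: measurable_fun_pair.
apply/eqP; rewrite eq_le w2_ge0// andbT.
apply: (w2_le mu2 mu2 (G := law mu md)) => //.
  move=> A mA.
  have e1 : (fun x : V => (x, x)) @^-1` (A `*` setT) = A by apply/seteqP; split => x //= [].
  have e2 : (fun x : V => (x, x)) @^-1` (setT `*` A) = A by apply/seteqP; split => x //= [].
  by split; [exact: (congr1 mu e1)|exact: (congr1 mu e2)].
have mc := @measurable_dist2 _ (V * V)%type _ _ measurable_fst measurable_snd.
have c0 (z : V * V) : (0 <= (enorm ((z.1 : 'rV[R]_d) - (z.2 : 'rV[R]_d)) ^+ 2)%:E)%E.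
  by rewrite lee_fin sqr_ge0.
have E : (\int[mu]_x (enorm ((x : 'rV[R]_d) - (x : 'rV[R]_d)) ^+ 2)%:E =
    transport_cost (law mu md))%E.
  exact: (@integral_marginal _ _ _ _ _ mu (law mu md) (fun x : V => (x, x)) _ md
    (fun A _ => erefl) mc c0).
rewrite -E (eq_integral (fun=> 0%E)) ?integral0 ?expr0n// => x _.
by rewrite subrr enorm0 expr0n.
Qed.

Lemma w2_le_sym mu nu : P2 mu -> P2 nu -> w2 nu mu <= w2 mu nu.
Proof.
move=> mu2 nu2; apply/ler_addgt0Pr => e e0.
have [G cG Gc] := w2_lt mu2 nu2 (ltac:(by rewrite ltrDl) : w2 mu nu < w2 mu nu + e).
have ms : measurable_fun setT (fun z : V * V => (z.2, z.1)).
  exact: measurable_fun_pair measurable_snd measurable_fst.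
apply: (w2_le nu2 mu2 (G := law G ms)).
- move=> A mA; have [h1 h2] := cG A mA.
  have e1 : (fun z : V * V => (z.2, z.1)) @^-1` (A `*` setT) = setT `*` A.
    by apply/seteqP; split => -[x y] [].
  have e2 : (fun z : V * V => (z.2, z.1)) @^-1` (setT `*` A) = A `*` setT.
    by apply/seteqP; split => -[x y] [].
  by split; [rewrite -h2; exact: (congr1 G e1)|rewrite -h1; exact: (congr1 G e2)].
- by rewrite addr_ge0 ?w2_ge0// ltW.
- have mc := @measurable_dist2 _ (V * V)%type _ _ measurable_fst measurable_snd.
  have c0 (z : V * V) : (0 <= (enorm ((z.1 : 'rV[R]_d) - (z.2 : 'rV[R]_d)) ^+ 2)%:E)%E.
    by rewrite lee_fin sqr_ge0.
  have E : (\int[G]_z (enorm ((z.2 : 'rV[R]_d) - (z.1 : 'rV[R]_d)) ^+ 2)%:E =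
      transport_cost (law G ms))%E.
    exact: (@integral_marginal _ _ _ _ _ G (law G ms) (fun z : V * V => (z.2, z.1)) _ ms
      (fun A _ => erefl) mc c0).
  rewrite -E; apply: le_trans Gc; rewrite le_eqVlt; apply/orP; left; apply/eqP.
  by apply: eq_integral => z _ /=; rewrite enormB.
Qed.

Lemma w2_sym mu nu : P2 mu -> P2 nu -> w2 nu mu = w2 mu nu.
Proof. by move=> mu2 nu2; apply/eqP; rewrite eq_le !w2_le_sym. Qed.

(** The moment is the distance to the Dirac mass at the origin, so this is a triangle inequality. *)
Lemma moment_le mu nu : P2 mu -> P2 nu -> moment nu <= moment mu + w2 mu nu.
Proof.
move=> mu2 nu2; apply/ler_addgt0Pr => e e0; rewrite -addrA.
set c := w2 mu nu + e.
have wc : w2 mu nu < c by rewrite ltrDl.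
have c0 : 0 <= c by rewrite addr_ge0 ?w2_ge0// ltW.
have [G cG Gc] := w2_lt mu2 nu2 wc.
apply: le_add_of_young; rewrite ?moment_ge0// => s s0.
suff : ((moment nu ^+ 2)%:E <= (1 + s)%:E * (moment mu ^+ 2)%:E +
    (1 + s^-1)%:E * (c ^+ 2)%:E)%E by rewrite -!EFinM -EFinD lee_fin.
rewrite -(P2E nu2) -(P2E mu2).
rewrite -(coupling_snd (phi := fun x : V => (enorm (x : 'rV[R]_d) ^+ 2)%:E) cG); last 2 first.
  exact: measurable_enorm2.
  by move=> x; rewrite lee_fin sqr_ge0.
rewrite -(coupling_fst (phi := fun x : V => (enorm (x : 'rV[R]_d) ^+ 2)%:E) cG); last 2 first.
  exact: measurable_enorm2.
  by move=> x; rewrite lee_fin sqr_ge0.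
apply: (@le_trans _ _ ((1 + s)%:E * \int[G]_z (enorm (z.1 : 'rV[R]_d) ^+ 2)%:E +
   (1 + s^-1)%:E * transport_cost G)%E).
  apply: (integral_young s0).
  - exact: (measurableT_comp measurable_enorm measurable_fst).
  - exact: (measurableT_comp measurable_enorm (measurable_subV measurable_fst measurable_snd)).
  - exact: (measurableT_comp measurable_enorm measurable_snd).
  - apply/aeW => z; rewrite (enormB z.1).
    by rewrite -[in X in X <= _](subrKC (z.1 : 'rV[R]_d) z.2); exact: enorm_young.
by rewrite leeD2l// lee_wpmul2l// lee_fin addr_ge0// invr_ge0 ltW.
Qed.

(** Under a coupling of cost at most [c^2] the distance [D] satisfies [D <= c / 2 + D^2 / (2 c)],
    whose right-hand side integrates to at most [c]. This replaces Cauchy-Schwarz. *)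
Lemma lip_mean_le mu nu (f : 'rV[R]_d -> R) (L : R) : P2 mu -> P2 nu ->
  (forall x, 0 <= f x <= 1) -> (forall x y, `|f x - f y| <= L * enorm (x - y)) ->
  0 <= L -> mean mu (f : V -> R) <= mean nu (f : V -> R) + L * w2 mu nu.
Proof.
move=> mu2 nu2 f01 fL L0; apply/ler_addgt0Pr => e e0.
have cf : continuous f by exact: lipschitz_continuous fL.
have f0 x : 0 <= f x by have /andP[] := f01 x.
have mf : measurable_fun setT (f : V -> R) by exact: continuous_measurable_rV.
(* The excess costs [L * e / (L + 1) <= e] in the end, also when [L = 0], and makes [c] positive. *)
set c := w2 mu nu + e / (L + 1).
have L10 : 0 < L + 1 by rewrite ltr_wpDl.
have wc : w2 mu nu < c by rewrite ltrDl divr_gt0.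
have c0 : 0 < c by exact: le_lt_trans (w2_ge0 _ _) wc.
have [G cG Gc] := w2_lt mu2 nu2 wc.
have bf : bmf (f : V -> R).
  by apply: (@bmf_continuous _ _ _ 1 cf) => x; have /andP[? ?] := f01 x; rewrite ger0_norm.
have fE0 (x : V) : (0 <= (f x)%:E)%E by rewrite lee_fin.
have mfE : measurable_fun setT (fun x : V => (f x)%:E) by exact/measurable_EFinP.
have mD := @measurable_dist2 _ (V * V)%type _ _ measurable_fst measurable_snd.
have D0 (z : V * V) : (0 <= (enorm ((z.1 : 'rV[R]_d) - (z.2 : 'rV[R]_d)) ^+ 2)%:E)%E.
  by rewrite lee_fin sqr_ge0.
have k0 : (0 <= (L / (2 * c))%:E)%E by rewrite lee_fin divr_ge0// mulr_ge0// ltW.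
have k1 : 0 <= L * c / 2 by rewrite divr_ge0// mulr_ge0// ltW.
rewrite -lee_fin -(meanE _ bf) -(coupling_fst cG mfE fE0).
apply: (@le_trans _ _ (\int[G]_z ((f z.2)%:E + ((L * c / 2)%:E +
   (L / (2 * c))%:E * (enorm ((z.1 : 'rV[R]_d) - (z.2 : 'rV[R]_d)) ^+ 2)%:E)))%E).
  apply: ge0_le_integral => //.
  - exact: (measurableT_comp mfE measurable_fst).
  - apply: emeasurable_funD; first exact: (measurableT_comp mfE measurable_snd).
    by apply: emeasurable_funD; [exact: measurable_cst|exact: measurable_funeM].
  - move=> z _; rewrite -EFinM -!EFinD lee_fin.
    have := fL z.1 z.2; rewrite ler_norml => /andP[_ h].
    have ci : 0 < c^-1 by rewrite invr_gt0.
    set D := enorm _ in h *.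
    have := young D 1 ci; rewrite invrK expr1n !mulr1 => y.
    have {}y : D <= c / 2 + D ^+ 2 / (2 * c).
      rewrite (_ : D ^+ 2 / (2 * c) = c^-1 * D ^+ 2 / 2); last by field; rewrite gt_eqF.
      by move: y; lra.
    rewrite -lerBlDl; apply: (le_trans h).
    apply: (le_trans (ler_wpM2l L0 y)); rewrite mulrDr le_eqVlt; apply/orP; left; apply/eqP.
    by field; rewrite gt_eqF.
rewrite ge0_integralD//; last 3 first.
- exact: (measurableT_comp mfE measurable_snd).
- by move=> z _; rewrite adde_ge0// mule_ge0.
- by apply: emeasurable_funD; [exact: measurable_cst|exact: measurable_funeM].
rewrite ge0_integralD//; last 2 first.
- by move=> z _; rewrite mule_ge0.
- exact: measurable_funeM.
rewrite (coupling_snd cG mfE fE0) (meanE _ bf) integral_cst_prob.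
have k0r : 0 <= L / (2 * c) by rewrite -lee_fin.
rewrite ge0_integralZl_EFin//.
apply: (@le_trans _ _ ((mean nu (f : V -> R))%:E + ((L * c / 2)%:E + (L / (2 * c))%:E * (c ^+ 2)%:E))%E).
  by rewrite !leeD2l// lee_wpmul2l.
rewrite -EFinM -!EFinD lee_fin -addrA lerD2l.
rewrite (_ : L * c / 2 + L / (2 * c) * c ^+ 2 = L * c); last by field; rewrite gt_eqF.
rewrite /c mulrDr lerD2l mulrCA ler_piMr ?(ltW e0)//.
by rewrite ler_pdivrMr// mul1r lerDl.
Qed.

Lemma lip_mean mu nu (f : 'rV[R]_d -> R) (L : R) : P2 mu -> P2 nu ->
  (forall x, 0 <= f x <= 1) -> (forall x y, `|f x - f y| <= L * enorm (x - y)) ->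
  0 <= L -> `|mean mu (f : V -> R) - mean nu (f : V -> R)| <= L * w2 mu nu.
Proof.
move=> mu2 nu2 f01 fL L0; rewrite ler_norml; apply/andP; split.
  by rewrite lerNl opprB lerBlDl (w2_sym nu2 mu2); exact: lip_mean_le.
by rewrite lerBlDl; exact: lip_mean_le.
Qed.

(** The Young bound is integrated for each parameter and optimised afterwards by [le_add_of_young].
    The pointwise bound is required almost everywhere only, which is how the glued coupling provides
    it. *)
Lemma integral_minkowski d' (T : measurableType d') (G : {measure set T -> \bar R})
    (f g h : T -> R) (a b : R) : 0 <= a -> 0 <= b ->
  measurable_fun setT f -> measurable_fun setT g -> measurable_fun setT h ->
  (forall x, 0 <= h x) -> {ae G, forall x, h x <= f x + g x} ->
  (\int[G]_x (f x ^+ 2)%:E <= (a ^+ 2)%:E)%E ->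
  (\int[G]_x (g x ^+ 2)%:E <= (b ^+ 2)%:E)%E ->
  (\int[G]_x (h x ^+ 2)%:E <= ((a + b) ^+ 2)%:E)%E.
Proof.
move=> a0 b0 mf mg mh h0 hfg fa gb.
have H s : 0 < s -> (\int[G]_x (h x ^+ 2)%:E <=
    ((1 + s) * a ^+ 2 + (1 + s^-1) * b ^+ 2)%:E)%E.
  move=> s0; apply: le_trans (integral_young s0 mf mg mh _) _.
    apply: filterS hfg => x hx.
    apply: (@le_trans _ _ ((f x + g x) ^+ 2)).
      by rewrite ler_pXn2r ?nnegrE// (le_trans (h0 x) hx).
    by have := young (f x) (g x) s0; rewrite sqrrD -mulr_natl; lra.
  rewrite [leRHS]EFinD [in leRHS]EFinM [X in (_ <= _ + X)%E]EFinM.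
  apply: leeD; apply: lee_wpmul2l => //.
    by rewrite lee_fin addr_ge0// ltW.
  by rewrite lee_fin addr_ge0// invr_ge0 ltW.
have I0 : (0 <= \int[G]_x (h x ^+ 2)%:E)%E.
  by apply: integral_ge0 => x _; rewrite lee_fin sqr_ge0.
have Ifin : (\int[G]_x (h x ^+ 2)%:E)%E \is a fin_num.
  by rewrite ge0_fin_numE// (le_lt_trans (H _ ltr01))// ltry.
rewrite -(fineK Ifin) lee_fin -(sqr_sqrtr (fine_ge0 I0)).
rewrite ler_pXn2r ?nnegrE ?sqrtr_ge0 ?addr_ge0//.
apply: le_add_of_young; rewrite ?sqrtr_ge0// => s s0.
by rewrite sqr_sqrtr ?fine_ge0// -lee_fin fineK// H.
Qed.

(** Cubes of a grid of side [e / (d + 1)], indexed by the code of their integer corner; the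
    Euclidean norm is at most [d] times the sup norm, and [d + 1] covers [d = 0]. *)
Lemma small_partition (e : R) : 0 < e -> exists2 i : V -> nat,
  forall k, measurable (i @^-1` [set k]) &
  forall x y, i x = i y -> enorm ((x : 'rV[R]_d) - (y : 'rV[R]_d)) <= e.
Proof.
move=> e0; pose h := e / d.+1%:R.
have h0 : 0 < h by rewrite divr_gt0.
pose v (x : 'rV[R]_d) : 'rV[int]_d := \row_j Num.floor (x ord0 j / h).
have vE x w : v x = w <-> forall j, (w ord0 j)%:~R * h <= x ord0 j < (w ord0 j + 1)%:~R * h.
  split=> [<- j|H].
    by rewrite mxE -ler_pdivlMr// -ltr_pdivrMr// floor_itv.
  apply/rowP => j; rewrite mxE; apply/eqP; rewrite real_floor_eq ?num_real//.
  by have := H j; rewrite -ler_pdivlMr// -ltr_pdivrMr.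
exists (fun x : V => pickle (v x)) => [k|x y /(pcan_inj pickleK) xy].
  rewrite (_ : _ @^-1` _ = \bigcup_(w : 'rV[int]_d)
     (if pickle w == k then [set x : V | v x = w] else set0)).
    apply: countable_bigcupT_measurable => // w; case: ifP => // _.
    rewrite (_ : [set x : V | v x = w] = \bigcap_(j in [set: 'I_d])
       ((fun x : V => (x : 'rV[R]_d) ord0 j) @^-1` `[(w ord0 j)%:~R * h, (w ord0 j + 1)%:~R * h[)).
      apply: fin_bigcap_measurable => [|j _]; first exact: finite_finset.
      by rewrite -[X in measurable X]setTI; apply: measurable_coord => //; exact: measurable_itv.
    apply/seteqP; split => x /=; first by move=> /vE H j _; rewrite /= in_itv; exact: H.
    by move=> H; apply/vE => j; have := H j I; rewrite /= in_itv.
  apply/seteqP; split => x /=; first by move=> <-; exists (v x) => //; rewrite eqxx.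
  by move=> [w _]; case: ifP => // /eqP <- /= ->.
have /vE Hx := xy; have /vE Hy : v y = v y by [].
apply: (@le_trans _ _ (d%:R * h)).
  apply: enorm_le_sup; first exact: ltW.
  move=> j; rewrite 2!mxE.
  have := Hx j; have := Hy j; rewrite intrD mulrDl mul1r.
  by move=> /andP[? ?] /andP[? ?]; rewrite ler_norml; apply/andP; split; lra.
by rewrite /h mulrCA ler_piMr ?(ltW e0)// ler_pdivrMr// mul1r ler_nat.
Qed.

(* Two near-optimal couplings are glued along a partition of the space in small
   cells, which avoids disintegration. *)
Lemma w2_triangle mu nu rho : P2 mu -> P2 nu -> P2 rho ->
  w2 mu rho <= w2 mu nu + w2 nu rho.
Proof.
move=> mu2 nu2 rho2; apply/ler_addgt0Pr => e0 e00.
(* One third for each near-optimal coupling and one for the diameter of the cells. *)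
pose e := e0 / 3; have e3 : 0 < e by rewrite divr_gt0.
set c1 := w2 mu nu + e; set c2 := w2 nu rho + e.
have wc1 : w2 mu nu < c1 by rewrite ltrDl.
have wc2 : w2 nu rho < c2 by rewrite ltrDl.
have c10 : 0 <= c1 by rewrite addr_ge0 ?w2_ge0// ltW.
have c20 : 0 <= c2 by rewrite addr_ge0 ?w2_ge0// ltW.
have [G1 cG1 Gc1] := w2_lt mu2 nu2 wc1.
have [G2 cG2 Gc2] := w2_lt nu2 rho2 wc2.
have [i mi ie] := small_partition e3.
have m1 k : measurable ((i \o snd : V * V -> nat) @^-1` [set k]).
  have := @measurable_snd _ _ V V measurableT _ (mi k); by rewrite setTI.
have m2 k : measurable ((i \o fst : V * V -> nat) @^-1` [set k]).
  have := @measurable_fst _ _ V V measurableT _ (mi k); by rewrite setTI.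
have law12 k : G1 ((i \o snd : V * V -> nat) @^-1` [set k]) =
    G2 ((i \o fst : V * V -> nat) @^-1` [set k]).
  have [_ h1] := cG1 _ (mi k); have [h2 _] := cG2 _ (mi k).
  transitivity (nu (i @^-1` [set k])); [rewrite -h1|rewrite -h2].
    by congr (G1 _); apply/seteqP; split => -[x y] //= [].
  by congr (G2 _); apply/seteqP; split => -[x y] //= [].
have [K [K1 K2 Kae]] := coupling_glue m1 m2 law12.
pose VV : measurableType _ := (V * V)%type.
have mx : measurable_fun setT (fun w : VV * VV => w.1.1).
  exact: (measurableT_comp measurable_fst measurable_fst).
have my : measurable_fun setT (fun w : VV * VV => w.1.2).
  exact: (measurableT_comp measurable_snd measurable_fst).
have my' : measurable_fun setT (fun w : VV * VV => w.2.1).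
  exact: (measurableT_comp measurable_fst measurable_snd).
have mz : measurable_fun setT (fun w : VV * VV => w.2.2).
  exact: (measurableT_comp measurable_snd measurable_snd).
have mp := measurable_fun_pair mx mz.
pose D (f g : VV * VV -> V) (w : VV * VV) : R := enorm ((f w : 'rV[R]_d) - (g w : 'rV[R]_d)).
have mD f g : measurable_fun setT f -> measurable_fun setT g -> measurable_fun setT (D f g).
  by move=> mf mg; exact: (measurableT_comp measurable_enorm (measurable_subV mf mg)).
have mc := @measurable_dist2 _ VV _ _ measurable_fst measurable_snd.
have c0 (z : VV) : (0 <= (enorm ((z.1 : 'rV[R]_d) - (z.2 : 'rV[R]_d)) ^+ 2)%:E)%E.
  by rewrite lee_fin sqr_ge0.
have I1 : (\int[K]_w (D (fun w => w.1.1) (fun w => w.1.2) w ^+ 2)%:E <= (c1 ^+ 2)%:E)%E.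
  apply: le_trans Gc1; rewrite le_eqVlt; apply/orP; left; apply/eqP.
  apply: (@integral_marginal _ _ _ _ _ K G1 fst _ measurable_fst _ mc c0).
  move=> A mA; rewrite -[RHS](K1 _ mA); congr (K _).
  by apply/seteqP; split => -[x y] //= [].
have I2 : (\int[K]_w (D (fun w => w.2.1) (fun w => w.2.2) w ^+ 2)%:E <= (c2 ^+ 2)%:E)%E.
  apply: le_trans Gc2; rewrite le_eqVlt; apply/orP; left; apply/eqP.
  apply: (@integral_marginal _ _ _ _ _ K G2 snd _ measurable_snd _ mc c0).
  move=> A mA; rewrite -[RHS](K2 _ mA); congr (K _).
  by apply/seteqP; split => -[x y] //= [].
have I12 : (\int[K]_w ((D (fun w => w.1.1) (fun w => w.1.2) w +
     D (fun w => w.2.1) (fun w => w.2.2) w) ^+ 2)%:E <= ((c1 + c2) ^+ 2)%:E)%E.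
  apply: integral_minkowski I1 I2 => //.
  - exact: mD.
  - exact: mD.
  - by apply: measurable_funD; exact: mD.
  - by move=> w; rewrite addr_ge0// enorm_ge0.
  - exact: aeW.
have I3 : (\int[K]_w (e ^+ 2)%:E <= (e ^+ 2)%:E)%E.
  by rewrite integral_cst_prob.
have I4 : (\int[K]_w (D (fun w => w.1.1) (fun w => w.2.2) w ^+ 2)%:E <=
    ((c1 + c2 + e) ^+ 2)%:E)%E.
  apply: integral_minkowski I12 I3 => //.
  - exact: addr_ge0.
  - exact: ltW.
  - by apply: measurable_funD; exact: mD.
  - exact: mD.
  - by move=> w; exact: enorm_ge0.
  (* The path goes from [x] to [y], jumps to [y'] inside the same cell, and continues to [z]. *)
  - apply: filterS Kae => -[[x y] [y' z]] /= /ie yy'; rewrite /D /=.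
    have -> : (x : 'rV[R]_d) - (z : 'rV[R]_d) = (x - y) + (y' - z) + (y - y').
      by apply/rowP => j; rewrite !mxE; ring.
    by rewrite (le_trans (enormD _ _))// lerD// enormD.
have -> : w2 mu nu + w2 nu rho + e0 = c1 + c2 + e by rewrite /c1 /c2 /e; field.
apply: (w2_le mu2 rho2 (G := law K mp)).
- move=> A mA; have [h1 _] := cG1 _ mA; have [_ h2] := cG2 _ mA.
  have e1 : (fun w : VV * VV => (w.1.1, w.2.2)) @^-1` (A `*` setT) = (A `*` setT) `*` setT.
    by apply/seteqP; split => -[[x y] [y' z]] //= [] //= [].
  have e2 : (fun w : VV * VV => (w.1.1, w.2.2)) @^-1` (setT `*` A) = setT `*` (setT `*` A).
    by apply/seteqP; split => -[[x y] [y' z]] //= [] //= [].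
  split.
    by rewrite -h1 -[RHS]K1; [exact: (congr1 K e1)|exact: measurableX].
  by rewrite -h2 -[RHS]K2; [exact: (congr1 K e2)|exact: measurableX].
- exact: (addr_ge0 (addr_ge0 c10 c20) (ltW e3)).
apply: le_trans I4; rewrite le_eqVlt; apply/orP; left; apply/eqP; apply/esym.
exact: (@integral_marginal _ _ _ _ _ K (law K mp) _ _ mp _ mc c0).
Qed.

End wasserstein.

(** * Lower semicontinuity and tightness *)

Section lsc.
Context {R : realType} {m : nat} (F : set_system nat) {PF : ProperFilter F}.
Local Notation V := (borel_rV R m).

(** The truncations [min g k] are bounded and continuous, so their integrals converge; monotone
    convergence then removes the truncation. *)
Lemma integral_lsc (nu_ : nat -> borel_prob R m) (nu : borel_prob R m)
    (g : 'rV[R]_m -> R) (B : R) :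
  liminf_open F nu_ nu -> continuous g -> (forall x, 0 <= g x) ->
  (\forall n \near F, (\int[nu_ n]_x (g x)%:E <= B%:E)%E) ->
  (\int[nu]_x (g x)%:E <= B%:E)%E.
Proof.
move=> H cg g0 gB.
pose gk (k : nat) (x : 'rV[R]_m) := Num.min (g x) k%:R.
have ck k : continuous (gk k).
  move=> x; apply: (@continuous_comp _ _ _ g (fun t : R => Num.min t k%:R)).
    exact: cg.
  by apply: (@continuous_min R R id (cst k%:R)); [exact: cvg_id|exact: cvg_cst].
have gk0 k x : 0 <= gk k x by rewrite le_min g0 ler0n.
have gkM k x : `|gk k x| <= k%:R by rewrite ger0_norm// ge_min lexx orbT.
have bk k : bmf (gk k : V -> R) by exact: bmf_continuous (ck k) (gkM k).
have mg : measurable_fun setT (g : V -> R) by exact: continuous_measurable_rV.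
have gkB k : (\int[nu]_x (gk k x)%:E <= B%:E)%E.
  rewrite (meanE _ (bk k)) lee_fin.
  apply: (cvgr_le_cst (liminf_open_cvg H (ck k) (gkM k))).
  apply: filterS gB => n gB; rewrite -lee_fin -(meanE _ (bk k)).
  apply: le_trans gB; apply: ge0_le_integral => //.
  - by move=> x _; rewrite lee_fin.
  - by apply/measurable_EFinP; have [] := bk k.
  - exact/measurable_EFinP.
  - by move=> x _; rewrite lee_fin ge_min lexx.
have -> : (\int[nu]_x (g x)%:E = \int[nu]_x limn (fun k => (gk k x)%:E))%E.
  apply: eq_integral => x _; apply/esym/cvg_lim => //.
  apply: cvg_near_cst; exists (Num.bound (g x)) => // k /= gxk.
  congr EFin; apply/min_idPl; apply: le_trans (ltW (archi_boundP (g0 x))) _.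
  by rewrite ler_nat.
have cvgI := @cvg_monotone_convergence _ _ _ nu setT measurableT
  (fun k (x : V) => (gk k x)%:E).
apply: (@cvge_le _ \oo _ _ (fun n => \int[nu]_x (gk n x)%:E)%E).
  by apply: nearW => k; exact: gkB.
apply: cvgI.
- by move=> k; apply/measurable_EFinP; have [] := bk k.
- by move=> k x _; rewrite lee_fin.
- move=> x _ k k' kk'; rewrite lee_fin /gk le_min ge_min lexx/= ge_min.
  by rewrite ler_nat kk' orbT.
Qed.

End lsc.

Lemma pr_enorm_ge (R : realType) m (P : borel_prob R m) (B K : R) : 0 < K ->
  (\int[P]_x (enorm (x : 'rV[R]_m) ^+ 2)%:E <= B%:E)%E ->
  pr P ([set x : 'rV[R]_m | K <= enorm x] : set (borel_rV R m)) <= B / K ^+ 2.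
Proof.
move=> K0 PB; set A := ([set x : 'rV[R]_m | K <= enorm x] : set (borel_rV R m)).
have mA : measurable A.
  have := @measurable_enorm R m measurableT `[K, +oo[%classic (measurable_itv _).
  by rewrite setTI; congr measurable; apply/seteqP; split => x; rewrite /= in_itv/= andbT.
rewrite ler_pdivlMr ?exprn_gt0// mulrC -lee_fin; apply: le_trans PB.
rewrite EFinM; have -> : ((pr P A)%:E = \int[P]_x (\1_A x)%:E)%E.
  by rewrite integral_indic// setIT; exact/esym/prE.
have mI : measurable_fun setT (fun x : borel_rV R m => (\1_A x : R)%:E).
  exact/measurable_EFinP/measurable_indic.
rewrite -ge0_integralZl_EFin ?sqr_ge0//.
apply: ge0_le_integral => //.
- by move=> x _; rewrite mule_ge0// lee_fin ?sqr_ge0.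
- exact: measurable_funeM.
- exact: measurable_enorm2.
- move=> x _; rewrite -EFinM lee_fin indicE; case: (boolP (x \in A)) => xA.
    by move: xA; rewrite inE /A/= mulr1 => xA; rewrite ler_pXn2r ?nnegrE ?(ltW K0)// enorm_ge0.
  by rewrite mulr0 sqr_ge0.
Qed.

Lemma tight_of_moment (R : realType) m (P : nat -> borel_prob R m) (B : R) : 0 <= B ->
  (forall n, (\int[P n]_x (enorm (x : 'rV[R]_m) ^+ 2)%:E <= B%:E)%E) ->
  forall e : R, 0 < e -> exists K : R, forall n,
    pr (P n) ([set x : 'rV[R]_m | K <= enorm x] : set (borel_rV R m)) <= e.
Proof.
(* Since [K = 1 + B / e] is at least 1, [K^2 >= K >= B / e] and the Chebyshev bound [B / K^2] is at
   most [e]. *)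
move=> B0 PB e e0; exists (1 + B / e) => n.
have K1 : 1 <= 1 + B / e by rewrite lerDl divr_ge0// ltW.
have K0 : 0 < 1 + B / e by exact: lt_le_trans ltr01 K1.
apply: (le_trans (pr_enorm_ge K0 (PB n))).
rewrite ler_pdivrMr ?exprn_gt0//.
apply: (@le_trans _ _ (e * (1 + B / e))).
  by rewrite mulrDr mulr1 mulrCA mulfV ?gt_eqF// mulr1 lerDr ltW.
by rewrite ler_pM2l// expr2 ler_peMr// ltW.
Qed.

Section w2_lsc.
Context {R : realType} {d : nat} (U : set_system nat) {UU : UltraFilter U}.
Local Notation V := (borel_rV R d).
Local Notation VV := (borel_rV R (d + d)).

(** Couplings are moved to row vectors of length [d + d], the setting of [prokhorov_ultra]. *)
Let joinV (z : V * V) : VV := row_mx (z.1 : 'rV[R]_d) (z.2 : 'rV[R]_d).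
Let splitV (w : VV) : V * V := (lsubmx (w : 'rV[R]_(d + d)), rsubmx (w : 'rV[R]_(d + d))).

Let measurable_joinV : measurable_fun setT joinV.
Proof.
apply: measurable_fun_rV => j.
rewrite (_ : (fun z => _) = (fun z : V * V =>
   match fintype.split j with inl i => (z.1 : 'rV[R]_d) ord0 i | inr i => (z.2 : 'rV[R]_d) ord0 i end)).
  case: (fintype.split j) => i.
    exact: (measurableT_comp (measurable_coord i) measurable_fst).
  exact: (measurableT_comp (measurable_coord i) measurable_snd).
by apply/funext => z; rewrite mxE.
Qed.

Let measurable_splitV : measurable_fun setT splitV.
Proof.
apply: measurable_fun_pair; apply: measurable_fun_rV => j.
  by under eq_fun do rewrite mxE; exact: measurable_coord.
by under eq_fun do rewrite mxE; exact: measurable_coord.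
Qed.

Let sqr_enorm_join (w : 'rV[R]_(d + d)) :
  enorm w ^+ 2 = enorm (lsubmx w) ^+ 2 + enorm (rsubmx w) ^+ 2.
Proof.
rewrite !sqr_enorm big_split_ord/=.
by congr (_ + _); apply: eq_bigr => i _; rewrite mxE.
Qed.

Let lsub_le (w : 'rV[R]_(d + d)) : enorm (lsubmx w) <= enorm w.
Proof.
rewrite -(@ler_pXn2r _ 2) ?nnegrE ?enorm_ge0// (sqr_enorm_join w) lerDl.
exact: sqr_ge0.
Qed.

Let rsub_le (w : 'rV[R]_(d + d)) : enorm (rsubmx w) <= enorm w.
Proof.
rewrite -(@ler_pXn2r _ 2) ?nnegrE ?enorm_ge0// (sqr_enorm_join w) lerDr.
exact: sqr_ge0.
Qed.

(** Near-optimal couplings have bounded second moments, hence a limit along [U]. Its marginals are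
    the limits of the marginals, and the cost is lower semicontinuous. *)
Lemma w2_lsc (mu_ nu_ : nat -> borel_prob R d) (mu nu : borel_prob R d) (B c : R) :
  0 <= B -> 0 <= c ->
  (forall n, P2 (mu_ n)) -> (forall n, P2 (nu_ n)) ->
  (forall n, moment (mu_ n) <= B) -> (forall n, moment (nu_ n) <= B) ->
  P2 mu -> P2 nu -> liminf_open U mu_ mu -> liminf_open U nu_ nu ->
  (forall e, 0 < e -> \forall n \near U, w2 (mu_ n) (nu_ n) <= c + e) ->
  w2 mu nu <= c.
Proof.
move=> B0 c0 mu2 nu2 muB nuB Pmu Pnu Lmu Lnu H; apply/ler_addgt0Pr => e e0.
have PU : ProperFilter U by exact: ultra_proper.
have e20 : 0 < e / 2 by rewrite divr_gt0.
have /choice[G GP] n : exists G : probability (V * V)%type R,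
    coupling (mu_ n) (nu_ n) G /\
    (transport_cost G <= ((w2 (mu_ n) (nu_ n) + e / 2) ^+ 2)%:E)%E.
  have [G cG Gc] := w2_lt (mu2 n) (nu2 n)
    (ltac:(by rewrite ltrDl) : w2 (mu_ n) (nu_ n) < w2 (mu_ n) (nu_ n) + e / 2).
  by exists G.
have cG n : coupling (mu_ n) (nu_ n) (G n) by have [] := GP n.
pose th n : borel_prob R (d + d) := law (G n) measurable_joinV.
have en0 m (x : 'rV[R]_m) : (0 <= (enorm x ^+ 2)%:E)%E by rewrite lee_fin sqr_ge0.
have thI n (phi : VV -> \bar R) : measurable_fun setT phi -> (forall x, (0 <= phi x)%E) ->
    (\int[G n]_z phi (joinV z) = \int[th n]_w phi w)%E.
  move=> mphi phi0.
  exact: (@integral_marginal _ _ _ _ _ (G n) (th n) joinV phi measurable_joinV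
    (fun A _ => erefl) mphi phi0).
have thB n : (\int[th n]_w (enorm (w : 'rV[R]_(d + d)) ^+ 2)%:E <= (B ^+ 2 + B ^+ 2)%:E)%E.
  rewrite -(thI n _ (@measurable_enorm2 R (d + d)) (@en0 _)).
  under eq_integral do rewrite sqr_enorm_join /joinV row_mxKl row_mxKr EFinD.
  rewrite ge0_integralD//; last 2 first.
    exact: (measurableT_comp measurable_enorm2 measurable_fst).
    exact: (measurableT_comp measurable_enorm2 measurable_snd).
  rewrite (coupling_fst (cG n) measurable_enorm2 (@en0 _)).
  rewrite (coupling_snd (cG n) measurable_enorm2 (@en0 _)).
  rewrite (P2E (mu2 n)) (P2E (nu2 n)) -EFinD lee_fin.
  by apply: lerD; rewrite ler_pXn2r ?nnegrE ?moment_ge0.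
have BB0 : 0 <= B ^+ 2 + B ^+ 2 by rewrite addr_ge0 ?sqr_ge0.
have [t tL] := prokhorov_ultra (U := U) (tight_of_moment BB0 thB).
pose K := law t measurable_splitV.
have KI (phi : V * V -> \bar R) : measurable_fun setT phi -> (forall x, (0 <= phi x)%E) ->
    (\int[t]_w phi (splitV w) = \int[K]_z phi z)%E.
  move=> mphi phi0.
  exact: (@integral_marginal _ _ _ _ _ t K splitV phi measurable_splitV
    (fun A _ => erefl) mphi phi0).
(* A Lipschitz test composed with the 1-Lipschitz projection [s] is a Lipschitz test for the joint
   laws; its means have two limits along [U], which must agree. *)
have marginal (s : VV -> V) (p : V * V -> V) (rho_ : nat -> borel_prob R d) rho :
    (forall w w', enorm ((s w : 'rV[R]_d) - (s w' : 'rV[R]_d)) <=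
                  enorm ((w : 'rV[R]_(d + d)) - (w' : 'rV[R]_(d + d)))) ->
    (forall z, s (joinV z) = p z) ->
    (forall n (phi : V -> \bar R), measurable_fun setT phi -> (forall x, (0 <= phi x)%E) ->
      (\int[G n]_z phi (p z) = \int[rho_ n]_x phi x)%E) ->
    liminf_open U rho_ rho -> forall ms : measurable_fun setT s,
    forall A, measurable A -> law t ms A = rho A.
  move=> sl sp pG Lrho ms; apply: probability_eq_lip => f L f01 fL.
  have f0 x : 0 <= f x by have /andP[] := f01 x.
  have fM x : `|f x| <= 1 by rewrite ger0_norm//; have /andP[] := f01 x.
  have cf : continuous f by exact: lipschitz_continuous fL.
  have mf : measurable_fun setT (f : V -> R) by exact: continuous_measurable_rV.
  have cfs : continuous (fun w : 'rV[R]_(d + d) => f (s w)).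
    apply: (@lipschitz_continuous _ _ _ `|L|) => w w'; apply: (le_trans (fL _ _)).
    apply: (@le_trans _ _ (`|L| * enorm ((s w : 'rV[R]_d) - (s w' : 'rV[R]_d)))).
      by rewrite ler_wpM2r ?enorm_ge0// ler_norm.
    by rewrite ler_wpM2l.
  have c1 := liminf_open_cvg (PF := PU) tL cfs (fun w => fM (s w)).
  have c2 := liminf_open_cvg (PF := PU) Lrho cf fM.
  have E n : mean (th n) (fun w : VV => f (s w)) = mean (rho_ n) (f : V -> R).
    rewrite /mean /Rintegral; congr fine.
    rewrite -(pG n (fun x : V => (f x)%:E)); last 2 first.
      exact/measurable_EFinP.
      by move=> x; rewrite lee_fin.
    rewrite -(thI n (fun w : VV => (f (s w))%:E)); last 2 first.
      by apply/measurable_EFinP; exact: (measurableT_comp mf ms).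
      by move=> x; rewrite lee_fin.
    by apply: eq_integral => z _; rewrite sp.
  have <- : mean t (fun w : VV => f (s w)) = mean (law t ms) (f : V -> R).
    exact: (@mean_marginal _ _ _ _ _ t (law t ms) s (f : V -> R) ms (fun A _ => erefl) mf f0).
  rewrite (funext E) in c1.
  by rewrite -(cvg_lim (@Rhausdorff R) c1) -(cvg_lim (@Rhausdorff R) c2).
have msl : measurable_fun setT (fst \o splitV) by exact: (measurableT_comp measurable_fst).
have msr : measurable_fun setT (snd \o splitV) by exact: (measurableT_comp measurable_snd).
have ml : forall A, measurable A -> law t msl A = mu A.
  apply: (marginal _ fst mu_) => //.
  - by move=> w w' /=; rewrite -linearB lsub_le.
  - by move=> z; rewrite /= /joinV row_mxKl.
  - by move=> n phi; exact: coupling_fst (cG n).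
have mr : forall A, measurable A -> law t msr A = nu A.
  apply: (marginal _ snd nu_) => //.
  - by move=> w w' /=; rewrite -linearB rsub_le.
  - by move=> z; rewrite /= /joinV row_mxKr.
  - by move=> n phi; exact: coupling_snd (cG n).
apply: (w2_le Pmu Pnu (G := K)).
- move=> A mA.
  have e1 : splitV @^-1` (A `*` setT) = (fst \o splitV) @^-1` A.
    by apply/seteqP; split => w //= [].
  have e2 : splitV @^-1` (setT `*` A) = (snd \o splitV) @^-1` A.
    by apply/seteqP; split => w //= [].
  by split; [rewrite -ml//; exact: (congr1 t e1)|rewrite -mr//; exact: (congr1 t e2)].
- by rewrite addr_ge0// ltW.
have mc := @measurable_dist2 _ _ _ (V * V)%type _ _ measurable_fst measurable_snd.
have cc0 (z : V * V) : (0 <= (enorm ((z.1 : 'rV[R]_d) - (z.2 : 'rV[R]_d)) ^+ 2)%:E)%E by [].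
rewrite /transport_cost -(KI _ mc cc0).
apply: (integral_lsc tL (g := fun w : 'rV[R]_(d + d) => enorm (lsubmx w - rsubmx w) ^+ 2)).
- move=> w; apply: (@continuous_comp _ _ _ (fun w : 'rV[R]_(d + d) => enorm (lsubmx w - rsubmx w))
    (fun r : R => r ^+ 2)); last exact: exprn_continuous.
  apply: (@lipschitz_continuous _ _ _ 2) => {}w w'.
  apply: (le_trans (enorm_dist _ _)).
  have -> : lsubmx w - rsubmx w - (lsubmx w' - rsubmx w') =
     lsubmx (w - w') - rsubmx (w - w').
    by apply/rowP => i; rewrite !mxE; ring.
  rewrite (le_trans (enormD _ _))// enormN mulr_natl mulr2n lerD//.
- by move=> w; exact: sqr_ge0.
have := H (e / 2) e20; apply: filterS => n Hn.
rewrite -(thI n (fun w : VV => (enorm (lsubmx (w : 'rV[R]_(d + d)) - rsubmx (w : 'rV[R]_(d + d))) ^+ 2)%:E)).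
- apply: (@le_trans _ _ (transport_cost (G n))).
    rewrite le_eqVlt; apply/orP; left; apply/eqP; apply: eq_integral => z _.
    by rewrite /joinV row_mxKl row_mxKr.
  have [_ h] := GP n; apply: (le_trans h); rewrite lee_fin.
  have w0 := w2_ge0 (mu2 n) (nu2 n).
  rewrite ler_pXn2r ?nnegrE ?addr_ge0 ?(ltW e20) ?(ltW e0)//.
  by rewrite [X in _ <= c + X](splitr e) addrA lerD2r.
- exact: (measurableT_comp mc measurable_splitV).
- by move=> w; exact: cc0 (splitV w).
Qed.

End w2_lsc.

(** * The minimizing movement scheme *)

Section energy.
Context {R : realType} {d : nat} (W : 'rV[R]_d -> R).
Hypotheses (hA : assumption_A W) (hB : assumption_B W) (hC : assumption_C' W).
Local Notation V := (borel_rV R d).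

Let cW : continuous W. Proof. by have [] := hA. Qed.

(* [W + l''/2 |x|^2 + l' |x|] is convex, even and vanishes at [0], hence it is
   nonnegative. *)
Lemma potential_bound : exists2 K : R, 0 < K &
  forall x, `|W x| <= K * (1 + enorm x ^+ 2).
Proof.
have [C C0 CW] := hB; have [l' [l'' [l'0 l''0 cvx]]] := hC.
have [_ Wsym W0 _] := hA.
(* [C] is for the upper bound; the lower one uses [l''/2 |x|^2 + l' |x|] with [|x| <= 1 + |x|^2]. *)
exists (C + l'' + l'); first by rewrite -addrA ltr_pwDl// addr_ge0.
move=> x; have e0 := enorm_ge0 x.
have half01 : 0 <= (2^-1 : R) <= 1 by rewrite invr_ge0 ler0n invf_le1// ler1n.
have t01 : Itv.spec (@Itv.num_sem R) (Itv.Real `[0%Z, 1%Z]) (2^-1 : R).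
  by rewrite /= /Itv.num_sem/= num_real/= in_itv/=.
have H0 := cvx (Itv.mk t01) x (- x) (in_setT _) (in_setT _).
have : W 0 + l'' / 2 * enorm (0 : 'rV[R]_d) ^+ 2 + l' * enorm (0 : 'rV[R]_d) <=
    2^-1 * (W x + l'' / 2 * enorm x ^+ 2 + l' * enorm x) +
    (1 - 2^-1) * (W (- x) + l'' / 2 * enorm (- x) ^+ 2 + l' * enorm (- x)).
  have -> : (0 : 'rV[R]_d) = 2^-1 *: x + (1 - 2^-1) *: - x.
    by rewrite scalerN -scalerBl (_ : 2^-1 - (1 - 2^-1) = 0 :> R) ?scale0r//; lra.
  exact: H0.
rewrite W0 enorm0 expr0n/= !mulr0 !addr0.
rewrite enormN -Wsym => H.
have H1 : enorm x <= 1 + enorm x ^+ 2.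
  by have := sqr_ge0 (enorm x - 1); rewrite sqrrB1; lra.
have H2 : l' * enorm x <= l' * (1 + enorm x ^+ 2) by rewrite ler_wpM2l.
have H3 := CW x.
have H4 : 0 <= l'' * (1 + enorm x ^+ 2) by rewrite mulr_ge0// addr_ge0// sqr_ge0.
have H5 : 0 <= C * (1 + enorm x ^+ 2) by rewrite mulr_ge0 ?(ltW C0)// addr_ge0// sqr_ge0.
have H6 : 0 <= l' * (1 + enorm x ^+ 2) by rewrite mulr_ge0// addr_ge0// sqr_ge0.
have H7 : l'' / 2 * enorm x ^+ 2 <= l'' * (1 + enorm x ^+ 2).
  rewrite -mulrA ler_wpM2l//.
  by have := sqr_ge0 (enorm x); lra.
rewrite !mulrDl ler_norml; apply/andP; split; last by move: H3 H4 H6; lra.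
by move: H H2 H5 H7; lra.
Qed.

Definition energy (mu : borel_prob R d) : R := fine (interaction_energy W mu).

Lemma energy_bound : exists2 K : R, 0 < K & forall mu : borel_prob R d, P2 mu ->
  interaction_energy W mu = (energy mu)%:E /\ `|energy mu| <= K * (1 + moment mu ^+ 2).
Proof.
(* By [|x - y|^2 <= 2 |x|^2 + 2 |y|^2] the integral of [|W (x - y)|] is at most [K (1 + 4 m^2)],
   where [m] is the moment of [mu]. *)
have [K K0 WK] := potential_bound; exists (4 * K); first by rewrite mulr_gt0.
move=> mu mu2.
pose G : probability (V * V)%type R := (mu \x mu)%E.
have cG : coupling mu mu G by exact: coupling_prod.
pose f (z : V * V) : R := W ((z.1 : 'rV[R]_d) - (z.2 : 'rV[R]_d)).
have mf : measurable_fun setT f.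
  apply: (measurableT_comp (continuous_measurable_rV cW)).
  exact: measurable_subV measurable_fst measurable_snd.
have en0 (x : V) : (0 <= (enorm (x : 'rV[R]_d) ^+ 2)%:E)%E by rewrite lee_fin sqr_ge0.
have m1 : measurable_fun setT (fun z : V * V => (enorm (z.1 : 'rV[R]_d) ^+ 2)%:E).
  exact: (measurableT_comp measurable_enorm2 measurable_fst).
have m2 : measurable_fun setT (fun z : V * V => (enorm (z.2 : 'rV[R]_d) ^+ 2)%:E).
  exact: (measurableT_comp measurable_enorm2 measurable_snd).
have k2 : 0 <= 2 * K by rewrite mulr_ge0// ltW.
have I2 : (\int[G]_z `|(f z)%:E| <= (4 * K * (1 + moment mu ^+ 2))%:E)%E.
  apply: (@le_trans _ _ (\int[G]_z (K%:E + ((2 * K)%:E * (enorm (z.1 : 'rV[R]_d) ^+ 2)%:E +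
     (2 * K)%:E * (enorm (z.2 : 'rV[R]_d) ^+ 2)%:E)))%E).
    apply: ge0_le_integral => //.
    - by apply: measurableT_comp => //; exact/measurable_EFinP.
    - apply: emeasurable_funD; first exact: measurable_cst.
      by apply: emeasurable_funD; exact: measurable_funeM.
    - move=> z _; rewrite abse_EFin -!EFinM -!EFinD lee_fin.
      apply: (le_trans (WK _)); rewrite mulrDr mulr1 lerD2l -mulrDr.
      rewrite [2 * K]mulrC -mulrA ler_wpM2l ?(ltW K0)//.
      have := enorm_young (z.1 : 'rV[R]_d) (- (z.2 : 'rV[R]_d)) ltr01.
      by rewrite enormN invr1; lra.
  have g1 z : (0 <= (2 * K)%:E * (enorm (z : 'rV[R]_d) ^+ 2)%:E)%E.
    by rewrite mule_ge0// lee_fin.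
  rewrite ge0_integralD//; last 3 first.
  - by move=> z _; rewrite lee_fin ltW.
  - by move=> z _; rewrite adde_ge0.
  - by apply: emeasurable_funD; exact: measurable_funeM.
  rewrite ge0_integralD//; last 2 first.
  - exact: measurable_funeM.
  - exact: measurable_funeM.
  rewrite !ge0_integralZl_EFin// integral_cst_prob.
  rewrite (coupling_fst cG measurable_enorm2 en0) (coupling_snd cG measurable_enorm2 en0).
  rewrite (P2E mu2) -!EFinM -!EFinD lee_fin.
  have := sqr_ge0 (moment mu) => s0.
  by have := mulr_ge0 (ltW K0) s0; move: K0; lra.
have If : G.-integrable setT (EFin \o f).
  apply/integrableP; split; first exact/measurable_EFinP.
  by rewrite (le_lt_trans I2)// ltry.
have fin : (\int[G]_z (f z)%:E)%E \is a fin_num by exact: integrable_fin_num If.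
have E : interaction_energy W mu = (energy mu)%:E.
  by rewrite /energy fineK// /interaction_energy fin_numM.
split=> //; rewrite -lee_fin -abse_EFin -E /interaction_energy abseM.
apply: (@le_trans _ _ (1%:E * (4 * K * (1 + moment mu ^+ 2))%:E)%E); last by rewrite mul1e.
apply: lee_pmul => //.
  rewrite abse_EFin lee_fin ger0_norm ?invr_ge0 ?ler0n//; lra.
by apply: le_trans I2; exact: le_abse_integral (measurable_int _ If).
Qed.

Lemma argmin_mm_step (tau : R) (nu mu : borel_prob R d) : 0 < tau -> P2 nu ->
  argmin_mm W tau nu mu ->
  P2 mu /\ energy mu + w2 nu mu ^+ 2 / (2 * tau) <= energy nu.
Proof.
move=> tau0 nu2 [mu2 /(_ nu nu2)].
have [K _ H] := energy_bound.
rewrite /mm_functional (H _ mu2).1 (H _ nu2).1 (W2_w2 nu2 mu2) (W2_w2 nu2 nu2).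
rewrite w2_refl// => h; split => //; move: h.
by rewrite -!EFin_expe -!EFinM -!EFinD lee_fin expr0n/= mulr0 addr0 mulrC.
Qed.

End energy.

(** * Discrete Gronwall estimate *)

Section gronwall.
Context {R : realType}.

(** [E + 2 c a^2 + c] dominates [c a^2] by the lower bound on [E]. The square [(a + D)^2] is
    expanded with Young parameter [8 c tau]: since [2 c (1 + 1 / (8 c tau)) = 2 c + 1 / (4 tau) <= 1
    / (2 tau)], the dissipation absorbs the [D^2] term. The remaining cost [2 c * 8 c tau * a^2]
    explains the rate [16 c tau]. *)
Lemma mm_gronwall_step (c tau a a' D E E' : R) : 0 < c -> 0 < tau -> 8 * c * tau <= 1 ->
  0 <= a -> 0 <= a' -> 0 <= D -> a' <= a + D ->
  E' + D ^+ 2 / (2 * tau) <= E -> - (c * (1 + a ^+ 2)) <= E ->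
  E' + 2 * c * a' ^+ 2 + c <= (1 + 16 * c * tau) * (E + 2 * c * a ^+ 2 + c).
Proof.
move=> c0 t0 ct a0 a'0 D0 aD EE El.
have s0 : 0 < 8 * c * tau by rewrite !mulr_gt0.
have h1 : a' ^+ 2 <= (1 + 8 * c * tau) * a ^+ 2 + (1 + (8 * c * tau)^-1) * D ^+ 2.
  apply: (@le_trans _ _ ((a + D) ^+ 2)).
    by rewrite ler_pXn2r ?nnegrE// addr_ge0.
  by have := young a D s0; rewrite sqrrD -mulr_natl; lra.
have h2 : 2 * c * (1 + (8 * c * tau)^-1) * D ^+ 2 <= D ^+ 2 / (2 * tau).
  rewrite mulrC ler_wpM2l ?sqr_ge0//.
  rewrite (_ : 2 * c * _ = 2 * c + (4 * tau)^-1); last first.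
    by field; rewrite (gt_eqF c0) (gt_eqF t0).
  rewrite (_ : (2 * tau)^-1 = (4 * tau)^-1 + (4 * tau)^-1); last first.
    by field; rewrite (gt_eqF t0).
  rewrite lerD2r -[leRHS]div1r ler_pdivlMr ?mulr_gt0//.
  by move: ct; lra.
have h3 : 2 * c * a' ^+ 2 <= 2 * c * ((1 + 8 * c * tau) * a ^+ 2) + D ^+ 2 / (2 * tau).
  apply: (@le_trans _ _ (2 * c * ((1 + 8 * c * tau) * a ^+ 2 + (1 + (8 * c * tau)^-1) * D ^+ 2))).
    by rewrite ler_wpM2l// mulr_ge0// ltW.
  by rewrite mulrDr lerD2l mulrA.
have h4 : c * a ^+ 2 <= E + 2 * c * a ^+ 2 + c by move: El; lra.
have h5 : 16 * c * tau * (c * a ^+ 2) <= 16 * c * tau * (E + 2 * c * a ^+ 2 + c).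
  by rewrite ler_wpM2l// !mulr_ge0// ltW.
rewrite mulrDl mul1r; move: h5 h3 EE.
rewrite (_ : 2 * c * ((1 + 8 * c * tau) * a ^+ 2) = 2 * c * a ^+ 2 + 16 * c * tau * (c * a ^+ 2)).
  lra.
by ring.
Qed.

Lemma mm_gronwall (c e0 a0 : R) : 0 < c -> exists2 B : R -> R, (forall T, 0 <= B T) &
  forall (tau : R) (a D E : nat -> R), 0 < tau -> 8 * c * tau <= 1 ->
    (forall k, 0 <= a k) -> (forall k, 0 <= D k) ->
    (forall k, a k.+1 <= a k + D k) ->
    (forall k, E k.+1 + D k ^+ 2 / (2 * tau) <= E k) ->
    (forall k, - (c * (1 + a k ^+ 2)) <= E k) ->
    E 0%N <= e0 -> a 0%N <= a0 ->
    forall T k, k%:R * tau <= T ->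
      a k <= B T /\ \sum_(j < k) D j ^+ 2 / tau <= B T.
Proof.
move=> c0; pose Q T : R := `|e0 + 2 * c * a0 ^+ 2 + c| * expR (16 * c * T).
have Q0 T : 0 <= Q T by rewrite mulr_ge0// expR_ge0.
(* The first term bounds [a k], from [c a^2 <= Q]. The second bounds the telescoping sum
   [2 (E 0 - E k)], as [- E k <= c + c a^2 <= c + Q]. *)
exists (fun T => Num.sqrt (Q T / c) + 2 * (`|e0| + c + Q T)) => [T|tau a D E].
  by rewrite addr_ge0 ?sqrtr_ge0// mulr_ge0// !addr_ge0// ltW.
move=> t0 ct a_ge0 D_ge0 aD ED El E0 A0 T k kT.
pose Psi j := E j + 2 * c * a j ^+ 2 + c.
have PsiS j : Psi j.+1 <= (1 + 16 * c * tau) * Psi j by apply: (mm_gronwall_step (D := D j)).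
have q0 : 0 <= 1 + 16 * c * tau by have := mulr_gt0 c0 t0; lra.
have Psik : Psi k <= (1 + 16 * c * tau) ^+ k * Psi 0%N.
  elim: k {kT} => [|k ih]; first by rewrite expr0 mul1r.
  by rewrite exprS -mulrA; apply: (le_trans (PsiS k)); rewrite ler_wpM2l.
have aPsi j : c * a j ^+ 2 <= Psi j by have := El j; rewrite /Psi; lra.
have Psi0 : Psi 0%N <= `|e0 + 2 * c * a0 ^+ 2 + c|.
  apply: le_trans (ler_norm _); rewrite /Psi lerD2r lerD// ler_wpM2l ?mulr_ge0 ?(ltW c0)//.
  by rewrite ler_pXn2r ?nnegrE// (le_trans (a_ge0 0%N)).
have cak : c * a k ^+ 2 <= Q T.
  apply: (le_trans (aPsi k)); apply: (le_trans Psik).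
  rewrite mulrC /Q; apply: ler_pM => //.
  - by apply: le_trans (aPsi 0%N); rewrite mulr_ge0 ?sqr_ge0// ltW.
  - exact: exprn_ge0.
  - apply: (@le_trans _ _ (expR (16 * c * tau) ^+ k)).
      by rewrite lerXn2r ?nnegrE ?expR_ge0// expR_ge1Dx.
    rewrite -expRM_natl ler_expR mulrCA ler_wpM2l ?mulr_ge0 ?(ltW c0)//.
have s2 : a k <= Num.sqrt (Q T / c).
  rewrite -(ger0_norm (a_ge0 k)) -sqrtr_sqr ler_wsqrtr// ler_pdivlMr//.
  by rewrite mulrC.
have tele j : \sum_(i < j) D i ^+ 2 / tau <= 2 * (E 0%N - E j).
  elim: j => [|j ih]; first by rewrite big_ord0 subrr mulr0.
  rewrite big_ord_recr/=; have := ED j.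
  rewrite (_ : D j ^+ 2 / (2 * tau) = D j ^+ 2 / tau / 2); last first.
    by field; rewrite (gt_eqF t0).
  by move: ih; lra.
have := ler_norm e0 => He0.
split.
  by rewrite (le_trans s2)// lerDl mulr_ge0// !addr_ge0// ltW.
apply: (le_trans (tele k)).
have := El k; have := sqrtr_ge0 (Q T / c); move: E0 cak He0; lra.
Qed.

End gronwall.

(* Uniform estimates satisfied by the interpolated scheme with time step [tau]:
   [F] bounds the length and [e] the energy of the discrete curve; the third
   clause is Cauchy-Schwarz [(F t - F s)^2 <= (t - s + tau) (e t - e s)] in
   linearised form. *)
Definition action_control {R : realType} {d : nat} (tau : R) (c : R -> borel_prob R d)
    (F e B : R -> R) :=
  [/\ forall t, 0 <= t -> P2 (c t),
      forall s t, 0 <= s -> s <= t -> w2 (c s) (c t) <= F t - F s,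
      forall k s t, 0 < k -> 0 <= s -> s <= t ->
        2 * (F t - F s) <= k * (t - s + tau) + k^-1 * (e t - e s),
      forall s t, 0 <= s -> s <= t -> e s <= e t &
      [/\ F 0 = 0, e 0 = 0 & forall T t, 0 <= t -> t <= T ->
        moment (c t) <= B T /\ e t <= B T]].

(** * Uniform estimates for the interpolated scheme *)

Section interpolation.
Context {R : realType} {d : nat}.

(** The index is the ceiling of [t / tau]. Its time overshoots [t] by less than one step, which is
    the origin of the [tau] in [action_control]. *)
Lemma pwc_index (tau : R) (M : nat -> borel_prob R d) (c : R -> borel_prob R d) :
  0 < tau -> pwc_interpolation tau M c -> exists k : R -> nat,
    [/\ k 0 = 0%N, forall t, 0 <= t -> c t = M (k t),
        forall t, 0 <= t -> t <= (k t)%:R * tau < t + tau &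
        forall s t, 0 <= s -> s <= t -> (k s <= k t)%N].
Proof.
move=> tau0 [c0 cM]; pose k (t : R) := `|Num.ceil (t / tau)|%N.
have kE t : 0 <= t -> (k t)%:R = (Num.ceil (t / tau))%:~R :> R.
  move=> t0; rewrite natr_absz ger0_norm// ceil_ge0.
  by apply: lt_le_trans (divr_ge0 t0 (ltW tau0)); rewrite ltrN10.
have kI t : 0 <= t -> t <= (k t)%:R * tau < t + tau.
  move=> t0; rewrite kE//; have := ceil_itv (t / tau).
  rewrite intrB => /andP[h1 h2]; apply/andP; split.
    by rewrite -ler_pdivrMr.
  move: h1; rewrite ltrBlDr -(ltr_pM2r tau0) mulrDl mul1r mulfVK// gt_eqF//.
have k0 : k 0 = 0%N by rewrite /k mul0r ceil0.
exists k; split => //.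
- move=> t; rewrite le_eqVlt => /predU1P[<-|t0]; first by rewrite k0.
  have /andP[h1 h2] := kI t (ltW t0).
  have kt0 : (0 < k t)%N.
    rewrite lt0n; apply/eqP => kt; move: h1; rewrite kt mul0r.
    by move/(lt_le_trans t0); rewrite ltxx.
  rewrite (cM (k t).-1 t) ?prednK//.
  by move: h2; rewrite -(prednK kt0) -natr1 mulrDl mul1r ltrD2r.
- move=> s t s0 st; rewrite -(ler_nat R) !kE// ?(le_trans s0)// ler_int.
  by apply: le_ceil; rewrite ler_pM2r// invr_gt0.
Qed.

Lemma w2_chain (M : nat -> borel_prob R d) (j k : nat) :
  (forall i, P2 (M i)) -> (j <= k)%N ->
  w2 (M j) (M k) <= \sum_(i < k) w2 (M i) (M i.+1) - \sum_(i < j) w2 (M i) (M i.+1).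
Proof.
move=> M2; elim: k => [|k ih].
  by rewrite leqn0 => /eqP ->; rewrite subrr w2_refl.
rewrite leq_eqVlt => /predU1P[->|]; first by rewrite subrr w2_refl.
rewrite ltnS => /ih {}ih; rewrite big_ord_recr/= addrAC.
by apply: le_trans (w2_triangle (M2 j) (M2 k) (M2 k.+1)) _; rewrite lerD2r.
Qed.

Lemma sum_ord_sub (f : nat -> R) j k : (j <= k)%N ->
  \sum_(i < k) f i - \sum_(i < j) f i = \sum_(j <= i < k) f i.
Proof.
move=> jk; rewrite -!(big_mkord xpredT) (big_cat_nat _ (n := j))//=.
by rewrite addrAC subrr add0r.
Qed.

Lemma scheme_control (W : 'rV[R]_d -> R) (mu0 : borel_prob R d) :
  assumption_A W -> assumption_B W -> assumption_C' W -> P2 mu0 ->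
  exists (tau1 : R) (B : R -> R), 0 < tau1 /\
    forall tau M c, 0 < tau -> tau < tau1 -> mm_scheme W mu0 tau M ->
      pwc_interpolation tau M c -> exists F e, action_control tau c F e B.
Proof.
move=> hA hB hC mu02.
have [K K0 HK] := energy_bound hA hB hC.
have [B0 B0_ge0 HB] := mm_gronwall (energy W mu0) (moment mu0) K0.
(* [1 / (8 K)] is the smallness required by Gronwall; [tau < 1] keeps the grid time after [t <= T]
   below [T + 1]. *)
exists (Num.min 1 (8 * K)^-1), (fun T => B0 (T + 1)).
split; first by rewrite lt_min ltr01 invr_gt0 mulr_gt0.
move=> tau M c tau0; rewrite lt_min => /andP[tau1 tauK] [M0 MS] pwc.
have M2 i : P2 (M i).
  by elim: i => [|i ih]; [rewrite M0|have [] := argmin_mm_step hA hB hC tau0 ih (MS i)].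
pose D i := w2 (M i) (M i.+1).
have D0 i : 0 <= D i by exact: w2_ge0.
have bnd T k : k%:R * tau <= T -> moment (M k) <= B0 T /\ \sum_(j < k) D j ^+ 2 / tau <= B0 T.
  apply: (HB tau (fun i => moment (M i)) D (fun i => energy W (M i))) => //.
  - rewrite mulrC -ler_pdivlMr ?mulr_gt0// div1r; exact: ltW.
  - by move=> i; exact: moment_ge0.
  - by move=> i; exact: moment_le.
  - by move=> i; have [] := argmin_mm_step hA hB hC tau0 (M2 i) (MS i).
  - move=> i; have [_] := HK _ (M2 i).
    by rewrite ler_norml => /andP[].
  - by rewrite M0.
  - by rewrite M0.
have [k [k0 ck kI kmono]] := pwc_index tau0 pwc.
exists (fun t => \sum_(i < k t) D i), (fun t => \sum_(i < k t) D i ^+ 2 / tau).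
split.
- by move=> t t0; rewrite ck.
- move=> s t s0 st; rewrite !ck ?(le_trans s0)//.
  by apply: w2_chain => //; exact: kmono.
- move=> a s t a0 s0 st; rewrite (sum_ord_sub D (kmono _ _ s0 st)) (sum_ord_sub (fun i => D i ^+ 2 / tau) (kmono _ _ s0 st)).
  have t0 := le_trans s0 st.
  have /andP[s1 s2] := kI s s0; have /andP[t1 t2] := kI t t0.
  (* Each step obeys [2 D i <= a tau + D i^2 / (a tau)], and the steps between [s] and [t] last at
     most [t - s + tau]. *)
  apply: (@le_trans _ _ (\sum_(k s <= i < k t) (a * tau + a^-1 * (D i ^+ 2 / tau)))).
    rewrite mulr_sumr; apply: ler_sum => i _.
    have := young 1 (D i) (mulr_gt0 a0 tau0).
    by rewrite mul1r expr1n mulr1 invfM -mulrA [tau^-1 * _]mulrC.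
  rewrite big_split/= -[X in _ + X <= _]mulr_sumr lerD2r sumr_const_nat -mulrnAr ler_wpM2l ?(ltW a0)//.
  rewrite -mulr_natl natrB ?kmono// mulrBl.
  by move: s1 t2; lra.
- move=> s t s0 st; rewrite -subr_ge0 (sum_ord_sub (fun i => D i ^+ 2 / tau) (kmono _ _ s0 st)).
  by apply: sumr_ge0 => i _; rewrite divr_ge0 ?sqr_ge0// ltW.
- split; rewrite ?k0 ?big_ord0// => T t t0 tT; rewrite ck//.
  apply: bnd; have /andP[_ h] := kI t t0; apply: (le_trans (ltW h)).
  by rewrite lerD// ltW.
Qed.

End interpolation.

(** * The limit curve *)

(** [U] contains every finite intersection of the [A j] and every cofinite set, so such an
    intersection has elements beyond any bound. *)
Lemma diagonal_subsequence (U : set_system nat) (A : nat -> set nat) :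
  ProperFilter U -> \oo `<=` U -> (forall j, U (A j)) ->
  exists phi : nat -> nat, (forall k, (phi k < phi k.+1)%N) /\
    forall j k, (j <= k)%N -> A j (phi k).
Proof.
move=> PU ooU UA.
have UI k : U [set n | forall j, (j <= k)%N -> A j n].
  elim: k => [|k ih].
    by apply: filterS (UA 0%N) => n An j; rewrite leqn0 => /eqP ->.
  apply: filterS2 ih (UA k.+1) => n h1 h2 j.
  by rewrite leq_eqVlt => /predU1P[->//|]; rewrite ltnS; exact: h1.
have /choice[next nextP] (kb : nat * nat) : exists n, (kb.2 <= n)%N /\
    forall j, (j <= kb.1)%N -> A j n.
  have Ub : U [set n | (kb.2 <= n)%N] by apply: ooU; exists kb.2.
  by have [n [h1 h2]] := filter_ex (filterI Ub (UI kb.1)); exists n.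
pose phi := fix phi k := if k is k'.+1 then next (k, (phi k').+1) else next (0, 0)%N.
exists phi; split.
  by move=> k; have [] := nextP (k.+1, (phi k).+1).
move=> j k jk; suff : forall j, (j <= k)%N -> A j (phi k) by exact.
by case: k {jk} => [|k]; [have [] := nextP (0, 0)%N|have [] := nextP (k.+1, (phi k).+1)].
Qed.

Lemma open_obox {R : realType} {d : nat} b : open (@obox R d b).
Proof.
rewrite openE => x bx.
suff H i : nbhs x [set y : 'rV[R]_d | ratr (b.1 ord0 i) < y ord0 i < ratr (b.2 ord0 i)].
  exact: (@filter_forall _ _ _ (nbhs x) _ H).
pose I := `]ratr (b.1 ord0 i), ratr (b.2 ord0 i)[%classic : set R.
have oI : open ((fun y : 'rV[R]_d => y ord0 i) @^-1` I).
  apply: open_comp => [y _|]; last exact: interval_open.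
  exact: coord_continuous.
rewrite (_ : [set y | _] = (fun y : 'rV[R]_d => y ord0 i) @^-1` I).
  by apply: open_nbhs_nbhs; split => //; rewrite /I /= in_itv; exact: bx.
by apply/seteqP; split => y; rewrite /I /= in_itv.
Qed.

Section compactness.
Context {R : realType} {d : nat}.
Local Notation V := (borel_rV R d).
Variables (tau_ : nat -> R) (c_ : nat -> R -> borel_prob R d).
Variables (F_ e_ : nat -> R -> R) (B : R -> R).
Hypothesis tau_gt0 : forall n, 0 < tau_ n.
Hypothesis tau_le1 : forall n, tau_ n <= 1.
Hypothesis tau_cvg : tau_ n @[n --> \oo] --> 0.
Hypothesis ctrl : forall n, action_control (tau_ n) (c_ n) (F_ n) (e_ n) B.

Let cP2 n t : 0 <= t -> P2 (c_ n t).
Proof. by have [h _ _ _ _] := ctrl n; exact: h. Qed.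

Let cF n s t : 0 <= s -> s <= t -> w2 (c_ n s) (c_ n t) <= F_ n t - F_ n s.
Proof. by have [_ h _ _ _] := ctrl n; exact: h. Qed.

Let Fe n k s t : 0 < k -> 0 <= s -> s <= t ->
  2 * (F_ n t - F_ n s) <= k * (t - s + tau_ n) + k^-1 * (e_ n t - e_ n s).
Proof. by have [_ _ h _ _] := ctrl n; exact: h. Qed.

Let e_nd n s t : 0 <= s -> s <= t -> e_ n s <= e_ n t.
Proof. by have [_ _ _ h _] := ctrl n; exact: h. Qed.

Let cB n T t : 0 <= t -> t <= T -> moment (c_ n t) <= B T.
Proof. by have [_ _ _ _ [_ _ h]] := ctrl n => t0 tT; have [] := h T t t0 tT. Qed.

Let eB n T t : 0 <= t -> t <= T -> e_ n t <= B T.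
Proof. by have [_ _ _ _ [_ _ h]] := ctrl n => t0 tT; have [] := h T t t0 tT. Qed.

Let e_ge0 n t : 0 <= t -> 0 <= e_ n t.
Proof.
by move=> t0; have [_ _ _ _ [_ e0 _]] := ctrl n; rewrite -e0; exact: e_nd.
Qed.

Let B_ge0 T : 0 <= T -> 0 <= B T.
Proof. by move=> T0; apply: le_trans (moment_ge0 (c_ 0%N T)) _; exact: cB. Qed.

Let F_nd n s t : 0 <= s -> s <= t -> F_ n s <= F_ n t.
Proof.
move=> s0 st; rewrite -subr_ge0; apply: le_trans (cF n s0 st).
by apply: w2_ge0; apply: cP2 => //; exact: le_trans st.
Qed.

Let F_bound n t : 0 <= t -> `|F_ n t| <= t + 1 + B t.
Proof.
move=> t0; have [_ _ _ _ [F0 e0 _]] := ctrl n.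
have Fn0 : 0 <= F_ n t by rewrite -F0; exact: F_nd.
rewrite ger0_norm//; have := Fe n ltr01 (lexx 0) t0.
have := eB n t0 (lexx t); have := tau_le1 n; have := B_ge0 t0.
by rewrite F0 e0 invr1; lra.
Qed.

(** Equicontinuity from the right at [t], up to finitely many [n]: [k] is taken large to make the
    [e] term at most [eta], then [q - t] and [tau_ n] small compared with [eta / k]. *)
Let small_gap (t eta : R) : 0 <= t -> 0 < eta -> exists2 del : R, 0 < del &
  forall q, t <= q -> q <= t + del ->
    \forall n \near \oo, F_ n q - F_ n t <= eta.
Proof.
move=> t0 eta0; have B1 : 0 <= B (t + 1) by rewrite B_ge0// addr_ge0.
pose k := 1 + B (t + 1) / eta.
have k1 : 1 <= k by rewrite lerDl divr_ge0// ltW.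
have k0 : 0 < k by exact: lt_le_trans ltr01 k1.
have kB : k^-1 * B (t + 1) <= eta.
  by rewrite mulrC ler_pdivrMr// /k mulrDr mulr1 mulrCA mulfV ?gt_eqF// mulr1 lerDr ltW.
exists (Num.min 1 (eta / 2 / k)); first by rewrite lt_min ltr01 !divr_gt0.
move=> q tq; rewrite -lerBlDl le_min => /andP[q1 qk].
have ek0 : 0 < eta / 2 / k by rewrite !divr_gt0.
apply: filterS (cvgr_le _ tau_cvg _ ek0) => n tn.
have q0 : 0 <= q by exact: le_trans tq.
have h1 := Fe n k0 t0 tq.
have h2 : k^-1 * (e_ n q - e_ n t) <= eta.
  apply: le_trans kB; rewrite ler_wpM2l ?invr_ge0 ?(ltW k0)//.
  have := e_ge0 n t0; have := @eB n (t + 1) q q0; lra.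
have h3 : k * (q - t + tau_ n) <= eta.
  rewrite mulrC -ler_pdivlMr// (_ : eta / k = eta / 2 / k + eta / 2 / k); last first.
    by field; rewrite gt_eqF.
  exact: lerD.
by move: h1 h2 h3; lra.
Qed.

Lemma compactness : exists (phi : nat -> nat) (mu : R -> borel_prob R d) (F e : R -> R),
  [/\ forall k, (phi k < phi k.+1)%N,
      forall t, 0 <= t -> P2 (mu t),
      forall t, 0 <= t -> narrow_cvg (fun n => c_ (phi n) t) (mu t),
      forall s t, 0 <= s -> s <= t -> w2 (mu s) (mu t) <= F t - F s &
      (forall k s t, 0 < k -> 0 <= s -> s <= t ->
        2 * (F t - F s) <= k * (t - s) + k^-1 * (e t - e s)) /\
      forall s t, 0 <= s -> s <= t -> e s <= e t].
Proof.
have [U [UU ooU]] := @ultraFilterLemma nat \oo _.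
have PU : ProperFilter U by exact: ultra_proper.
have /choice[mu muL] t : exists nu, 0 <= t -> liminf_open U (fun n => c_ n t) nu.
  have [t0|] := boolP (0 <= t); last by exists (c_ 0%N 0).
  have BB : 0 <= B t ^+ 2 by exact: sqr_ge0.
  have cBB n : (\int[c_ n t]_x (enorm (x : 'rV[R]_d) ^+ 2)%:E <= (B t ^+ 2)%:E)%E.
    rewrite (P2E (cP2 n t0)) lee_fin ler_pXn2r ?nnegrE ?moment_ge0 ?B_ge0//.
    exact: cB.
  have [nu Hnu] := prokhorov_ultra (U := U) (tight_of_moment BB cBB).
  by exists nu.
have /choice[F FL] t : exists l : R, 0 <= t -> F_ n t @[n --> U] --> l.
  have [t0|] := boolP (0 <= t); last by exists 0.
  by have [l Hl] := ultra_cvgr (U := U) (fun n => F_bound n t0); exists l.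
have /choice[e eL] t : exists l : R, 0 <= t -> e_ n t @[n --> U] --> l.
  have [t0|] := boolP (0 <= t); last by exists 0.
  have eM n : `|e_ n t| <= B t by rewrite ger0_norm ?e_ge0//; exact: eB.
  by have [l Hl] := ultra_cvgr (U := U) eM; exists l.
have tauU : tau_ n @[n --> U] --> 0 by move=> O /tau_cvg; exact: ooU.
have mu2 t : 0 <= t -> P2 (mu t).
  move=> t0; apply: (@le_lt_trans _ _ (B t ^+ 2)%:E); last by rewrite ltry.
  apply: (integral_lsc (muL t t0) (g := fun x : 'rV[R]_d => enorm x ^+ 2)).
  - move=> x; apply: (@continuous_comp _ _ _ (@enorm R d) (fun r : R => r ^+ 2)).
      exact: enorm_continuous.
    exact: exprn_continuous.
  - by move=> x; exact: sqr_ge0.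
  - apply: nearW => n; rewrite (P2E (cP2 n t0)) lee_fin.
    by rewrite ler_pXn2r ?nnegrE ?moment_ge0 ?B_ge0//; exact: cB.
have Fst s t : 0 <= s -> s <= t -> F_ n t - F_ n s @[n --> U] --> F t - F s.
  by move=> s0 st; apply: cvgB; apply: FL => //; exact: le_trans st.
have w2F s t : 0 <= s -> s <= t -> w2 (mu s) (mu t) <= F t - F s.
  move=> s0 st; have t0 := le_trans s0 st.
  have F0 : 0 <= F t - F s.
    rewrite -oppr_le0; apply: (cvgr_le_cst (cvgN (Fst _ _ s0 st))).
    by apply: nearW => n; rewrite oppr_le0 subr_ge0 F_nd.
  apply: (w2_lsc (U := U) (mu_ := fun n => c_ n s) (nu_ := fun n => c_ n t) (B := B t)) => //.
  - exact: B_ge0.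
  - by move=> n; exact: cP2.
  - by move=> n; exact: cP2.
  - by move=> n; exact: cB.
  - by move=> n; exact: cB.
  - exact: mu2.
  - exact: mu2.
  - exact: muL.
  - exact: muL.
  - move=> eps eps0.
    have h : F t - F s < F t - F s + eps by rewrite ltrDl.
    apply: filterS (cvgr_le _ (Fst _ _ s0 st) _ h) => n; apply: le_trans.
    exact: cF.
(* A code stands for a rational time, a finite union of boxes and a tolerance [1 / (N + 1)]; other
   codes and negative times impose nothing. *)
pose A (j : nat) : set nat :=
  if (unpickle j : option (rat * seq ('rV[rat]_d * 'rV[rat]_d) * nat)) is Some qsN then
    if 0 <= ratr qsN.1.1 :> R then
      [set n | pr (mu (ratr qsN.1.1)) (oboxes qsN.1.2 : set V) <=
               pr (c_ n (ratr qsN.1.1)) (oboxes qsN.1.2 : set V) + qsN.2.+1%:R^-1]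
    else setT
  else setT.
have UA j : U (A j).
  rewrite /A; case: unpickle => [[[q s] N]|]; last exact: filterT.
  case: ifPn => [/= q0|_]; last exact: filterT.
  have N0 : 0 < N.+1%:R^-1 :> R by rewrite invr_gt0.
  apply: (muL _ q0 _ _ _ N0); rewrite oboxesE; apply: bigcup_open => b _.
  exact: open_obox.
have [phi [phiS phiA]] := diagonal_subsequence PU ooU UA.
have phi_ge n : (n <= phi n)%N.
  by elim: n => // n ih; exact: leq_ltn_trans ih (phiS n).
have phi_oo : phi n @[n --> \oo] --> \oo.
  move=> O [N _ NO]; exists N => // n /= Nn; apply: NO => /=.
  exact: leq_trans (phi_ge n).
have subseq (P : nat -> Prop) : (\forall n \near \oo, P n) -> \forall n \near \oo, P (phi n).
  by move=> H; exact: phi_oo H.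
have rat_liminf (q : rat) : 0 <= ratr q :> R ->
    liminf_open \oo (fun n => c_ (phi n) (ratr q)) (mu (ratr q)).
  move=> q0; apply: liminf_open_boxes => s eps eps0.
  have [N eN] : exists N : nat, N.+1%:R^-1 < eps.
    exists (Num.bound eps^-1); rewrite invf_plt ?posrE//.
    apply: (@lt_trans _ _ (Num.bound eps^-1)%:R); last by rewrite ltr_nat.
    by rewrite archi_boundP// invr_ge0 ltW.
  exists (pickle (q, s, N)) => // k /= jk.
  have := phiA _ _ jk; rewrite /A pickleK /= q0 => /le_trans; apply.
  by rewrite lerD2l ltW.
(* From [t] to a rational [q] on the right in the limit curve, convergence at [q], then back to [t]
   in the discrete curve: three errors of [eps / 4]. The gap of the limit curve is inherited from
   the discrete ones along [U]. *)
have t_liminf t : 0 <= t -> liminf_open \oo (fun n => c_ (phi n) t) (mu t).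
  move=> t0; apply: liminf_open_lip => f L f01 fL0 eps eps0.
  have fL x y : `|f x - f y| <= `|L| * enorm (x - y).
    by apply: (le_trans (fL0 x y)); rewrite ler_wpM2r ?enorm_ge0// ler_norm.
  have cf : continuous f by exact: lipschitz_continuous fL.
  have fM x : `|f x| <= 1 by have /andP[? ?] := f01 x; rewrite ger0_norm.
  have L1 : 0 < 4 * (`|L| + 1) by rewrite mulr_gt0// ltr_wpDl.
  pose eta := eps / (4 * (`|L| + 1)).
  have eta0 : 0 < eta by rewrite divr_gt0.
  have Leta : `|L| * eta <= eps / 4.
    rewrite /eta mulrCA ler_pM2l// ler_pdivrMr// mulrA mulVf// mul1r lerDl//.
  have [del del0 gap] := small_gap t0 eta0.
  have [q] := @rat_in_itvoo R t (t + del) (ltac:(by rewrite ltrDl)).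
  rewrite in_itv/= => /andP[tq qd].
  have q0 : 0 <= ratr q :> R by exact: le_trans (ltW tq).
  have gq := gap _ (ltW tq) (ltW qd).
  have Fq : F (ratr q) - F t <= eta.
    exact: (cvgr_le_cst (Fst _ _ t0 (ltW tq)) (ooU _ gq)).
  have h1 : mean (mu t) (f : V -> R) <= mean (mu (ratr q)) (f : V -> R) + eps / 4.
    have := lip_mean (mu2 _ t0) (mu2 _ q0) f01 fL (normr_ge0 L).
    rewrite ler_norml => /andP[_]; rewrite lerBlDl => /le_trans; apply.
    rewrite lerD2l (le_trans _ Leta)// ler_wpM2l// (le_trans _ Fq)//.
    exact: w2F (ltW tq).
  have h20 : mean (mu (ratr q)) (f : V -> R) - eps / 4 < mean (mu (ratr q)) (f : V -> R).
    by rewrite ltrBlDr ltrDl divr_gt0.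
  have h2 : \forall n \near \oo, mean (mu (ratr q)) (f : V -> R) - eps / 4 <=
      mean (c_ (phi n) (ratr q)) (f : V -> R).
    exact: (cvgr_ge _ (liminf_open_cvg (rat_liminf q q0) cf fM) _ h20).
  apply: filterS2 h2 (subseq _ gq) => n h2 h3.
  have h4 : mean (c_ (phi n) (ratr q)) (f : V -> R) <= mean (c_ (phi n) t) (f : V -> R) + eps / 4.
    have := lip_mean (cP2 (phi n) t0) (cP2 (phi n) q0) f01 fL (normr_ge0 L).
    rewrite distrC ler_norml => /andP[_]; rewrite lerBlDl => /le_trans; apply.
    rewrite lerD2l (le_trans _ Leta)// ler_wpM2l// (le_trans _ h3)//.
    exact: cF (ltW tq).
  by move: h1 h2 h4; lra.
exists phi, mu, F, e; split => //.
- move=> t t0 f cf [M fM].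
  have bf : bmf (f : V -> R) by exact: bmf_continuous cf fM.
  rewrite [X in _ --> X](meanE (mu t) bf).
  rewrite (_ : (fun n => \int[c_ (phi n) t]_x (f x)%:E)%E =
      (fun n => (mean (c_ (phi n) t) (f : V -> R))%:E)).
    apply/fine_cvgP; split; last exact: (liminf_open_cvg (t_liminf t t0) cf fM).
    by near=> n.
  by apply/funext => n; rewrite (meanE (c_ (phi n) t) bf).
- split.
    move=> k s t k0 s0 st; have t0 := le_trans s0 st.
    rewrite -lerBlDr.
    have H : 2 * (F_ n t - F_ n s) - k^-1 * (e_ n t - e_ n s) - k * tau_ n @[n --> U] -->
        2 * (F t - F s) - k^-1 * (e t - e s) - k * 0.
      apply: cvgB; [apply: cvgB|]; apply: cvgM; try exact: cvg_cst.
      - exact: Fst.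
      - by apply: cvgB; exact: eL.
      - exact: tauU.
    rewrite mulr0 subr0 in H; apply: (cvgr_le_cst H); apply: nearW => n.
    by have := Fe n k0 s0 st; lra.
  move=> s t s0 st; have t0 := le_trans s0 st.
  rewrite -subr_le0; apply: (cvgr_le_cst (cvgB (eL _ s0) (eL _ t0))).
  by apply: nearW => n; rewrite subr_le0 e_nd.
Unshelve. all: by end_near. Qed.

End compactness.

(** * Absolutely continuous curves *)

Section stieltjes.
Context {R : realType}.
Local Notation leb := (@lebesgue_measure R).

Section cumul.
Variables (f : R -> R) (nd : {homo f : x y / x <= y}) (rc : right_continuous f).

Definition cumul : cumulative R R := HB.pack f (isCumulative.Build R _ R f nd rc).

Definition stieltjes : {measure set (measurableTypeR R) -> \bar R} :=
  lebesgue_stieltjes_measure cumul.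

Lemma stieltjes_itv (a b : R) : a <= b ->
  stieltjes (`]a, b]%classic : set (measurableTypeR R)) = (f b - f a)%:E.
Proof.
move=> ab; rewrite /stieltjes /= /lebesgue_stieltjes_measure /measure_extension.
rewrite measurable_mu_extE/=; last exact: is_ocitv.
by rewrite wlength_itv_bnd.
Qed.

End cumul.

(** Both sides are measures that agree on the intervals []a, b]]. *)
Lemma stieltjes_add (f g h : R -> R) (nf : {homo f : x y / x <= y}) (rf : right_continuous f)
    (ng : {homo g : x y / x <= y}) (rg : right_continuous g)
    (nh : {homo h : x y / x <= y}) (rh : right_continuous h) (k : {nonneg R}) :
  (forall x, h x = f x + k%:num * g x) ->
  forall A, measurable A ->
    stieltjes nh rh A = (stieltjes nf rf A + k%:num%:E * stieltjes ng rg A)%E.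
Proof.
move=> hE A mA.
pose m : {measure set (measurableTypeR R) -> \bar R} := measure_add (stieltjes nf rf) (mscale k (stieltjes ng rg)).
have mE B : m B = (stieltjes nf rf B + k%:num%:E * stieltjes ng rg B)%E.
  exact: (measure_addE (stieltjes nf rf) (mscale k (stieltjes ng rg)) B).
rewrite -mE.
apply: lebesgue_stieltjes_measure_unique => // _ [[a b] _ <-] /=.
have [ab|ba] := leP a b; last first.
  rewrite set_itv_ge; last by rewrite bnd_simp -leNgt ltW.
  exact: (etrans (measure0 (stieltjes nh rh)) (esym (measure0 m))).
apply: etrans (stieltjes_itv nh rh ab) _.
apply: etrans _ (esym (mE _)).
rewrite (stieltjes_itv nf rf ab) (stieltjes_itv ng rg ab) !hE -EFinM -EFinD.
by congr EFin; ring.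
Qed.

Section ac.
Variables P E : R -> R.
Hypotheses (ndP : {homo P : x y / x <= y}) (ndE : {homo E : x y / x <= y}).
Hypothesis rcE : right_continuous E.
Hypothesis PE : forall k s t, 0 < k -> s <= t ->
  2 * k * (P t - P s) <= k ^+ 2 * (t - s) + (E t - E s).

Lemma right_continuous_of_le : right_continuous P.
Proof.
move=> x; apply/cvgrPdist_le => e e0.
have hE : \forall y \near x^'+, `|E x - E y| <= e by move/cvgrPdist_le : (@rcE x) => /(_ _ e0).
near=> y.
have xy : x < y by near: y; exact: nbhs_right_gt.
rewrite distrC ger0_norm ?subr_ge0 ?ndP ?ltW//.
have h1 : y - x < e.
  rewrite ltrBlDr addrC; near: y; apply: nbhs_right_lt.
  by rewrite ltrDl.
have h2 : E y - E x <= e.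
  have : `|E x - E y| <= e by near: y.
  by rewrite distrC ger0_norm// subr_ge0 ndE// ltW.
have := PE ltr01 (ltW xy); rewrite mulr1 expr1n mul1r.
by move: h1 h2; lra.
Unshelve. all: by end_near. Qed.

Hypothesis rcP : right_continuous P.

(** [E + k^2 x - 2 k P] is nondecreasing, so it has a nonnegative Stieltjes measure; this carries
    the inequality from intervals to all Borel sets. *)
Lemma ac_measure_le (k : R) (A : set (measurableTypeR R)) : 0 < k -> measurable A ->
  ((2 * k)%:E * stieltjes ndP rcP A <= (k ^+ 2)%:E * leb A + stieltjes ndE rcE A)%E.
Proof.
move=> k0 mA.
pose f x := E x + k ^+ 2 * x.
pose h x := f x - 2 * k * P x.
have k2 : 0 <= k ^+ 2 by exact: sqr_ge0.
have ndf : {homo f : x y / x <= y}.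
  by move=> x y xy; rewrite /f lerD ?ndE// ler_wpM2l.
have rcf : right_continuous f.
  by move=> x; apply: cvgD; [exact: rcE|apply: cvgM; [exact: cvg_cst|exact: cvg_within]].
have ndh : {homo h : x y / x <= y}.
  by move=> x y xy; have := PE k0 xy; rewrite /h /f; lra.
have rch : right_continuous h.
  by move=> x; apply: cvgB; [exact: rcf|apply: cvgM; [exact: cvg_cst|exact: rcP]].
have ndi : {homo (fun x : R => x) : x y / x <= y} by [].
have rci : right_continuous (fun x : R => x) by move=> x; exact: cvg_within.
have c2 : (0 <= 2 * k)%R by rewrite mulr_ge0// ltW.
have E1 := stieltjes_add ndE rcE ndi rci ndf rcf (k := NngNum k2) (fun x => erefl) mA.
have E2 := stieltjes_add ndh rch ndP rcP ndf rcf (k := NngNum c2) _ mA.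
have lebE : leb A = stieltjes ndi rci A.
  apply: (lebesgue_measure_unique (mu := stieltjes ndi rci) _ mA) => _ [[a b] _ <-] /=.
  have [ab|ba] := leP a b; last first.
    rewrite set_itv_ge; last by rewrite bnd_simp -leNgt ltW.
    exact: (etrans (measure0 leb) (esym (measure0 (stieltjes ndi rci)))).
  apply: etrans _ (esym (stieltjes_itv ndi rci ab)).
  apply: etrans (lebesgue_measure_itv _) _ => /=.
  by rewrite lte_fin lt_neqAle ab andbT; case: eqVneq => [->|_] /=; rewrite ?subrr ?EFinB.
rewrite lebE addeC -E1 E2; last by move=> x; rewrite /h subrK.
by rewrite leeDr.
Qed.

End ac.
End stieltjes.

(** * Square-integrable density of a length function *)

Section density.
Context {R : realType}.
Local Notation leb := (@lebesgue_measure R).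

(** [f] has derivative [a] at [t], in little-o form: such estimates add up and compare directly,
    with no quotient to divide out. *)
Definition slope (f : R -> R) (t a : R) : Prop :=
  forall e, 0 < e -> \forall s \near t, `|f s - f t - a * (s - t)| <= e * `|s - t|.

Lemma slope_derivable (f : R -> R) t a : derivable f t 1 -> f^`()%classic t = a -> slope f t a.
Proof.
move=> df fa e e0.
have : is_derive t 1 f a by apply: DeriveDef => //; rewrite -derive1E.
move=> /is_derive1_caratheodory[g [fg cg ga]].
have h : \forall s \near t, `|g t - g s| <= e by move/cvgrPdist_le : cg => /(_ _ e0).
near=> s; rewrite fg -mulrBl normrM ler_wpM2r//.
by rewrite -ga distrC; near: s.
Unshelve. all: by end_near. Qed.

Lemma slope_unique (f : R -> R) t a b : slope f t a -> slope f t b -> a = b.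
Proof.
move=> fa fb; apply/eqP; rewrite -subr_eq0 -normr_le0; apply/ler_addgt0Pl => e e0.
rewrite addr0.
have e2 : 0 < e / 2 by rewrite divr_gt0.
have h1 : \forall s \near t^'+, `|f s - f t - a * (s - t)| <= e / 2 * `|s - t|.
  exact: cvg_within (fa _ e2).
have h2 : \forall s \near t^'+, `|f s - f t - b * (s - t)| <= e / 2 * `|s - t|.
  exact: cvg_within (fb _ e2).
near t^'+ => s.
have u0 : 0 < s - t by rewrite subr_gt0; near: s; exact: nbhs_right_gt.
rewrite -(ler_pM2r u0) -{1}(gtr0_norm u0) -normrM mulrBl.
have -> : a * (s - t) - b * (s - t) = (f s - f t - b * (s - t)) - (f s - f t - a * (s - t)) by ring.
apply: le_trans (ler_normB _ _) _; rewrite (splitr e) mulrDl -[in leRHS](gtr0_norm u0).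
by rewrite lerD//; near: s.
Unshelve. all: by end_near. Qed.

Lemma slopeD (f g : R -> R) t a b : slope f t a -> slope g t b -> slope (fun x => f x + g x) t (a + b).
Proof.
move=> fa gb e e0; have e2 : 0 < e / 2 by rewrite divr_gt0.
apply: filterS2 (fa _ e2) (gb _ e2) => s h1 h2.
rewrite [X in `|X|](_ : _ = (f s - f t - a * (s - t)) + (g s - g t - b * (s - t))); last by ring.
by apply: le_trans (ler_normD _ _) _; apply: le_trans (lerD h1 h2) _; lra.
Qed.

Lemma slopeN (f : R -> R) t a : slope f t a -> slope (fun x => - f x) t (- a).
Proof.
move=> fa e e0; apply: filterS (fa _ e0) => s.
by rewrite -normrN; congr (`|_| <= _); ring.
Qed.

Lemma aeS (p q : R -> Prop) : (forall t, p t -> q t) ->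
  {ae leb, forall t, p t} -> {ae leb, forall t, q t}.
Proof. by move=> pq; exact: (@filterS _ _ (ae_filter_ringOfSetsType leb)). Qed.

Lemma aeI (p q : R -> Prop) : {ae leb, forall t, p t} -> {ae leb, forall t, q t} ->
  {ae leb, forall t, p t /\ q t}.
Proof. exact: (@filterI _ _ (ae_filter_ringOfSetsType leb)). Qed.

(* The set is cut into the slices [j <= f < j + 1]. *)
Lemma integral_sqr_slices (mu : {measure set (measurableTypeR R) -> \bar R}) (f : R -> R) :
  measurable_fun setT (f : measurableTypeR R -> R) -> (forall x, 0 <= f x) ->
  (forall (j : nat),
    (j%:R%:E * \int[leb]_(x in f @^-1` `[j%:R, j.+1%:R[) (f x)%:E <= mu (f @^-1` `[j%:R, j.+1%:R[))%E) ->
  (\int[leb]_x (f x ^+ 2)%:E <= \int[leb]_x (f x)%:E + mu setT)%E.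
Proof.
move=> mf f0 hj; pose A (j : nat) : set (measurableTypeR R) := f @^-1` `[j%:R, j.+1%:R[.
have mA j : measurable (A j) by rewrite -[A j]setTI; exact: mf.
have AT : \bigcup_j A j = setT.
  apply/seteqP; split => // x _; exists (Num.truncn (f x)) => //; rewrite /A/=.
  by rewrite in_itv/= truncn_itv.
have tA : trivIset setT A.
  apply/trivIsetP => i j _ _ /eqP ij; apply/seteqP; split => // x [] /=.
  by rewrite /A/= !in_itv/= => /truncn_def fi /truncn_def fj; apply: ij; rewrite -fi -fj.
rewrite -AT (measure_bigcup mu setT)// (eq_eseriesl (Q := xpredT)); last by move=> i; rewrite in_setT.
rewrite ge0_integral_bigcup//; first last.
- by move=> x _; rewrite lee_fin sqr_ge0.
- by apply/measurable_EFinP; apply: measurable_funX; rewrite AT.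
rewrite ge0_integral_bigcup//; first last.
- by move=> x _; rewrite lee_fin.
- by apply/measurable_EFinP; rewrite AT.
rewrite -nneseriesD//; last first.
  by move=> i _ _; apply: integral_ge0 => x _; rewrite lee_fin.
apply: lee_nneseries => [i _ _|j _]; first by apply: integral_ge0 => x _; rewrite lee_fin sqr_ge0.
have mfj : measurable_fun (A j) f by exact: measurable_funS mf.
(* On the slice [f^2 <= (j + 1) f]; the part [j f] is charged to [mu] and the rest to the integral
   of [f]. *)
apply: (@le_trans _ _ (\int[leb]_(x in A j) (j.+1%:R%:E * (f x)%:E))%E).
  apply: ge0_le_integral => //.
  - by move=> x _; rewrite lee_fin sqr_ge0.
  - by apply/measurable_EFinP; exact: measurable_funX.
  - by apply/measurable_EFinP; exact: measurable_funM.
  - move=> x; rewrite /A/= in_itv/= => /andP[_ /ltW h].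
    by rewrite -EFinM lee_fin expr2 ler_wpM2r.
rewrite ge0_integralZl//; last 2 first.
- exact/measurable_EFinP.
- by move=> x _; rewrite lee_fin.
rewrite -natr1 EFinD ge0_muleDl ?lee_fin// mul1e addeC leeD2l//.
Qed.

Section density_itv.
Variables (P E : R -> R) (N : R).
Hypotheses (ndP : {homo P : x y / x <= y}) (ndE : {homo E : x y / x <= y}).
Hypothesis rcE : right_continuous E.
Hypothesis N0 : 0 <= N.
Hypothesis PE : forall k s t, 0 < k -> s <= t ->
  2 * k * (P t - P s) <= k ^+ 2 * (t - s) + (E t - E s).

(** [rho] is the Radon-Nikodym density of the Stieltjes measure of [P], restricted to []0, N]] to
    make it finite; its slopes come from Lebesgue differentiation. *)
Lemma density_itv : exists rho : R -> R,
  [/\ forall x, 0 <= rho x,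
      leb.-integrable setT (EFin \o rho),
      (\int[leb]_x (rho x ^+ 2)%:E < +oo)%E,
      forall s t, 0 <= s -> s <= t -> t <= N ->
        (\int[leb]_(x in `]s, t]) (rho x)%:E = (P t - P s)%:E)%E &
      {ae leb, forall t, 0 < t < N -> slope P t (rho t)}].
Proof.
have rcP := right_continuous_of_le ndP ndE rcE PE.
pose D : set (measurableTypeR R) := `]0, N]%classic.
have mD : measurable D by exact: measurable_itv.
have dPD : (stieltjes ndP rcP D < +oo)%E by rewrite stieltjes_itv// ltry.
have dED : (stieltjes ndE rcE D < +oo)%E by rewrite stieltjes_itv// ltry.
pose p : {finite_measure set (measurableTypeR R) -> \bar R} := mfrestr mD dPD.
pose e : {finite_measure set (measurableTypeR R) -> \bar R} := mfrestr mD dED.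
have pE A : p A = stieltjes ndP rcP (A `&` D) by [].
have eE A : e A = stieltjes ndE rcE (A `&` D) by [].
have pfin A : measurable A -> p A \is a fin_num by exact: fin_num_measure.
have efin A : measurable A -> e A \is a fin_num by exact: fin_num_measure.
have pe k A : 0 < k -> measurable A -> ((2 * k)%:E * p A <= (k ^+ 2)%:E * leb A + e A)%E.
  move=> k0 mA; rewrite pE eE.
  apply: le_trans (ac_measure_le ndP ndE rcE PE rcP k0 (measurableI _ _ mA mD)) _.
  rewrite leeD2r// lee_wpmul2l ?lee_fin ?sqr_ge0// le_measure// ?inE//; exact: measurableI.
(* Let [k] go to infinity in [pe]. *)
have p0 : p `<< leb.
  apply/null_content_dominatesP => A mA A0.
  have {}pe k : 0 < k -> 2 * k * fine (p A) <= fine (e A).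
    move=> k0; have := pe k _ k0 mA.
    by rewrite A0 mule0 add0e -(fineK (pfin _ mA)) -(fineK (efin _ mA)) -EFinM lee_fin.
  rewrite -(fineK (pfin _ mA)); congr EFin; apply/eqP; rewrite eq_le fine_ge0// andbT leNgt.
  apply/negP => pA.
  (* This [k] would give [2 (e A + p A) <= e A]. *)
  have k0 : 0 < fine (e A) / fine (p A) + 1.
    by rewrite ltr_wpDl// divr_ge0 ?fine_ge0.
  have := pe _ k0; rewrite -mulrA [X in 2 * X]mulrDl mul1r divfK ?gt_eqF//.
  have : 0 <= fine (e A) by rewrite fine_ge0.
  by move: pA; lra.
have [f [f0 ffin intf pf]] := radon_nikodym_sigma_finite p0.
pose rho x := fine (f x).
have rhoE x : (rho x)%:E = f x by rewrite /rho fineK.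
have rho0 x : 0 <= rho x by rewrite fine_ge0.
have irho : leb.-integrable setT (EFin \o rho).
  by rewrite (_ : _ \o _ = f)//; apply/funext => x /=; rewrite rhoE.
have mrho : measurable_fun setT rho by have /integrableP[/measurable_EFinP] := irho.
have prho A : measurable A -> (\int[leb]_(x in A) (rho x)%:E = p A)%E.
  by move=> mA; rewrite pf//; apply: eq_integral => x _; rewrite rhoE.
have Prho s t : 0 <= s -> s <= t -> t <= N -> (\int[leb]_(x in `]s, t]) (rho x)%:E = (P t - P s)%:E)%E.
  move=> s0 st tN; rewrite prho ?pE//.
  rewrite (_ : _ `&` _ = `]s, t]%classic) ?stieltjes_itv//.
  apply/setIidl => x; rewrite /D/= !in_itv/= => /andP[sx xt].
  by rewrite (le_lt_trans s0 sx) (le_trans xt tN).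
exists rho; split => //.
- apply: le_lt_trans (integral_sqr_slices (mu := e) mrho rho0 _) _; last first.
    by rewrite prho// -ge0_fin_numE ?adde_ge0// fin_numD pfin ?efin.
  move=> j; set A := _ @^-1` _.
  have mA : measurable A by rewrite -[A]setTI; exact: mrho.
  rewrite prho//; have [->|j0] := eqVneq j 0%N; first by rewrite mul0e.
  have {}j0 : 0 < j%:R :> R by rewrite ltr0n lt0n.
  (* With [k = j], [2 j p(A) <= j^2 |A| + e(A)]; as [rho >= j] on [A], [j^2 |A| <= j p(A)], and
     [j p(A) <= e(A)] remains. *)
  have leA : (j%:R%:E * leb A <= p A)%E.
    rewrite -prho// -integral_cst//; apply: ge0_le_integral => //.
    - by move=> x _; rewrite lee_fin ltW.
    - by apply/measurable_EFinP; exact: measurable_funS mrho.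
    - by move=> x; rewrite /A/= in_itv/= => /andP[+ _]; rewrite lee_fin.
  have : ((2 * j%:R)%:E * p A <= j%:R%:E * p A + e A)%E.
    apply: le_trans (pe _ _ j0 mA) _.
    apply: leeD2r; rewrite expr2 EFinM -muleA.
    by apply: lee_wpmul2l leA; rewrite lee_fin ltW.
  suff : ((2 * j%:R)%:E * p A <= j%:R%:E * p A + e A -> j%:R%:E * p A <= e A)%E by [].
  move: (pfin _ mA) (efin _ mA); case: (p A) => // x; case: (e A) => // y _ _.
  by rewrite -!EFinM -EFinD !lee_fin -mulrA mulr_natl mulr2n lerD2l.
- have il y : leb.-integrable `]-oo, y] (EFin \o rho) by exact: integrableS irho.
  have := FTC1Ny il (open_integrable_locally openT irho).
  apply: aeS => t -[dF Ft] /andP[t0 tN] eps eps0.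
  have FP s : 0 < s < N -> (\int[leb]_(x in `]-oo, s]) rho x)%R = P s - P 0.
    move=> /andP[s0 sN]; rewrite /Rintegral prho// pE.
    rewrite (_ : _ `&` _ = `]0, s]%classic) ?stieltjes_itv ?(ltW s0)//.
    apply/seteqP; split => x; rewrite /D/= !in_itv/=; first by move=> [-> /andP[->]].
    by move=> /andP[-> xs]; rewrite xs (le_trans xs (ltW sN)).
  have := slope_derivable dF Ft eps0.
  have n0 : \forall s \near t, 0 < s by exact: lt_nbhsr.
  have nN : \forall s \near t, s < N by exact: lt_nbhsl.
  move: n0 nN; apply: filterS3 => s s0 sN.
  rewrite !FP ?s0 ?t0//.
  by rewrite (_ : P s - P 0 - _ = P s - P t)//; ring.
Qed.

End density_itv.
End density.

Section density_global.
Context {R : realType}.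
Local Notation leb := (@lebesgue_measure R).

Lemma measurable_fun_truncn (r_ : nat -> R -> R) : (forall n, measurable_fun setT (r_ n)) ->
  measurable_fun setT (fun t : R => r_ (Num.truncn t) t).
Proof.
move=> mr; pose A (n : nat) : set (measurableTypeR R) := [set t | Num.truncn t = n].
have mle n : measurable ([set t | (Num.truncn t <= n)%N] : set (measurableTypeR R)).
  rewrite (_ : [set t | _] = `]-oo, n.+1%:R[%classic)//.
  by apply/seteqP; split => t /=; rewrite in_itv/= truncn_le_nat.
have mA n : measurable (A n).
  case: n => [|n].
    rewrite (_ : A 0%N = [set t | (Num.truncn t <= 0)%N])//.
    by apply/seteqP; split => t; rewrite /A/= leqn0 => /eqP.
  rewrite (_ : A n.+1 = [set t | (Num.truncn t <= n.+1)%N] `\` [set t | (Num.truncn t <= n)%N]).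
    exact: measurableD.
  apply/seteqP; split => t; rewrite /A/=; first by move=> ->; rewrite leqnn ltnn.
  by move=> [t1 /negP]; rewrite -ltnNge => t2; apply/eqP; rewrite eqn_leq t1 t2.
have AT : \bigcup_n A n = setT by apply/seteqP; split => // t _; exists (Num.truncn t).
rewrite -AT; apply/measurable_fun_bigcup => // n.
apply: (@eq_measurable_fun _ _ _ _ _ (r_ n)); last exact: measurable_funS (mr n).
by move=> t; rewrite inE /A/= => ->.
Qed.

Variables P E : R -> R.
Hypotheses (ndP : {homo P : x y / x <= y}) (ndE : {homo E : x y / x <= y}).
Hypothesis rcE : right_continuous E.
Hypothesis PE : forall k s t, 0 < k -> s <= t ->
  2 * k * (P t - P s) <= k ^+ 2 * (t - s) + (E t - E s).

(** The densities on []0, n + 1]] are pasted along the integer part of [t]. Two of them agree almost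
    everywhere where both apply, being slopes of the same [P]. *)
Lemma density : exists rho : R -> R,
  [/\ measurable_fun setT rho, forall x, 0 <= rho x, forall x, x <= 0 -> rho x = 0 &
   [/\ forall T, (\int[leb]_(x in `]-oo, T]) (rho x)%:E < +oo)%E,
      forall T, (\int[leb]_(x in `]-oo, T]) (rho x ^+ 2)%:E < +oo)%E,
      forall s t, 0 <= s -> s <= t ->
        (\int[leb]_(x in `]s, t]) (rho x)%:E = (P t - P s)%:E)%E &
      {ae leb, forall t, 0 < t -> slope P t (rho t)}]].
Proof.
have /choice[r_ hr] (n : nat) := density_itv ndP ndE rcE (ler0n R n.+1) PE.
pose pos : set (measurableTypeR R) := `]0, +oo[%classic.
have mpos : measurable pos by exact: measurable_itv.
have mr n : measurable_fun setT (r_ n) by have [_ /integrableP[/measurable_EFinP]] := hr n.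
(* Cut off at nonpositive times, which makes integrals over half-lines finite. *)
pose q_ n t := r_ n t * \1_pos t.
have mq n : measurable_fun setT (q_ n) by apply: measurable_funM => //; exact: measurable_indic.
have r0 n x : 0 <= r_ n x by have [] := hr n.
have q0 n x : 0 <= q_ n x by rewrite mulr_ge0.
have qr n x : q_ n x <= r_ n x by rewrite ler_piMr// indicE; case: (_ \in _).
have qz n x : x <= 0 -> q_ n x = 0.
  move=> x0; rewrite /q_ indicE memNset ?mulr0// /pos/= in_itv/= andbT.
  by apply/negP; rewrite -leNgt.
have qp n x : 0 < x -> q_ n x = r_ n x.
  by move=> x0; rewrite /q_ indicE mem_set ?mulr1// /pos/= in_itv/= x0.
pose rho t := q_ (Num.truncn t) t.
have rho0 x : 0 <= rho x by exact: q0.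
have mrho : measurable_fun setT rho by exact: measurable_fun_truncn.
have ae1 : {ae leb, forall t n, 0 < t < n.+1%:R -> slope P t (r_ n t)}.
  by apply: (@ae_foralln _ _ _ leb (fun n t => 0 < t < n.+1%:R -> slope P t (r_ n t))) => n; have [] := hr n.
have ae2 : {ae leb, forall t, 0 < t -> slope P t (rho t)}.
  by apply: aeS ae1 => t + t0; rewrite /rho qp//; apply; rewrite t0 truncnS_gt.
have ae3 : {ae leb, forall t n, t < n.+1%:R -> rho t = q_ n t}.
  apply: aeS (aeI ae1 ae2) => t -[h1 h2] n tn; have [t0|t0] := leP t 0.
    by rewrite qz// /rho qz.
  by rewrite qp//; apply: slope_unique (h2 t0) (h1 _ _); rewrite t0.
pose N (T : R) := Num.truncn T.
have ltN T x : x <= T -> x < (N T).+1%:R by move=> /le_lt_trans; apply; exact: truncnS_gt.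
exists rho; split => //; first by move=> x x0; rewrite /rho qz.
split => //.
- move=> T; have [_ /integrableP[_] + _ _ _] := hr (N T); apply: le_lt_trans.
  rewrite (@ge0_ae_eq_integral _ _ _ leb _ _ (EFin \o q_ (N T)))//; first last.
  - by apply: aeS ae3 => x h xT /=; rewrite (h (N T))// ltN.
  - by move=> x _; rewrite lee_fin.
  - by move=> x _; rewrite lee_fin q0.
  - by apply/measurable_EFinP; exact: measurable_funS (mq _).
  - by apply/measurable_EFinP; exact: measurable_funS mrho.
  apply: (@le_trans _ _ (\int[leb]_(x in `]-oo, T]) `|(r_ (N T) x)%:E|)%E).
    apply: ge0_le_integral => //.
    - by move=> x _; rewrite lee_fin.
    - by apply/measurable_EFinP; exact: measurable_funS (mq _).
    - by apply: measurableT_comp => //; apply/measurable_EFinP; exact: measurable_funS (mr _).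
    - by move=> x _; rewrite lee_fin ger0_norm.
  apply: ge0_subset_integral => //.
  by apply: measurableT_comp => //; apply/measurable_EFinP; exact: mr.
- move=> T; have [_ _ + _ _] := hr (N T); apply: le_lt_trans.
  rewrite (@ge0_ae_eq_integral _ _ _ leb _ _ (fun x => (q_ (N T) x ^+ 2)%:E))//; first last.
  - by apply: aeS ae3 => x h xT /=; rewrite (h (N T))// ltN.
  - by move=> x _; rewrite lee_fin sqr_ge0.
  - by move=> x _; rewrite lee_fin sqr_ge0.
  - by apply/measurable_EFinP/measurable_funX; exact: measurable_funS (mq _).
  - by apply/measurable_EFinP/measurable_funX; exact: measurable_funS mrho.
  apply: (@le_trans _ _ (\int[leb]_(x in `]-oo, T]) (r_ (N T) x ^+ 2)%:E)%E).
    apply: ge0_le_integral => //.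
    - by move=> x _; rewrite lee_fin sqr_ge0.
    - by apply/measurable_EFinP/measurable_funX; exact: measurable_funS (mq _).
    - by apply/measurable_EFinP/measurable_funX; exact: measurable_funS (mr _).
    - by move=> x _; rewrite lee_fin lerXn2r// nnegrE.
  apply: ge0_subset_integral => //; last by move=> x _; rewrite lee_fin sqr_ge0.
  by apply/measurable_EFinP/measurable_funX; exact: mr.
- move=> s t s0 st; have [_ _ _ + _] := hr (N t).
  move=> /(_ s t s0 st (ltW (ltN t t (lexx t)))) <-.
  apply: ge0_ae_eq_integral => //.
  - by apply/measurable_EFinP; exact: measurable_funS mrho.
  - by apply/measurable_EFinP; exact: measurable_funS (mr _).
  - by move=> x _; rewrite lee_fin q0.
  - by move=> x _; rewrite lee_fin.
  - apply: aeS ae3 => x h; rewrite /= in_itv/= => /andP[sx xt].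
    by rewrite (h (N t)) ?ltN// qp// (le_lt_trans s0 sx).
Qed.

End density_global.

(** * Right-continuous extension to the real line *)

Section control.
Context {R : realType}.
Variables F e : R -> R.
Hypothesis ndF : forall s t, 0 <= s -> s <= t -> F s <= F t.
Hypothesis nde : forall s t, 0 <= s -> s <= t -> e s <= e t.
Hypothesis Fe : forall k s t, 0 < k -> 0 <= s -> s <= t ->
  2 * (F t - F s) <= k * (t - s) + k^-1 * (e t - e s).

(** Nothing is known at negative times, while Stieltjes measures ask for functions on the whole
    line; composing with [clip] freezes the value at 0. *)
Definition clip (t : R) : R := Num.max 0 t.

Lemma clip_ge0 t : 0 <= clip t. Proof. by rewrite le_max lexx. Qed.

Lemma le_clip s t : s <= t -> clip s <= clip t.
Proof. by move=> st; rewrite ge_max clip_ge0/= le_max st orbT. Qed.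

Lemma clip_id t : 0 <= t -> clip t = t. Proof. by move=> t0; rewrite /clip max_r. Qed.

Lemma clip_lt t x : 0 < x -> t < x -> clip t < x.
Proof. by move=> x0 tx; rewrite gt_max x0. Qed.

Lemma clip_sub s t : s <= t -> clip t - clip s <= t - s.
Proof. by move=> st; rewrite /clip; case: (ltP 0 s) => s0; case: (ltP 0 t) => t0; move: st s0 t0; lra. Qed.

Lemma control_right (x d : R) : 0 <= x -> 0 < d ->
  exists2 h, 0 < h & forall y, x <= y -> y <= x + h -> F y <= F x + d.
Proof.
move=> x0 d0; set A := e (x + 1) - e x.
have A0 : 0 <= A by rewrite subr_ge0 nde// lerDl.
(* [A] bounds the increment of [e] on [[x, x + 1]], so this [k] makes the [e] term at most [d]; the
   length [d / k] does the same for the other term. *)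
pose k := (A + 1) / d; have k0 : 0 < k by rewrite divr_gt0// ltr_wpDl.
have dk0 : 0 < d / k by rewrite divr_gt0.
exists (Num.min 1 (d / k)); first by rewrite lt_min ltr01.
move=> y xy yh; have := Fe k0 x0 xy.
have y1 : y <= x + 1 by apply: le_trans yh _; rewrite lerD2l ge_min lexx.
have yk : y <= x + d / k by apply: le_trans yh _; rewrite lerD2l ge_min lexx orbT.
have h1 : k * (y - x) <= d by rewrite mulrC -ler_pdivlMr// lerBlDl.
have h2 : k^-1 * (e y - e x) <= d.
  apply: (@le_trans _ _ (k^-1 * A)).
    by rewrite ler_wpM2l ?invr_ge0 ?(ltW k0)// lerD2r nde// (le_trans x0).
  rewrite mulrC ler_pdivrMr// /k mulrC divfK ?gt_eqF// lerDl.
  exact: ler01.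
by move: h1 h2; lra.
Qed.

(* The right-continuous version of [e] on [0, +oo[. *)
Definition right_inf (t : R) : R := inf [set e r | r in [set r | clip t < r]].

Let has_inf_right t : has_inf [set e r | r in [set r | clip t < r]].
Proof.
split; first by exists (e (clip t + 1)), (clip t + 1) => //=; rewrite ltrDl.
exists (e (clip t)) => _ [r /= tr <-]; apply: nde => //; first exact: clip_ge0.
exact: ltW.
Qed.

Lemma right_inf_le t r : clip t < r -> right_inf t <= e r.
Proof. by move=> tr; apply: ge_inf; [exact: (has_inf_right t).2|exists r]. Qed.

Lemma right_inf_lt t d : 0 < d -> exists2 r, clip t < r & e r < right_inf t + d.
Proof.
by move=> d0; have [_ [r /= tr <-] h] := inf_adherent d0 (has_inf_right t); exists r.
Qed.

Lemma right_inf_nd : {homo right_inf : x y / x <= y}.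
Proof.
move=> s t st; apply/ler_addgt0Pr => d d0.
have [r tr h] := right_inf_lt t d0.
by apply: le_trans (ltW h); apply: right_inf_le; apply: le_lt_trans tr; exact: le_clip.
Qed.

Lemma right_inf_rc : right_continuous right_inf.
Proof.
move=> t; apply/cvgrPdist_lt => d d0.
have [r tr h] := right_inf_lt t d0.
have r0 : 0 < r by apply: le_lt_trans tr; exact: clip_ge0.
have tr' : t < r by apply: le_lt_trans tr; rewrite le_max lexx orbT.
near=> y.
have ty : t <= y by apply: ltW; near: y; exact: nbhs_right_gt.
have yr : y < r by near: y; exact: nbhs_right_lt.
rewrite distrC ger0_norm ?subr_ge0 ?right_inf_nd// ltrBlDl.
by apply: le_lt_trans h; apply: right_inf_le; exact: clip_lt.
Unshelve. all: by end_near. Qed.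

(** The inequality is applied to both endpoints shifted right by a small [h]: there [e] is close to
    [right_inf t] from above and at least [right_inf s], and right-continuity of [F] at [clip s]
    absorbs the shift. *)
Lemma right_inf_control (k s t : R) : 0 < k -> s <= t ->
  2 * k * (F (clip t) - F (clip s)) <= k ^+ 2 * (t - s) + (right_inf t - right_inf s).
Proof.
move=> k0 st; apply/ler_addgt0Pr => d d0.
have d2 : 0 < d / 2 by rewrite divr_gt0.
have dk : 0 < d / 2 / (2 * k) by rewrite divr_gt0// mulr_gt0.
have [r tr er] := right_inf_lt t d2.
have [h0 h00 Fh] := control_right (clip_ge0 s) dk.
pose h := Num.min h0 (r - clip t).
have hp : 0 < h by rewrite lt_min h00 subr_gt0.
have cst := le_clip st; have s0 := clip_ge0 s.
have sh : clip s + h <= clip t + h by rewrite lerD2r.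
have sh0 : 0 <= clip s + h by rewrite addr_ge0// ltW.
have := Fe k0 sh0 sh.
rewrite -(ler_pM2l k0) [leRHS]mulrDr [in leRHS]mulrA mulVKf ?gt_eqF// -expr2 mulrA [k * 2]mulrC.
have -> : clip t + h - (clip s + h) = clip t - clip s by ring.
have h1 : e (clip t + h) <= right_inf t + d / 2.
  apply: le_trans (ltW er); apply: nde; first by rewrite addr_ge0 ?clip_ge0// ltW.
  by rewrite -lerBrDl ge_min lexx orbT.
have h2 : right_inf s <= e (clip s + h) by apply: right_inf_le; rewrite ltrDl.
have h3 : F (clip s + h) <= F (clip s) + d / 2 / (2 * k).
  by apply: Fh; rewrite ?lerDl ?(ltW hp)// lerD2l ge_min lexx.
have h4 : F (clip t) <= F (clip t + h) by apply: ndF; rewrite ?clip_ge0// lerDl ltW.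
have h5 : k ^+ 2 * (clip t - clip s) <= k ^+ 2 * (t - s).
  by rewrite ler_wpM2l ?sqr_ge0// clip_sub.
have h6 : 2 * k * (F (clip t) - F (clip s)) <= 2 * k * (F (clip t + h) - F (clip s + h)) + d / 2.
  rewrite -[d / 2 in leRHS](@mulfVK _ (2 * k)) ?gt_eqF ?mulr_gt0//.
  rewrite [d / 2 / (2 * k) * _]mulrC -mulrDr ler_wpM2l ?mulr_ge0 ?(ltW k0)//.
  by move: h3 h4; lra.
move: h1 h2 h5 h6; set A := k ^+ 2 * _; set B := k ^+ 2 * _.
by set a := 2 * k * _; set b := 2 * k * _; move: a b A B => a b A B; lra.
Qed.

End control.

(** * Existence of the metric derivative *)

Section metric.
Context {R : realType}.
Local Notation leb := (@lebesgue_measure R).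

Lemma slope_le (f g : R -> R) t a b : slope f t a -> slope g t b ->
  (\forall s \near t, `|f s - f t| <= `|g s - g t|) -> `|a| <= `|b|.
Proof.
move=> fa gb fg; apply/ler_addgt0Pr => e e0.
have e2 : 0 < e / 2 by rewrite divr_gt0.
have h1 : \forall s \near t^'+, `|f s - f t - a * (s - t)| <= e / 2 * `|s - t|.
  exact: cvg_within (fa _ e2).
have h2 : \forall s \near t^'+, `|g s - g t - b * (s - t)| <= e / 2 * `|s - t|.
  exact: cvg_within (gb _ e2).
have h3 : \forall s \near t^'+, `|f s - f t| <= `|g s - g t| by exact: cvg_within fg.
near t^'+ => s.
have u0 : 0 < s - t by rewrite subr_gt0; near: s; exact: nbhs_right_gt.
rewrite -(ler_pM2r u0) mulrDl -{1 2}(gtr0_norm u0) -!normrM.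
have k1 : `|a * (s - t)| <= `|f s - f t| + e / 2 * (s - t).
  rewrite [a * _](_ : _ = (f s - f t) - (f s - f t - a * (s - t))); last by ring.
  apply: le_trans (ler_normB _ _) _; rewrite lerD2l -[in leRHS](gtr0_norm u0).
  by near: s.
have k2 : `|g s - g t| <= `|b * (s - t)| + e / 2 * (s - t).
  rewrite [g s - g t](_ : _ = (b * (s - t)) + (g s - g t - b * (s - t))); last by ring.
  apply: le_trans (ler_normD _ _) _; rewrite lerD2l -[in leRHS](gtr0_norm u0).
  by near: s.
have k3 : `|f s - f t| <= `|g s - g t| by near: s.
have -> : e * (s - t) = e / 2 * (s - t) + e / 2 * (s - t) by rewrite -mulrDl -splitr.
by move: k1 k2 k3; lra.
Unshelve. all: by end_near. Qed.

Variables (D : R -> R -> R) (F e : R -> R).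
Hypothesis D0 : forall s t, 0 <= s -> 0 <= t -> 0 <= D s t.
Hypothesis Dsym : forall s t, 0 <= s -> 0 <= t -> D s t = D t s.
Hypothesis Drefl : forall t, 0 <= t -> D t t = 0.
Hypothesis Dtri : forall r s t, 0 <= r -> 0 <= s -> 0 <= t -> D r t <= D r s + D s t.
Hypothesis DF : forall s t, 0 <= s -> s <= t -> D s t <= F t - F s.
Hypothesis nde : forall s t, 0 <= s -> s <= t -> e s <= e t.
Hypothesis Fe : forall k s t, 0 < k -> 0 <= s -> s <= t ->
  2 * (F t - F s) <= k * (t - s) + k^-1 * (e t - e s).

Let ndF s t : 0 <= s -> s <= t -> F s <= F t.
Proof. by move=> s0 st; rewrite -subr_ge0; apply: le_trans (DF s0 st); rewrite D0// (le_trans s0). Qed.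

Let Dle s t q : 0 <= q -> 0 <= s -> 0 <= t -> `|D q t - D q s| <= D s t.
Proof.
move=> q0 s0 t0; have h1 := Dtri q0 s0 t0; have := Dtri q0 t0 s0.
by rewrite (Dsym t0 s0) ler_norml => h2; apply/andP; split; move: h1 h2; lra.
Qed.

Let Dlip q s t : 0 <= q -> 0 <= s -> s <= t -> `|D q t - D q s| <= F t - F s.
Proof.
by move=> q0 s0 st; apply: le_trans (DF s0 st); rewrite Dle// (le_trans s0).
Qed.

Lemma metric_derivative : exists g : R -> R,
  [/\ measurable_fun setT g, forall x, 0 <= g x &
   [/\ forall T, leb.-integrable `]-oo, T] (EFin \o g),
      forall T, (\int[leb]_(x in `]-oo, T]) (g x ^+ 2)%:E < +oo)%E,
      forall s t, 0 <= s -> s <= t -> ((D s t)%:E <= \int[leb]_(x in `]s, t]) (g x)%:E)%E &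
      {ae leb, forall t : R, 0 < t -> forall eps : R, 0 < eps ->
        \forall s \near t, `|D s t - g t * `|s - t| | <= eps * `|s - t|}]].
Proof.
pose Fc t := F (clip t); pose E := right_inf e.
have ndFc : {homo Fc : x y / x <= y}.
  by move=> x y xy; apply: ndF; [exact: clip_ge0|exact: le_clip].
have ndE : {homo E : x y / x <= y} by exact: right_inf_nd.
have rcE : right_continuous E by exact: right_inf_rc.
have FE k s t : 0 < k -> s <= t -> 2 * k * (Fc t - Fc s) <= k ^+ 2 * (t - s) + (E t - E s).
  by move=> k0 st; exact: right_inf_control.
have [rho [mrho rho0 rhoz [irho irho2 Frho aerho]]] := density ndFc ndE rcE FE.
pose q_ (n : nat) : R := clip (ratr (odflt 0%Q (unpickle n))).
have q0 n : 0 <= q_ n by exact: clip_ge0.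
have qdense (x y : R) : 0 <= x -> x < y -> exists n, x < q_ n < y.
  move=> x0 /rat_in_itvoo[q]; rewrite in_itv/= => /andP[xq qy].
  by exists (pickle q); rewrite /q_ pickleK/= clip_id ?xq// ltW// (le_lt_trans x0).
(* The distance to a fixed point of the curve is not monotone; adding [Fc], which dominates its
   increments, makes it so. *)
pose P_ n t := D (q_ n) (clip t) + Fc t.
(* The increments of [P_ n] are at most twice those of [Fc]; the inequality for [Fc] at [k / 2],
   multiplied by 4, gives [k^2 (t - s)] and [4 E]. *)
pose E4 t := 4 * E t.
have h_lip n s t : s <= t -> `|D (q_ n) (clip t) - D (q_ n) (clip s)| <= Fc t - Fc s.
  by move=> st; apply: Dlip; rewrite ?clip_ge0// le_clip.
have ndP n : {homo P_ n : x y / x <= y}.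
  by move=> x y xy; have := h_lip n _ _ xy; rewrite ler_norml /P_ => /andP[+ _]; lra.
have ndE4 : {homo E4 : x y / x <= y} by move=> x y xy; rewrite /E4 ler_wpM2l// ndE.
have rcE4 : right_continuous E4.
  by move=> x; apply: cvgM; [exact: cvg_cst|exact: rcE].
have PE n k s t : 0 < k -> s <= t -> 2 * k * (P_ n t - P_ n s) <= k ^+ 2 * (t - s) + (E4 t - E4 s).
  move=> k0 st; have k2 : 0 < k / 2 by rewrite divr_gt0.
  have := FE _ _ _ k2 st; have := h_lip n _ _ st; rewrite ler_norml => /andP[_ h1] h2.
  have h3 : 2 * k * (P_ n t - P_ n s) <= 4 * (2 * (k / 2) * (Fc t - Fc s)).
    have -> : 4 * (2 * (k / 2) * (Fc t - Fc s)) = 2 * k * (2 * (Fc t - Fc s)) by field.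
    by rewrite ler_wpM2l ?mulr_ge0 ?(ltW k0)// /P_; move: h1; lra.
  apply: le_trans h3 _; rewrite -(ler_pM2l (_ : 0 < 4)) in h2 => //.
  apply: le_trans h2 _; rewrite /E4.
  have -> : 4 * ((k / 2) ^+ 2 * (t - s) + (E t - E s)) = k ^+ 2 * (t - s) + 4 * (E t - E s) by field.
  by rewrite (mulrBr 4).
have /choice[p_ hp] n := density (ndP n) ndE4 rcE4 (PE n).
pose r_ n t := p_ n t - rho t.
(* The minimum changes nothing almost everywhere, but makes the supremum finite at every [t] and
   dominated by [rho]. *)
pose m_ n t := Num.min `|r_ n t| (rho t).
have m0 n t : 0 <= m_ n t by rewrite le_min normr_ge0 rho0.
have mle n t : m_ n t <= rho t by rewrite ge_min lexx orbT.
pose g t := sups (fun n => m_ n t) 0.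
have mub t : has_ubound (range (m_ ^~ t)) by exists (rho t) => _ [n _ <-].
have gE t : g t = sup (range (m_ ^~ t)).
  by rewrite /g /sups/= /sdrop; congr sup; apply/seteqP; split => x [n _ <-]; exists n.
have mg n t : m_ n t <= g t by rewrite gE; apply: ub_le_sup; [exact: mub|exists n].
have g0 t : 0 <= g t by exact: le_trans (mg 0%N t).
have grho t : g t <= rho t.
  by rewrite gE; apply: ge_sup; [exists (m_ 0%N t), 0%N|move=> _ [n _ <-]].
have mp n : measurable_fun setT (p_ n) by have [] := hp n.
have mmg : measurable_fun setT g.
  apply: measurable_fun_sups => // n; apply: measurable_minr => //.
  by apply: measurableT_comp => //; exact: measurable_funB.
have ig T : (\int[leb]_(x in `]-oo, T]) (g x)%:E < +oo)%E.
  apply: le_lt_trans (irho T); apply: ge0_le_integral => //.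
  - by move=> x _; rewrite lee_fin.
  - by apply/measurable_EFinP; exact: measurable_funS mmg.
  - by apply/measurable_EFinP; exact: measurable_funS mrho.
  - by move=> x _; rewrite lee_fin.
have ig2 T : (\int[leb]_(x in `]-oo, T]) (g x ^+ 2)%:E < +oo)%E.
  apply: le_lt_trans (irho2 T); apply: ge0_le_integral => //.
  - by move=> x _; rewrite lee_fin sqr_ge0.
  - by apply/measurable_EFinP/measurable_funX; exact: measurable_funS mmg.
  - by apply/measurable_EFinP/measurable_funX; exact: measurable_funS mrho.
  - by move=> x _; rewrite lee_fin lerXn2r// nnegrE.
have aeh : {ae leb, forall (t : R) n, 0 < t -> slope (fun s => D (q_ n) (clip s)) t (r_ n t)}.
  apply: (@ae_foralln _ _ _ leb (fun n (t : R) => 0 < t -> slope (fun s => D (q_ n) (clip s)) t (r_ n t))) => n.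
  have [_ _ _ [_ _ _ aep]] := hp n.
  apply: aeS (aeI aep aerho) => t -[h1 h2] t0.
  have := slopeD (h1 t0) (slopeN (h2 t0)).
  by rewrite /P_ (_ : (fun x => _ + _) = (fun s => D (q_ n) (clip s)))//; apply/funext => s; rewrite addrK.
have aer : {ae leb, forall (t : R) n, 0 < t -> `|r_ n t| <= g t}.
  apply: aeS (aeI aeh aerho) => t -[h1 h2] n t0.
  have : `|r_ n t| <= `|rho t|.
    apply: slope_le (h1 n t0) (h2 t0) _; apply: (@filterE R (nbhs t)) => s.
    have [st|/ltW st] := leP s t.
      by rewrite -normrN opprB (le_trans (h_lip n _ _ st))// -normrN opprB ler_norm.
    by rewrite (le_trans (h_lip n _ _ st))// ler_norm.
  rewrite (ger0_norm (rho0 t)) => rr.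
  by apply: le_trans (mg n t); rewrite le_min lexx.
have intg n t : q_ n <= t -> ((D (q_ n) t)%:E <= \int[leb]_(x in `]q_ n, t]) (g x)%:E)%E.
  move=> qt; have [_ p0 _ [_ _ pint _]] := hp n.
  have tq : 0 <= t := le_trans (q0 n) qt.
  have mI (f : R -> R) : measurable_fun setT f -> measurable_fun `]q_ n, t]%classic (EFin \o f).
    by move=> mf; apply/measurable_EFinP; exact: measurable_funS mf.
  (* The left side is [D (q_ n) t + F t - F (q_ n)] and the integral of [rho] is [F t - F (q_ n)],
     which cancels. *)
  have : (\int[leb]_(x in `]q_ n, t]) (p_ n x)%:E <= \int[leb]_(x in `]q_ n, t]) ((g x)%:E + (rho x)%:E))%E.
    apply: ae_ge0_le_integral => //.
    - by move=> x _; rewrite lee_fin.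
    - exact: mI.
    - by move=> x _; rewrite adde_ge0// lee_fin.
    - by apply: emeasurable_funD; exact: mI.
    - apply: aeS aer => x h; rewrite /= in_itv/= => /andP[qx _].
      rewrite -EFinD lee_fin -lerBlDr; apply: le_trans (h n _); first exact: ler_norm.
      exact: le_lt_trans (q0 n) qx.
  rewrite ge0_integralD//; first last.
  - exact: mI.
  - by move=> x _; rewrite lee_fin.
  - exact: mI.
  - by move=> x _; rewrite lee_fin.
  rewrite pint// Frho// /P_ /Fc !clip_id// Drefl// -/(Fc t).
  have : (0 <= \int[leb]_(x in `]q_ n, t]) (g x)%:E)%E by apply: integral_ge0 => x _; rewrite lee_fin.
  case: (\int[leb]_(x in `]q_ n, t]) (g x)%:E)%E => [x _|_ _|//]; last by rewrite leey.
  by rewrite -EFinD !lee_fin; lra.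
have Dg s t : 0 <= s -> s <= t -> ((D s t)%:E <= \int[leb]_(x in `]s, t]) (g x)%:E)%E.
  move=> s0 st; move: (st); rewrite le_eqVlt => /predU1P[<-|lst].
    by rewrite Drefl// set_itvoc0 integral_set0.
  apply/lee_addgt0Pr => d d0.
  (* A rational time slightly to the right of [s] replaces [s], at a cost of at most [d] by
     right-continuity of [F]. *)
  have [h h0 hF] := control_right nde Fe s0 d0.
  have [||n] := qdense s (Num.min t (s + h)) => //.
    by rewrite lt_min lst ltrDl.
  rewrite lt_min => /and3P[sq qt qh].
  have h1 : D s t <= d + D (q_ n) t.
    apply: le_trans (Dtri s0 (q0 n) (le_trans s0 st)) _; rewrite lerD2r.
    apply: le_trans (DF s0 (ltW sq)) _; rewrite lerBlDl.
    by apply: hF; exact: ltW.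
  apply: (@le_trans _ _ (d%:E + (D (q_ n) t)%:E)%E); first by rewrite -EFinD lee_fin.
  rewrite addeC leeD2r//; apply: le_trans (intg n t (ltW qt)) _.
  apply: ge0_subset_integral => //.
  - by apply/measurable_EFinP; exact: measurable_funS mmg.
  - by move=> x _; rewrite lee_fin.
  - by apply: subset_itvr; rewrite bnd_simp ltW.
have Lg T : leb.-integrable `]-oo, T] (EFin \o g).
  apply/integrableP; split; first by apply/measurable_EFinP; exact: measurable_funS mmg.
  by under eq_integral do rewrite /= ger0_norm//.
exists g; split => //; split => //.
pose G x := (\int[leb]_(t in `]-oo, x]) g t)%R.
have DG s t : 0 <= s -> s <= t -> D s t <= G t - G s.
  move=> s0 st; rewrite /G (Rintegral_itvB (Lg t)) ?bnd_simp//.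
  rewrite /Rintegral -lee_fin fineK ?Dg//.
  rewrite ge0_fin_numE ?integral_ge0// => [|x _]; last by rewrite lee_fin.
  apply: le_lt_trans (ig t); apply: ge0_subset_integral => //.
  - by apply/measurable_EFinP; exact: measurable_funS mmg.
  - by move=> x _; rewrite lee_fin.
  - exact: subset_itvr.
have aeG : {ae leb, forall t : R, slope G t (g t)}.
  apply: aeS (FTC1Ny Lg _) => [t [dG Gt]|]; first exact: slope_derivable dG Gt.
  split => //; first exact: openT.
  move=> K _ cK; have [M [_ hM]] := compact_bounded cK.
  have KM : K `<=` `]-oo, M + 1].
    move=> x Kx; rewrite /= in_itv/=; apply: le_trans (ler_norm _) _.
    by apply: (hM _ _ x Kx); rewrite ltrDl.
  apply: le_lt_trans (ig (M + 1)).
  under eq_integral do rewrite ger0_norm//.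
  apply: ge0_subset_integral => //.
  - exact: compact_measurable.
  - by apply/measurable_EFinP; exact: measurable_funS mmg.
  - by move=> x _; rewrite lee_fin.
(* From above, [D s t] is at most the increment of the primitive [G], of slope [g t]. From below, it
   is at least the increment of the distance to [q_ n], with [n] chosen so that
   [|r_ n t| > g t - eps / 2]. *)
apply: aeS (aeI aeh aeG) => t -[ht hG] t0 eps eps0.
have n0 : \forall s \near t, 0 < s by exact: lt_nbhsr.
have e2 : 0 < eps / 2 by rewrite divr_gt0.
have hs : has_sup (range (m_ ^~ t)) by split; [exists (m_ 0%N t), 0%N|exact: mub].
have [_ [n _ <-] gn] := sup_adherent e2 hs.
rewrite -gE in gn.
have {}gn : g t - eps / 2 < `|r_ n t| by apply: lt_le_trans gn _; rewrite ge_min lexx.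
have h1 := hG _ eps0; have h2 := ht n t0 _ e2.
move: n0 h1 h2; apply: filterS3 => s s0 h1 h2.
have up : D s t <= `|G s - G t|.
  have [st|/ltW st] := leP s t.
    by rewrite -normrN opprB (le_trans (DG _ _ (ltW s0) st))// ler_norm.
  by rewrite (Dsym (ltW s0) (ltW t0)) (le_trans (DG _ _ (ltW t0) st))// ler_norm.
have low : `|D (q_ n) (clip s) - D (q_ n) (clip t)| <= D s t.
  rewrite (clip_id (ltW s0)) (clip_id (ltW t0)) (Dsym (ltW s0) (ltW t0)).
  exact: Dle (q0 n) (ltW t0) (ltW s0).
have u1 : `|G s - G t| <= g t * `|s - t| + eps * `|s - t|.
  rewrite [G s - G t](_ : _ = g t * (s - t) + (G s - G t - g t * (s - t))); last by ring.
  by apply: le_trans (ler_normD _ _) _; rewrite normrM (ger0_norm (g0 t)) lerD2l.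
have u2 : `|r_ n t| * `|s - t| <= `|D (q_ n) (clip s) - D (q_ n) (clip t)| + eps / 2 * `|s - t|.
  rewrite -normrM [r_ n t * _](_ : _ = (D (q_ n) (clip s) - D (q_ n) (clip t)) -
    (D (q_ n) (clip s) - D (q_ n) (clip t) - r_ n t * (s - t))); last by ring.
  by apply: le_trans (ler_normB _ _) _; rewrite lerD2l.
have u3 : (g t - eps / 2) * `|s - t| <= `|r_ n t| * `|s - t| by rewrite ler_wpM2r// ltW.
rewrite ler_norml; apply/andP; split; last by move: up u1; lra.
have -> : eps * `|s - t| = eps / 2 * `|s - t| + eps / 2 * `|s - t| by rewrite -mulrDl -splitr.
by move: u2 u3 low; rewrite mulrBl; lra.
Qed.

End metric.

(** * Regularity of the limit curve and convergence *)

Section conclusion.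
Context {R : realType} {d : nat}.
Local Notation leb := (@lebesgue_measure R).

Lemma control_AC2_loc (mu : R -> borel_prob R d) (F e : R -> R) :
  (forall t, 0 <= t -> P2 (mu t)) ->
  (forall s t, 0 <= s -> s <= t -> w2 (mu s) (mu t) <= F t - F s) ->
  (forall k s t, 0 < k -> 0 <= s -> s <= t ->
    2 * (F t - F s) <= k * (t - s) + k^-1 * (e t - e s)) ->
  (forall s t, 0 <= s -> s <= t -> e s <= e t) ->
  AC2_loc mu.
Proof.
move=> mu2 muF Fe nde; pose D s t := w2 (mu s) (mu t).
have D0 s t : 0 <= s -> 0 <= t -> 0 <= D s t by move=> s0 t0; apply: w2_ge0; exact: mu2.
have Dsym s t : 0 <= s -> 0 <= t -> D s t = D t s by move=> s0 t0; apply: w2_sym; exact: mu2.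
have Drefl t : 0 <= t -> D t t = 0 by move=> t0; apply: w2_refl; exact: mu2.
have Dtri r s t : 0 <= r -> 0 <= s -> 0 <= t -> D r t <= D r s + D s t.
  by move=> r0 s0 t0; apply: w2_triangle; exact: mu2.
have [g [mg g0 [ig ig2 Dg aeg]]] := metric_derivative D0 Dsym Drefl Dtri muF nde Fe.
have mgT T : measurable_fun (`[0, T] : set R) g by exact: measurable_funS mg.
split => //; [exists g|exists g].
- by move=> T T0; apply: integrableS (ig T) => //; exact: subset_itvr.
- move=> s t s0 st; rewrite (W2_w2 (mu2 _ s0) (mu2 _ (le_trans s0 st))).
  apply: le_trans (Dg _ _ s0 st) _; apply: ge0_subset_integral => //.
  + by apply/measurable_EFinP; exact: measurable_funS mg.
  + by move=> x _; rewrite lee_fin.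
  + exact: subset_itv_oc_cc.
- apply: aeS aeg => t + t0 => /(_ t0) h.
  have n0 : \forall s \near t^', 0 < s by exact: cvg_within (lt_nbhsr t0).
  have h' eps : 0 < eps -> \forall s \near t^', `|D s t - g t * `|s - t| | <= eps * `|s - t|.
    by move=> eps0; exact: cvg_within (h _ eps0).
  apply: (@cvg_trans _ ((D s t * `|s - t|^-1)%:E @[s --> t^'])).
    apply: near_eq_cvg; near=> s.
    by rewrite (W2_w2 (mu2 _ _) (mu2 _ (ltW t0))) ?EFinM// ltW//; near: s.
  apply: cvg_EFin; first by apply: (@filterE R (t^')).
  apply/cvgrPdist_le => eps eps0; near=> s.
  have st : s != t by near: s; exact: nbhs_dnbhs_neq.
  have st0 : 0 < `|s - t| by rewrite normr_gt0 subr_eq0.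
  have hs : `|D s t - g t * `|s - t| | <= eps * `|s - t| by near: s; exact: h'.
  rewrite /= distrC -(ler_pM2r st0); apply: le_trans hs.
  rewrite -[X in _ * X <= _]normr_id -normrM.
  by rewrite mulrBl divfK ?gt_eqF.
- move=> T T0; split => //.
  apply: le_lt_trans (ig2 T); apply: ge0_subset_integral => //.
  + by apply/measurable_EFinP/measurable_funX; exact: measurable_funS mg.
  + by move=> x _; rewrite lee_fin sqr_ge0.
  + exact: subset_itvr.
Unshelve. all: by end_near. Qed.

End conclusion.

Theorem proposition4p2p2 (R : realType) (d : nat) (W : 'rV[R]_d -> R)
    (mu0 : borel_prob R d)
    (hA : assumption_A W) (hB : assumption_B W) (hC : assumption_C' W)
    (hmu0 : P2 mu0)
    (tau0 : R) (htau0 : 0 < tau0)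
    (mutau : R -> R -> borel_prob R d)
    (hmutau : forall tau : R, 0 < tau -> tau < tau0 ->
       exists2 M : nat -> borel_prob R d,
         mm_scheme W mu0 tau M & pwc_interpolation tau M (mutau tau)) :
  exists (tau_ : nat -> R) (mu : R -> borel_prob R d),
    [/\ forall n, 0 < tau_ n < tau0,
        decreasing_seq tau_,
        tau_ n @[n --> \oo] --> (0 : R),
        AC2_loc mu &
        forall t : R, 0 <= t -> narrow_cvg (fun n => mutau (tau_ n) t) (mu t)].
Proof.
have [tau1 [B [tau1_gt0 ctrl]]] := scheme_control hA hB hC hmu0.
(* Below [tau0] the scheme is given, below [tau1] the estimates hold, and [compactness] asks for
   steps at most 1. *)
pose a := Num.min 1 (Num.min tau0 tau1).
have a0 : 0 < a by rewrite !lt_min ltr01 htau0.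
(* The shift by 2 makes even [sigma 0] strictly smaller than [a]. *)
pose sigma (n : nat) : R := a / n.+2%:R.
have sigma_gt0 n : 0 < sigma n by rewrite divr_gt0.
have sigma_lt n : sigma n < a.
  by rewrite ltr_pdivrMr// ltr_pMr// ltr1n.
have sigma1 n : sigma n <= 1 by apply: le_trans (ltW (sigma_lt n)) _; rewrite ge_min lexx.
have sigma_tau0 n : sigma n < tau0.
  by apply: lt_le_trans (sigma_lt n) _; rewrite !ge_min lexx orbT.
have sigma_tau1 n : sigma n < tau1.
  by apply: lt_le_trans (sigma_lt n) _; rewrite !ge_min lexx !orbT.
have sigma_cvg : sigma n @[n --> \oo] --> (0 : R).
  rewrite -(mulr0 a); apply: cvgM; first exact: cvg_cst.
  apply: (@cvg_comp _ _ _ S (@harmonic R)) (@cvg_harmonic R).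
  by move=> A [n _ nA]; exists n => // k /= nk; apply: nA; exact: leqW.
have /choice[FE hFE] n : exists Fe : (R -> R) * (R -> R),
    action_control (sigma n) (mutau (sigma n)) Fe.1 Fe.2 B.
  have [M hM1 hM2] := hmutau _ (sigma_gt0 n) (sigma_tau0 n).
  have [F [e h]] := ctrl _ _ _ (sigma_gt0 n) (sigma_tau1 n) hM1 hM2.
  by exists (F, e).
have [phi [mu [F [e [hphi mu2 cvg_mu muF [Fe nde]]]]]] := compactness sigma1 sigma_cvg hFE.
have phi_homo : {homo phi : m n / (m < n)%N} by exact: homo_ltn ltn_trans hphi.
have phi_ge n : (n <= phi n)%N by elim: n => // n ih; exact: leq_ltn_trans ih (hphi n).
have phi_mono : {mono phi : m n / (m <= n)%N} by exact: leq_mono.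
exists (sigma \o phi), mu; split => //.
- by move=> n /=; rewrite sigma_gt0 sigma_tau0.
- move=> m n /=; rewrite /sigma ler_pM2l// lef_pV2 ?posrE ?ltr0n// ler_nat !ltnS.
  exact: phi_mono.
- apply: cvg_comp sigma_cvg => A [n _ nA]; exists n => // k /= nk; apply: nA => /=.
  exact: leq_trans nk (phi_ge k).
- exact: control_AC2_loc mu2 muF Fe nde.
Qed.
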